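(* Let $f=h+\overline{g}$ be a harmonic mapping in the unit disk $\mathbb{D}$, with $h,g$ analytic in $\mathbb{D}$. Then $f$ is uniformly locally univalent in $\mathbb{D}$ if and only if $\|T_f\|<\infty$.
   Context: $\mathbb{D}=\{z\in\mathbb{C}:|z|<1\}$. A harmonic mapping is a complex-valued harmonic function; on $\mathbb{D}$ it is written $f=h+\overline{g}$ with $h,g$ analytic in $\mathbb{D}$. The hyperbolic distance is $d_h(z,w)=\frac12\log\frac{1+\left|\frac{z-w}{1-\overline{z}w}\right|}{1-\left|\frac{z-w}{1-\overline{z}w}\right|}$ for $z,w\in\mathbb{D}$, and $D_h(a,\rho)=\{z\in\mathbb{D}: d_h(z,a)<\rho\}$. (The subscript $h$ here is unrelated to the analytic part $h$ of $f$.) $f$ is uniformly locally univalent in $\mathbb{D}$ if there is $\rho$ with $0<\rho\le\infty$, independent of the center, such that $f$ is univalent (injective) in $D_h(a,\rho)$ for every $a\in\mathbb{D}$. The pre-Schwarzian norm of $f=h+\overline g$ is $$\|T_f\|=\sup_{z\in\mathbb{D},\ \theta\in[0,2\pi]}(1-|z|^2)\left|\frac{h''(z)+e^{i\theta}g''(z)}{h'(z)+e^{i\theta}g'(z)}\right|,$$ with the convention that $\|T_f\|=\infty$ if $h'+e^{i\theta}g'$ vanishes at some point of $\mathbb{D}$ for some $\theta$. *)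

(* Defs.v *)
From Stdlib Require Import Reals ClassicalEpsilon.
From Coquelicot Require Import Coquelicot.

Open Scope R_scope.

Definition in_disk (z : C) : Prop := Cmod z < 1.

(* Complex differentiability: the scalars are [C_AbsRing], not the reals. *)
Definition analytic_in_disk (h : C -> C) : Prop :=
  forall z : C, in_disk z -> @ex_derive C_AbsRing C_NormedModule h z.

(* Functions on the disk are represented by total functions on [C]; the values
   outside the disk are irrelevant.  Harmonicity of [f] is a consequence of the
   decomposition. *)
Definition harmonic_mapping (f h g : C -> C) : Prop :=
  analytic_in_disk h /\ analytic_in_disk g /\
  forall z : C, in_disk z -> f z = (h z + Cconj (g z))%C.

Definition pseudo_hyp_dist (z w : C) : R :=
  Cmod ((z - w) / (1 - Cconj z * w))%C.

Definition hyp_dist (z w : C) : R :=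
  / 2 * ln ((1 + pseudo_hyp_dist z w) / (1 - pseudo_hyp_dist z w)).

(* The radius may be [p_infty], in which case the disk is the whole unit disk. *)
Definition hyp_disk (a : C) (rho : Rbar) (z : C) : Prop :=
  in_disk z /\ Rbar_lt (hyp_dist z a) rho.

Definition univalent_on (f : C -> C) (D : C -> Prop) : Prop :=
  forall z w : C, D z -> D w -> f z = f w -> z = w.

Definition uniformly_locally_univalent (f : C -> C) : Prop :=
  exists rho : Rbar, Rbar_lt 0 rho /\
    forall a : C, in_disk a -> univalent_on f (hyp_disk a rho).

Definition expi (theta : R) : C := (cos theta, sin theta).

Definition rotated_sum (theta : R) (u v : C) : C := (u + expi theta * v)%C.

Definition pre_schwarzian_value (h g : C -> C) (z : C) (theta : R) : R :=
  (1 - Cmod z ^ 2) *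
  Cmod (rotated_sum theta (C_derive (C_derive h) z) (C_derive (C_derive g) z) /
        rotated_sum theta (C_derive h z) (C_derive g z))%C.

Definition pre_schwarzian_degenerate (h g : C -> C) : Prop :=
  exists (z : C) (theta : R), in_disk z /\ 0 <= theta <= 2 * PI /\
    rotated_sum theta (C_derive h z) (C_derive g z) = RtoC 0.

(* [C_derive] is total and computes a limit along a horizontal line; it is the
   complex derivative wherever that exists, so for [h] analytic in the disk
   [C_derive (C_derive h)] is the second derivative there.
   The case split is needed because division by zero is total in [C]. *)
Definition pre_schwarzian_norm (h g : C -> C) : Rbar :=
  if excluded_middle_informative (pre_schwarzian_degenerate h g)
  then p_infty
  else Lub_Rbar (fun x : R =>
         exists (z : C) (theta : R), in_disk z /\ 0 <= theta <= 2 * PI /\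
           x = pre_schwarzian_value h g z theta).

(* Main.v *)
Require Import Defs.
From Stdlib Require Import Reals Ranalysis5 Lra Lia Classical ClassicalEpsilon.
From Coquelicot Require Import Coquelicot.

Open Scope R_scope.

(** A harmonic map f = h + conj g is uniformly locally univalent exactly when its pre-Schwarzian
    norm is finite.

    Finite norm implies univalence.  If f z = f w, the increments of h and g between z and w have
    equal moduli, so for some t the analytic function h + e^(i t) g takes the same value at z and w.
    A finite norm bounds (h + e^(i t) g)'' / (h + e^(i t) g)' by a constant over 1 - |a|^2 on a
    Euclidean ball about a whose radius is a fixed multiple of 1 - |a|^2.  If the multiple is small,
    the derivative is nearly constant there ([gronwall_ball]), and the function is injective
    ([injective_of_small_pre_schwarzian]).  Such balls contain hyperbolic disks of a fixed radius.

    Univalence implies finite norm.  The converse comparison of disks reduces this to a local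
    statement ([univalent_rotated_bound]): if f is injective on a ball of radius r about a, then
    h' + e g' does not vanish at a and |h'' + e g''| <= (K / r) |h' + e g'| there, for every unit
    number e, with K absolute.

    Nonvanishing is Lewy's theorem ([lewy]).  If h' + e g' vanished at a, then a real linear
    functional of f would be the real part of an analytic function with a critical point at a, so one
    of its level sets would contain three arcs starting at a.  On this level set f takes values in a
    line, and three arcs with a common end cannot be embedded in a line.

    The bound is first proved for the z-derivative of the logarithm of the Jacobian
    ([jacobian_pre_schwarzian_bound]).  This quantity is unchanged by affine maps in the image and
    scales like 1 / r.  If it were large, one could choose a point where it is nearly largest relative
    to the distance to the boundary, rescale so that it equals 1 there and is at most 4 on a huge disk,
    and normalize f affinely.  By Cauchy estimates the dilatation g' / h' is then nearly 0 and
    h'' / h' nearly 1 on bounded sets, so f is close to e^z - 1 in the C^1 sense and takes a value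
    twice, at 2 pi i and near 0 ([normalized_not_injective]).  The Schwarz-Pick inequality for the
    dilatation passes from the Jacobian to each rotation h + e g ([rotated_bound_of_lt]).

    Since h and g are only assumed complex differentiable, the existence of higher derivatives, the
    Cauchy estimates and the finite order of zeros are derived from Goursat's theorem: a holomorphic
    function has a primitive, the difference quotients of this primitive are holomorphic without
    exception, and this yields Cauchy's formula for it ([goursat], [cauchy_formula],
    [holo_derivative], [cauchy_estimate], [finite_order]). *)

(** * Moduli and derivatives *)

Lemma lt_Rmin (x a b : R) : x < Rmin a b -> x < a /\ x < b.
Proof. intros H. pose proof (Rmin_l a b). pose proof (Rmin_r a b). lra. Qed.

Lemma Cmod_sub_sym (z w : C) : Cmod (z - w) = Cmod (w - z).
Proof.
  replace (z - w)%C with (- (w - z))%C by ring. apply Cmod_opp.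
Qed.

Lemma Cmod_sub_triangle (x y z : C) : Cmod (x - z) <= Cmod (x - y) + Cmod (y - z).
Proof.
  replace (x - z)%C with ((x - y) + (y - z))%C by ring. apply Cmod_triangle.
Qed.

Lemma Cmod_minus_le (x y : C) : Cmod (x - y) <= Cmod x + Cmod y.
Proof.
  unfold Cminus. rewrite <- (Cmod_opp y). apply Cmod_triangle.
Qed.

Lemma Cmod_reverse_triangle (x y : C) : Cmod x - Cmod y <= Cmod (x - y).
Proof.
  pose proof (Cmod_triangle (x - y) y) as H.
  replace (x - y + y)%C with x in H by ring. lra.
Qed.

Lemma im_le_Cmod (z : C) : Rabs (snd z) <= Cmod z.
Proof. eapply Rle_trans; [apply Rmax_r | apply Rmax_Cmod]. Qed.

Lemma fst_le_Cmod (z : C) : Rabs (fst z) <= Cmod z.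
Proof. eapply Rle_trans; [apply Rmax_l | apply Rmax_Cmod]. Qed.

Lemma Cmod_le_add (z : C) : Cmod z <= Rabs (fst z) + Rabs (snd z).
Proof.
  unfold Cmod. apply Rsqr_incr_0_var.
  - rewrite Rsqr_sqrt by nra. unfold Rsqr.
    rewrite <- (pow2_abs (fst z)), <- (pow2_abs (snd z)).
    pose proof (Rabs_pos (fst z)); pose proof (Rabs_pos (snd z)). nra.
  - pose proof (Rabs_pos (fst z)); pose proof (Rabs_pos (snd z)). lra.
Qed.

Lemma Cmod_pair_le (x y b : R) : Rabs x <= b -> Rabs y <= b -> Cmod (x, y) <= 2 * b.
Proof.
  intros Hx Hy. pose proof (Cmod_le_add (x, y)) as H. simpl in H. lra.
Qed.

Lemma Cminus_nz (z w : C) : z <> w -> (z - w)%C <> 0.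
Proof.
  intros H E. apply H. replace z with ((z - w) + w)%C by ring. rewrite E. ring.
Qed.

Lemma Cmod_RtoC_pos (t : R) : 0 <= t -> Cmod (RtoC t) = t.
Proof. intros H. rewrite Cmod_R. apply Rabs_pos_eq, H. Qed.

Definition cderiv (f : C -> C) (z l : C) : Prop :=
  @is_derive C_AbsRing C_NormedModule f z l.

Lemma cderiv_eps (f : C -> C) (z l : C) :
  cderiv f z l <->
  forall eps : R, 0 < eps -> exists delta : R, 0 < delta /\
    forall w : C, Cmod (w - z) < delta ->
      Cmod (f w - f z - (w - z) * l) <= eps * Cmod (w - z).
Proof.
  split.
  - intros [_ H] eps Heps.
    destruct (H z (fun P HP => HP) (mkposreal eps Heps)) as [d Hd].
    exists d. split; [apply cond_pos|]. intros w Hw. exact (Hd w Hw).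
  - intros H. split; [apply is_linear_scal_l|].
    intros x Hx.
    assert (E : x = z).
    { symmetry. apply is_filter_lim_locally_unique. exact Hx. }
    subst x. intros eps. destruct (H eps (cond_pos eps)) as [d [Hd Hd']].
    exists (mkposreal d Hd). intros w Hw. exact (Hd' w Hw).
Qed.

(** The plane carries two normed module structures over itself, with the same norm
    but different uniform structures.  Differentiability sees only the norm, so rules proved
    for one structure hold for the other. *)
Lemma cderiv_abs_ring (f : C -> C) (z l : C) :
  cderiv f z l <-> @is_derive C_AbsRing (AbsRing_NormedModule C_AbsRing) f z l.
Proof.
  split; intros [_ H]; (split; [apply is_linear_scal_l|]); exact H.
Qed.

Lemma cderiv_ext_ball (f g : C -> C) (z l : C) (r : R) : 0 < r ->
  (forall w, Cmod (w - z) < r -> f w = g w) -> cderiv f z l -> cderiv g z l.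
Proof.
  intros Hr E. rewrite !cderiv_eps. intros H eps Heps.
  destruct (H eps Heps) as [d [Hd Hd']].
  exists (Rmin d r). split; [apply Rmin_pos; assumption|].
  intros w Hw. rewrite <- (E w), <- (E z).
  - apply Hd'. eapply Rlt_le_trans; [exact Hw | apply Rmin_l].
  - replace (z - z)%C with (RtoC 0) by ring. rewrite Cmod_0. exact Hr.
  - eapply Rlt_le_trans; [exact Hw | apply Rmin_r].
Qed.

Lemma cderiv_ext (f g : C -> C) (z l : C) :
  (forall w, f w = g w) -> cderiv f z l -> cderiv g z l.
Proof. intros E. apply (cderiv_ext_ball _ _ _ _ 1 Rlt_0_1). auto. Qed.

Lemma cderiv_eq (f : C -> C) (z l m : C) : l = m -> cderiv f z l -> cderiv f z m.
Proof. intros ->. auto. Qed.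

Lemma cderiv_unique (f : C -> C) (z l m : C) : cderiv f z l -> cderiv f z m -> l = m.
Proof.
  intros H1 H2. rewrite <- (is_C_derive_unique _ _ _ H1).
  apply is_C_derive_unique, H2.
Qed.

Lemma cderiv_const (c z : C) : cderiv (fun _ => c) z 0.
Proof. exact (is_derive_const c z). Qed.

Lemma cderiv_id (z : C) : cderiv (fun w => w) z 1.
Proof. apply cderiv_abs_ring. exact (is_derive_id z). Qed.

Lemma cderiv_plus (f g : C -> C) (z l m : C) :
  cderiv f z l -> cderiv g z m -> cderiv (fun w => f w + g w)%C z (l + m)%C.
Proof. intros H1 H2. exact (is_derive_plus _ _ _ _ _ H1 H2). Qed.

Lemma cderiv_minus (f g : C -> C) (z l m : C) :
  cderiv f z l -> cderiv g z m -> cderiv (fun w => f w - g w)%C z (l - m)%C.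
Proof. intros H1 H2. exact (is_derive_minus _ _ _ _ _ H1 H2). Qed.

Lemma cderiv_mult (f g : C -> C) (z l m : C) :
  cderiv f z l -> cderiv g z m ->
  cderiv (fun w => f w * g w)%C z (l * g z + f z * m)%C.
Proof. rewrite !cderiv_abs_ring. intros H1 H2.
  exact (@is_derive_mult C_AbsRing _ _ _ _ _ H1 H2 Cmult_comm). Qed.

Lemma cderiv_comp (f g : C -> C) (z l m : C) :
  cderiv f (g z) l -> cderiv g z m -> cderiv (fun w => f (g w)) z (m * l)%C.
Proof. rewrite (cderiv_abs_ring g). intros H1 H2. exact (@is_derive_comp C_AbsRing C_NormedModule _ _ _ _ _ H1 H2). Qed.

Lemma cderiv_scal (c : C) (f : C -> C) (z l : C) :
  cderiv f z l -> cderiv (fun w => c * f w)%C z (c * l)%C.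
Proof.
  intros H. eapply cderiv_eq; [|apply (cderiv_mult _ _ _ _ _ (cderiv_const c z) H)].
  simpl. ring.
Qed.

Lemma cderiv_affine (f : C -> C) (a b z l : C) :
  cderiv f (a + b * z)%C l -> cderiv (fun w => f (a + b * w)%C) z (b * l)%C.
Proof.
  intros H. apply (cderiv_comp f (fun w => a + b * w)%C); [exact H|].
  eapply cderiv_eq; [|apply (cderiv_plus _ _ _ _ _ (cderiv_const a z)
                               (cderiv_scal b _ _ _ (cderiv_id z)))].
  ring.
Qed.

Definition ccont (f : C -> C) (z : C) : Prop :=
  forall eps : R, 0 < eps -> exists delta : R, 0 < delta /\
    forall w : C, Cmod (w - z) < delta -> Cmod (f w - f z) < eps.

Lemma cderiv_ccont (f : C -> C) (z l : C) : cderiv f z l -> ccont f z.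
Proof.
  rewrite cderiv_eps. intros H eps Heps.
  destruct (H 1 Rlt_0_1) as [d [Hd Hd']].
  pose proof (Cmod_ge_0 l) as Hl.
  exists (Rmin d (eps / (Cmod l + 2))). split.
  { apply Rmin_pos; [exact Hd|]. apply Rdiv_lt_0_compat; lra. }
  intros w Hw.
  destruct (lt_Rmin _ _ _ Hw) as [H1 H2].
  pose proof (Hd' w H1) as H3.
  replace (f w - f z)%C with ((f w - f z - (w - z) * l) + (w - z) * l)%C by ring.
  eapply Rle_lt_trans; [apply Cmod_triangle|]. rewrite Cmod_mult.
  apply (Rmult_lt_compat_r (Cmod l + 2)) in H2; [|lra].
  replace (eps / (Cmod l + 2) * (Cmod l + 2)) with eps in H2 by (field; lra).
  pose proof (Cmod_ge_0 (w - z)). nra.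
Qed.

Lemma cderiv_Cinv (z : C) : z <> 0 -> cderiv Cinv z (- (/ z * / z))%C.
Proof.
  intros Hz. rewrite cderiv_eps. intros eps Heps.
  pose proof (proj1 (Cmod_gt_0 z) Hz) as Hm.
  exists (Rmin (Cmod z / 2) (eps * Cmod z ^ 3 / 2)). split.
  { apply Rmin_pos; [lra|]. apply Rdiv_lt_0_compat; [|lra].
    apply Rmult_lt_0_compat; [exact Heps | apply pow_lt, Hm]. }
  intros w Hw.
  destruct (lt_Rmin _ _ _ Hw) as [H1 H2].
  pose proof (Cmod_reverse_triangle z (z - w)) as H3.
  replace (z - (z - w))%C with w in H3 by ring.
  rewrite (Cmod_sub_sym z w) in H3.
  assert (Hw0 : 0 < Cmod w) by lra.
  assert (Hwz : w <> 0) by (apply Cmod_gt_0; exact Hw0).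
  replace (/ w - / z - (w - z) * - (/ z * / z))%C
    with ((w - z) * (w - z) / (w * (z * z)))%C by (field; auto).
  rewrite Cmod_div, !Cmod_mult by (repeat apply Cmult_neq_0; assumption).
  assert (HP : 0 < Cmod w * (Cmod z * Cmod z))
    by (repeat apply Rmult_lt_0_compat; assumption).
  apply (Rmult_le_reg_r (Cmod w * (Cmod z * Cmod z))); [exact HP|].
  unfold Rdiv. rewrite Rmult_assoc, Rinv_l by lra.
  pose proof (Cmod_ge_0 (w - z)) as H4. simpl in H2.
  assert (H5 : eps * Cmod z * Cmod z * Cmod z / 2 <= eps * Cmod z * Cmod z * Cmod w).
  { assert (0 < eps * Cmod z * Cmod z) by (repeat apply Rmult_lt_0_compat; assumption).
    nra. }
  nra.
Qed.

Lemma cderiv_inv (f : C -> C) (z l : C) : cderiv f z l -> f z <> 0 ->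
  cderiv (fun w => / f w)%C z (- l / (f z * f z))%C.
Proof.
  intros H Hz. eapply cderiv_eq; [|apply (cderiv_comp Cinv f _ _ _ (cderiv_Cinv _ Hz) H)].
  field. exact Hz.
Qed.

Lemma cderiv_div (f g : C -> C) (z l m : C) : cderiv f z l -> cderiv g z m -> g z <> 0 ->
  cderiv (fun w => f w / g w)%C z ((l * g z - f z * m) / (g z * g z))%C.
Proof.
  intros H1 H2 Hz.
  eapply cderiv_eq; [|apply (cderiv_mult _ _ _ _ _ H1 (cderiv_inv _ _ _ H2 Hz))].
  simpl. field. exact Hz.
Qed.

Lemma cderiv_pow (f : C -> C) (z l : C) (n : nat) : cderiv f z l ->
  cderiv (fun w => f w ^ S n)%C z (RtoC (INR (S n)) * f z ^ n * l)%C.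
Proof.
  intros H. induction n as [|n IH].
  - eapply cderiv_ext; [intros w; symmetry; apply Cpow_1_r|].
    eapply cderiv_eq; [|exact H]. simpl. ring.
  - eapply cderiv_ext; [intros w; symmetry; apply Cpow_S|].
    eapply cderiv_eq; [|apply (cderiv_mult _ _ _ _ _ H IH)].
    rewrite (S_INR (S n)), RtoC_plus, !Cpow_S. ring.
Qed.

Definition pderiv (p : R -> C) (t : R) (l : C) : Prop :=
  forall eps : R, 0 < eps -> exists delta : R, 0 < delta /\
    forall s : R, Rabs (s - t) < delta ->
      Cmod (p s - p t - RtoC (s - t) * l) <= eps * Rabs (s - t).

Lemma is_derive_eps (f : R -> R) (t l : R) :
  (forall eps : R, 0 < eps -> exists delta : R, 0 < delta /\
    forall s : R, Rabs (s - t) < delta ->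
      Rabs (f s - f t - (s - t) * l) <= eps * Rabs (s - t)) <-> is_derive f t l.
Proof.
  split.
  - intros H. split; [apply is_linear_scal_l|].
    intros x Hx.
    assert (E : x = t).
    { symmetry. apply is_filter_lim_locally_unique. exact Hx. }
    subst x. intros eps. destruct (H eps (cond_pos eps)) as [d [Hd Hd']].
    exists (mkposreal d Hd). intros w Hw. exact (Hd' w Hw).
  - intros [_ H] eps Heps.
    destruct (H t (fun P HP => HP) (mkposreal eps Heps)) as [d Hd].
    exists d. split; [apply cond_pos|]. intros w Hw. exact (Hd w Hw).
Qed.

Lemma pderiv_fst (p : R -> C) (t : R) (l : C) :
  pderiv p t l -> is_derive (fun s => fst (p s)) t (fst l).
Proof.
  intros H. apply is_derive_eps. intros eps Heps.
  destruct (H eps Heps) as [d [Hd Hd']]. exists d. split; [exact Hd|].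
  intros s Hs. eapply Rle_trans; [|apply (Hd' s Hs)].
  eapply Rle_trans; [|apply fst_le_Cmod]. right. simpl. f_equal. ring.
Qed.

Lemma pderiv_snd (p : R -> C) (t : R) (l : C) :
  pderiv p t l -> is_derive (fun s => snd (p s)) t (snd l).
Proof.
  intros H. apply is_derive_eps. intros eps Heps.
  destruct (H eps Heps) as [d [Hd Hd']]. exists d. split; [exact Hd|].
  intros s Hs. eapply Rle_trans; [|apply (Hd' s Hs)].
  eapply Rle_trans; [|apply im_le_Cmod]. right. simpl. f_equal. ring.
Qed.

Lemma pderiv_pair (f g : R -> R) (t a b : R) :
  is_derive f t a -> is_derive g t b -> pderiv (fun s => (f s, g s)) t (a, b).
Proof.
  intros H1 H2 eps Heps.
  destruct (proj2 (is_derive_eps _ _ _) H1 (eps / 2)) as [d1 [Hd1 Hd1']]; [lra|].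
  destruct (proj2 (is_derive_eps _ _ _) H2 (eps / 2)) as [d2 [Hd2 Hd2']]; [lra|].
  exists (Rmin d1 d2). split; [apply Rmin_pos; assumption|]. intros s Hs.
  destruct (lt_Rmin _ _ _ Hs) as [M1 M2].
  pose proof (Hd1' s M1) as E1. pose proof (Hd2' s M2) as E2.
  eapply Rle_trans; [apply Cmod_le_add|]. simpl.
  replace (f s + - f t + - ((s - t) * a - 0 * b)) with (f s - f t - (s - t) * a) by ring.
  replace (g s + - g t + - ((s - t) * b + 0 * a)) with (g s - g t - (s - t) * b) by ring.
  lra.
Qed.

Lemma pderiv_line (a v : C) (t : R) : pderiv (fun s => a + RtoC s * v)%C t v.
Proof.
  intros eps Heps. exists 1. split; [lra|]. intros s _.
  replace (a + s * v - (a + t * v) - RtoC (s - t) * v)%C with (RtoC 0).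
  - rewrite Cmod_0. pose proof (Rabs_pos (s - t)). nra.
  - rewrite RtoC_minus. ring.
Qed.

Definition pcont (p : R -> C) (t : R) : Prop :=
  forall eps : R, 0 < eps -> exists delta : R, 0 < delta /\
    forall s : R, Rabs (s - t) < delta -> Cmod (p s - p t) < eps.

Lemma pderiv_pcont (p : R -> C) (t : R) (l : C) : pderiv p t l -> pcont p t.
Proof.
  intros H eps Heps. destruct (H 1 Rlt_0_1) as [d [Hd Hd']].
  pose proof (Cmod_ge_0 l) as Hl.
  exists (Rmin d (eps / (Cmod l + 2))). split.
  { apply Rmin_pos; [exact Hd|]. apply Rdiv_lt_0_compat; lra. }
  intros w Hw.
  destruct (lt_Rmin _ _ _ Hw) as [H1 H2].
  pose proof (Hd' w H1) as H3.
  replace (p w - p t)%C with ((p w - p t - RtoC (w - t) * l) + RtoC (w - t) * l)%C by ring.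
  eapply Rle_lt_trans; [apply Cmod_triangle|]. rewrite Cmod_mult, Cmod_R.
  apply (Rmult_lt_compat_r (Cmod l + 2)) in H2; [|lra].
  replace (eps / (Cmod l + 2) * (Cmod l + 2)) with eps in H2 by (field; lra).
  pose proof (Rabs_pos (w - t)). nra.
Qed.

Lemma pderiv_comp (f : C -> C) (p : R -> C) (t : R) (l m : C) :
  cderiv f (p t) l -> pderiv p t m -> pderiv (fun s => f (p s)) t (l * m)%C.
Proof.
  intros Hf Hp eps Heps.
  pose proof (Cmod_ge_0 l) as Hl. pose proof (Cmod_ge_0 m) as Hm.
  set (e1 := eps / 2 / (Cmod m + 1)). set (e2 := Rmin 1 (eps / 2 / (Cmod l + 1))).
  assert (He1 : 0 < e1) by (unfold e1; repeat apply Rdiv_lt_0_compat; lra).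
  assert (He2 : 0 < e2) by
    (unfold e2; apply Rmin_pos; [|repeat apply Rdiv_lt_0_compat]; lra).
  rewrite cderiv_eps in Hf.
  destruct (Hf e1 He1) as [d1 [Hd1 Hf']].
  destruct (pderiv_pcont _ _ _ Hp d1 Hd1) as [d2 [Hd2 Hc]].
  destruct (Hp e2 He2) as [d3 [Hd3 Hp']].
  exists (Rmin d2 d3). split; [apply Rmin_pos; assumption|]. intros s Hs.
  pose proof (Hf' _ (Hc s (Rlt_le_trans _ _ _ Hs (Rmin_l _ _)))) as A.
  pose proof (Hp' s (Rlt_le_trans _ _ _ Hs (Rmin_r _ _))) as B.
  set (x := Rabs (s - t)) in *.
  assert (Hx : 0 <= x) by apply Rabs_pos.
  assert (D : Cmod (p s - p t) <= (Cmod m + 1) * x).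
  { replace (p s - p t)%C with ((p s - p t - RtoC (s - t) * m) + RtoC (s - t) * m)%C by ring.
    eapply Rle_trans; [apply Cmod_triangle|]. rewrite Cmod_mult, Cmod_R. fold x.
    assert (e2 <= 1) by apply Rmin_l. nra. }
  replace (f (p s) - f (p t) - RtoC (s - t) * (l * m))%C
    with ((f (p s) - f (p t) - (p s - p t) * l) + l * (p s - p t - RtoC (s - t) * m))%C
    by ring.
  eapply Rle_trans; [apply Cmod_triangle|]. rewrite (Cmod_mult l).
  assert (A' : e1 * Cmod (p s - p t) <= eps / 2 * x).
  { eapply Rle_trans; [apply Rmult_le_compat_l; [lra | exact D]|].
    right. unfold e1. field. lra. }
  assert (B' : Cmod l * (e2 * x) <= eps / 2 * x).
  { assert (Hq : e2 <= eps / 2 / (Cmod l + 1)) by apply Rmin_r.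
    apply (Rmult_le_compat_r (Cmod l + 1)) in Hq; [|lra].
    replace (eps / 2 / (Cmod l + 1) * (Cmod l + 1)) with (eps / 2) in Hq by (field; lra).
    assert (e2 * Cmod l <= eps / 2) by nra.
    rewrite <- Rmult_assoc, (Rmult_comm (Cmod l)). apply Rmult_le_compat_r; lra. }
  assert (Cmod l * Cmod (p s - p t - RtoC (s - t) * m) <= Cmod l * (e2 * x))
    by (apply Rmult_le_compat_l; lra).
  lra.
Qed.

Definition holo (a : C) (r : R) (f f1 : C -> C) : Prop :=
  forall z, Cmod (z - a) < r -> cderiv f z (f1 z).

Lemma ball_convex (a z w : C) (r t : R) : Cmod (z - a) < r -> Cmod (w - a) < r ->
  0 <= t <= 1 -> Cmod (w + RtoC t * (z - w) - a) < r.
Proof.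
  intros Hz Hw Ht.
  replace (w + RtoC t * (z - w) - a)%C with (RtoC t * (z - a) + RtoC (1 - t) * (w - a))%C
    by (rewrite RtoC_minus; ring).
  eapply Rle_lt_trans; [apply Cmod_triangle|].
  rewrite !Cmod_mult, !Cmod_RtoC_pos by lra.
  destruct (Req_dec t 0) as [->|]; [lra|]. nra.
Qed.

(** Projecting f onto the direction of f z - f w reduces the claim to the mean value
    theorem for a real function of one variable. *)
Lemma mean_value_segment (f f1 : C -> C) (z w : C) (K : R) :
  (forall t, 0 <= t <= 1 -> cderiv f (w + RtoC t * (z - w))%C (f1 (w + RtoC t * (z - w))%C)
     /\ Cmod (f1 (w + RtoC t * (z - w))%C) <= K) ->
  Cmod (f z - f w) <= K * Cmod (z - w).
Proof.
  intros H. set (u := (f z - f w)%C).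
  set (n := fun t : R => fst (Cconj u * f (w + RtoC t * (z - w)))%C).
  set (dn := fun t : R => fst (Cconj u * f1 (w + RtoC t * (z - w)) * (z - w))%C).
  assert (Hn : forall t, 0 <= t <= 1 -> is_derive n t (dn t)).
  { intros t Ht. unfold n, dn.
    apply (pderiv_fst (fun s => Cconj u * f (w + RtoC s * (z - w)))%C).
    apply (pderiv_comp (fun y => Cconj u * f y)%C).
    - apply cderiv_scal, H, Ht.
    - apply pderiv_line. }
  destruct (MVT_gen n 0 1 dn) as [c [Hc E]].
  - intros x Hx. rewrite Rmin_left, Rmax_right in Hx by lra. apply Hn. lra.
  - intros x Hx. rewrite Rmin_left, Rmax_right in Hx by lra.
    apply continuity_pt_filterlim, (ex_derive_continuous n).
    exists (dn x). apply Hn. lra.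
  - rewrite Rmin_left, Rmax_right in Hc by lra.
    assert (E1 : n 1 - n 0 = Cmod u ^ 2).
    { unfold n. replace (w + 1 * (z - w))%C with z by ring.
      replace (w + 0 * (z - w))%C with w by ring.
      rewrite Cmod2_alt. unfold u, Re, Im. simpl. ring. }
    assert (E2 : dn c <= Cmod u * (K * Cmod (z - w))).
    { unfold dn. eapply Rle_trans; [apply Rle_abs|].
      eapply Rle_trans; [apply fst_le_Cmod|].
      rewrite !Cmod_mult, Cmod_conj, Rmult_assoc.
      apply Rmult_le_compat_l; [apply Cmod_ge_0|].
      apply Rmult_le_compat_r; [apply Cmod_ge_0|]. apply H, Hc. }
    pose proof (Cmod_ge_0 u) as Hu.
    destruct (Req_dec (Cmod u) 0) as [Z|Z].
    + rewrite Z. apply Rmult_le_pos; [|apply Cmod_ge_0].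
      eapply Rle_trans; [apply Cmod_ge_0 | apply (H c Hc)].
    + apply (Rmult_le_reg_l (Cmod u)); nra.
Qed.

Lemma mean_value_ball (a : C) (r : R) (f f1 : C -> C) (K : R) : holo a r f f1 ->
  (forall z, Cmod (z - a) < r -> Cmod (f1 z) <= K) ->
  forall z w, Cmod (z - a) < r -> Cmod (w - a) < r ->
    Cmod (f z - f w) <= K * Cmod (z - w).
Proof.
  intros Hf HK z w Hz Hw. apply mean_value_segment with f1.
  intros t Ht. pose proof (ball_convex a z w r t Hz Hw Ht). auto.
Qed.

Lemma continuity_pt_Cmod (p : R -> C) (t : R) : pcont p t ->
  continuity_pt (fun s => Cmod (p s)) t.
Proof.
  intros H eps Heps. destruct (H eps Heps) as [d [Hd B]]. exists d. split; [exact Hd|].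
  intros s [_ Hs]. simpl in *. unfold Rdist in *.
  eapply Rle_lt_trans; [|apply (B s Hs)]. apply Rabs_le.
  pose proof (Cmod_reverse_triangle (p s) (p t)).
  pose proof (Cmod_reverse_triangle (p t) (p s)) as E. rewrite Cmod_sub_sym in E. lra.
Qed.

(** If |f'| <= K |f| on a ball with K r <= 1/2, then f stays close to its central value:
    the largest deviation m along a radius satisfies m <= K (|f a| + m) |z - a| by the mean value
    inequality, and the term in m is absorbed. *)
Lemma gronwall_ball (a : C) (r K : R) (f f1 : C -> C) : 0 < r -> 0 <= K -> K * r <= / 2 ->
  holo a r f f1 -> (forall z, Cmod (z - a) < r -> Cmod (f1 z) <= K * Cmod (f z)) ->
  forall z, Cmod (z - a) < r -> Cmod (f z - f a) <= 2 * K * Cmod (z - a) * Cmod (f a).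
Proof.
  intros Hr HK HKr Hf H1 z Hz.
  assert (Ha : Cmod (a - a) < r)
    by (replace (a - a)%C with (RtoC 0) by ring; rewrite Cmod_0; exact Hr).
  set (n := fun t : R => Cmod (f (a + RtoC t * (z - a))%C - f a)).
  assert (Hin : forall t, 0 <= t <= 1 -> Cmod (a + RtoC t * (z - a) - a) < r)
    by (intros t Ht; apply ball_convex; assumption).
  assert (Hc : forall t, 0 <= t <= 1 -> continuity_pt n t).
  { intros t Ht. apply continuity_pt_Cmod. eapply pderiv_pcont.
    apply (pderiv_comp (fun u => f u - f a)%C); [|apply pderiv_line].
    apply (cderiv_minus f (fun _ => f a)); [apply Hf, Hin, Ht | apply cderiv_const]. }
  destruct (continuity_ab_maj n 0 1) as [t0 [Hmax Ht0]]; [lra | exact Hc|].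
  set (m := n t0) in *.
  assert (Hm : m <= K * (Cmod (f a) + m) * Cmod (z - a)).
  { unfold m at 1, n.
    eapply Rle_trans;
      [apply (mean_value_segment f f1 (a + t0 * (z - a))%C a (K * (Cmod (f a) + m)))|].
    - intros t Ht.
      replace (a + t * (a + t0 * (z - a) - a))%C with (a + RtoC (t * t0) * (z - a))%C
        by (rewrite RtoC_mult; ring).
      assert (Htt : 0 <= t * t0 <= 1) by nra.
      split; [apply Hf, Hin, Htt|].
      eapply Rle_trans; [apply H1, Hin, Htt|].
      apply Rmult_le_compat_l; [exact HK|].
      pose proof (Hmax (t * t0) Htt) as E. unfold n in E at 1.
      pose proof (Cmod_reverse_triangle (f (a + RtoC (t * t0) * (z - a))%C) (f a)). lra.
    - apply Rmult_le_compat_l.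
      + apply Rmult_le_pos; [exact HK|].
        pose proof (Cmod_ge_0 (f a)). pose proof (Cmod_ge_0 (f (a + t0 * (z - a))%C - f a)%C).
        unfold m, n. lra.
      + replace (a + t0 * (z - a) - a)%C with (t0 * (z - a))%C by ring.
        rewrite Cmod_mult, Cmod_RtoC_pos by lra.
        pose proof (Cmod_ge_0 (z - a)). nra. }
  assert (Hz1 : n 1 <= m) by (apply Hmax; lra).
  unfold n in Hz1. replace (a + 1 * (z - a))%C with z in Hz1 by ring.
  assert (Hm0 : 0 <= m) by apply Cmod_ge_0.
  pose proof (Cmod_ge_0 (z - a)). pose proof (Cmod_ge_0 (f a)).
  assert (K * Cmod (z - a) <= / 2) by nra.
  assert (K * m * Cmod (z - a) <= m / 2) by nra.
  nra.
Qed.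

(** * Integrals along paths and segments *)

Lemma pcont_ccont (f : C -> C) (p : R -> C) (t : R) :
  ccont f (p t) -> pcont p t -> pcont (fun s => f (p s)) t.
Proof.
  intros Hf Hp eps Heps. destruct (Hf eps Heps) as [d [Hd Hf']].
  destruct (Hp d Hd) as [e [He Hp']]. exists e. auto.
Qed.

Lemma pcont_const (c : C) (t : R) : pcont (fun _ => c) t.
Proof.
  intros eps Heps. exists 1. split; [lra|]. intros s _.
  replace (c - c)%C with (RtoC 0) by ring. rewrite Cmod_0. exact Heps.
Qed.

Lemma pcont_plus (p q : R -> C) (t : R) :
  pcont p t -> pcont q t -> pcont (fun s => p s + q s)%C t.
Proof.
  intros Hp Hq eps Heps.
  destruct (Hp (eps / 2)) as [d [Hd Hp']]; [lra|].
  destruct (Hq (eps / 2)) as [e [He Hq']]; [lra|].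
  exists (Rmin d e). split; [apply Rmin_pos; assumption|]. intros s Hs.
  destruct (lt_Rmin _ _ _ Hs) as [M1 M2].
  pose proof (Hp' s M1). pose proof (Hq' s M2).
  replace (p s + q s - (p t + q t))%C with ((p s - p t) + (q s - q t))%C by ring.
  eapply Rle_lt_trans; [apply Cmod_triangle|]. lra.
Qed.

Lemma pcont_mult (p q : R -> C) (t : R) :
  pcont p t -> pcont q t -> pcont (fun s => p s * q s)%C t.
Proof.
  intros Hp Hq eps Heps.
  pose proof (Cmod_ge_0 (p t)) as P0. pose proof (Cmod_ge_0 (q t)) as Q0.
  set (a := eps / 2 / (Cmod (q t) + 1)). set (b := eps / 2 / (Cmod (p t) + 1)).
  assert (Ha : 0 < a) by (unfold a; repeat apply Rdiv_lt_0_compat; lra).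
  assert (Hb : 0 < b) by (unfold b; repeat apply Rdiv_lt_0_compat; lra).
  assert (Ea : a * (Cmod (q t) + 1) = eps / 2) by (unfold a; field; lra).
  assert (Eb : b * (Cmod (p t) + 1) = eps / 2) by (unfold b; field; lra).
  destruct (Hp a Ha) as [d [Hd Hp']].
  destruct (Hq (Rmin 1 b)) as [e [He Hq']]; [apply Rmin_pos; lra|].
  exists (Rmin d e). split; [apply Rmin_pos; assumption|]. intros s Hs.
  destruct (lt_Rmin _ _ _ Hs) as [M1 M2].
  pose proof (Hp' s M1) as A. pose proof (Hq' s M2) as B.
  destruct (lt_Rmin _ _ _ B) as [B1 B2].
  replace (p s * q s - p t * q t)%C
    with ((p s - p t) * q s + p t * (q s - q t))%C by ring.
  eapply Rle_lt_trans; [apply Cmod_triangle|]. rewrite !Cmod_mult.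
  pose proof (Cmod_reverse_triangle (q s) (q t)).
  pose proof (Cmod_ge_0 (p s - p t)). pose proof (Cmod_ge_0 (q s - q t)).
  pose proof (Cmod_ge_0 (q s)).
  assert (Cmod (p s - p t) * Cmod (q s) <= a * (Cmod (q t) + 1))
    by (apply Rmult_le_compat; lra).
  assert (Cmod (p t) * Cmod (q s - q t) <= Cmod (p t) * b)
    by (apply Rmult_le_compat_l; lra).
  lra.
Qed.

Lemma pcont_fst (p : R -> C) (t : R) : pcont p t -> continuous (fun s => fst (p s)) t.
Proof.
  intros H. apply continuity_pt_filterlim. intros eps Heps.
  destruct (H eps Heps) as [d [Hd H']]. exists d. split; [exact Hd|].
  intros s [_ Hs]. simpl in *. unfold Rdist in *.
  eapply Rle_lt_trans; [|apply (H' s Hs)]. exact (fst_le_Cmod (p s - p t)%C).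
Qed.

Lemma pcont_snd (p : R -> C) (t : R) : pcont p t -> continuous (fun s => snd (p s)) t.
Proof.
  intros H. apply continuity_pt_filterlim. intros eps Heps.
  destruct (H eps Heps) as [d [Hd H']]. exists d. split; [exact Hd|].
  intros s [_ Hs]. simpl in *. unfold Rdist in *.
  eapply Rle_lt_trans; [|apply (H' s Hs)]. exact (im_le_Cmod (p s - p t)%C).
Qed.

Definition Cint (q : R -> C) (a b : R) : C :=
  (RInt (fun t => fst (q t)) a b, RInt (fun t => snd (q t)) a b).

Definition pcont_on (a b : R) (p : R -> C) : Prop := forall t, a <= t <= b -> pcont p t.

Lemma pcont_ex_fst (q : R -> C) (a b : R) : a <= b -> pcont_on a b q ->
  ex_RInt (fun t => fst (q t)) a b.
Proof.
  intros Hab H. apply (@ex_RInt_continuous R_CompleteNormedModule). intros t Ht.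
  rewrite Rmin_left, Rmax_right in Ht by exact Hab. apply pcont_fst, H, Ht.
Qed.

Lemma pcont_ex_snd (q : R -> C) (a b : R) : a <= b -> pcont_on a b q ->
  ex_RInt (fun t => snd (q t)) a b.
Proof.
  intros Hab H. apply (@ex_RInt_continuous R_CompleteNormedModule). intros t Ht.
  rewrite Rmin_left, Rmax_right in Ht by exact Hab. apply pcont_snd, H, Ht.
Qed.

Lemma Cint_ext (p q : R -> C) (a b : R) : a <= b ->
  (forall t, a <= t <= b -> p t = q t) -> Cint p a b = Cint q a b.
Proof.
  intros Hab H. unfold Cint.
  f_equal; apply RInt_ext; intros t Ht; rewrite Rmin_left, Rmax_right in Ht by exact Hab;
    rewrite H by lra; reflexivity.
Qed.

Lemma Cint_plus (p q : R -> C) (a b : R) : a <= b -> pcont_on a b p -> pcont_on a b q ->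
  Cint (fun t => p t + q t)%C a b = (Cint p a b + Cint q a b)%C.
Proof.
  intros Hab Hp Hq. apply injective_projections.
  - exact (@RInt_plus R_CompleteNormedModule _ _ a b
      (pcont_ex_fst p a b Hab Hp) (pcont_ex_fst q a b Hab Hq)).
  - exact (@RInt_plus R_CompleteNormedModule _ _ a b
      (pcont_ex_snd p a b Hab Hp) (pcont_ex_snd q a b Hab Hq)).
Qed.

Lemma Cint_scal (c : C) (q : R -> C) (a b : R) : a <= b -> pcont_on a b q ->
  Cint (fun t => c * q t)%C a b = (c * Cint q a b)%C.
Proof.
  intros Hab Hq. pose proof (pcont_ex_fst q a b Hab Hq) as E1.
  pose proof (pcont_ex_snd q a b Hab Hq) as E2.
  assert (G : forall (k : R) (f : R -> R), ex_RInt f a b -> ex_RInt (fun t => k * f t) a b)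
    by (intros k f Hf; exact (@ex_RInt_scal R_NormedModule f a b k Hf)).
  assert (G' : forall (k : R) (f : R -> R), ex_RInt f a b ->
    RInt (fun t => k * f t) a b = k * RInt f a b)
    by (intros k f Hf; exact (@RInt_scal R_CompleteNormedModule f a b k Hf)).
  apply injective_projections; simpl.
  - rewrite <- !G' by assumption.
    exact (@RInt_minus R_CompleteNormedModule _ _ a b (G _ _ E1) (G _ _ E2)).
  - rewrite <- !G' by assumption.
    exact (@RInt_plus R_CompleteNormedModule _ _ a b (G _ _ E2) (G _ _ E1)).
Qed.

Lemma RInt_abs_bound (f : R -> R) (a b M : R) : a <= b -> ex_RInt f a b ->
  (forall t, a <= t <= b -> Rabs (f t) <= M) -> Rabs (RInt f a b) <= M * (b - a).
Proof.
  intros Hab He H.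
  apply (norm_RInt_le f (fun _ => M) a b); [exact Hab | exact H | |].
  - apply (@RInt_correct R_CompleteNormedModule), He.
  - replace (M * (b - a)) with (scal (b - a) M) by (unfold scal; simpl; unfold mult; simpl; ring).
    apply (@is_RInt_const R_NormedModule).
Qed.

(** The factor 2 comes from estimating the two components separately; only the order of
    magnitude matters in what follows. *)
Lemma Cint_bound (q : R -> C) (a b M : R) : a <= b -> pcont_on a b q ->
  (forall t, a <= t <= b -> Cmod (q t) <= M) -> Cmod (Cint q a b) <= 2 * (M * (b - a)).
Proof.
  intros Hab Hq H. apply Cmod_pair_le.
  - apply RInt_abs_bound; [exact Hab | apply pcont_ex_fst; assumption |].
    intros t Ht. eapply Rle_trans; [apply fst_le_Cmod | apply H, Ht].
  - apply RInt_abs_bound; [exact Hab | apply pcont_ex_snd; assumption |].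
    intros t Ht. eapply Rle_trans; [apply im_le_Cmod | apply H, Ht].
Qed.

Lemma Cint_derive (p q : R -> C) (a b : R) : a <= b -> pcont_on a b q ->
  (forall t, a <= t <= b -> pderiv p t (q t)) -> Cint q a b = (p b - p a)%C.
Proof.
  intros Hab Hq H.
  apply injective_projections; simpl; apply is_RInt_unique.
  - apply (is_RInt_derive (fun t => fst (p t)) (fun t => fst (q t))); intros t Ht;
      rewrite Rmin_left, Rmax_right in Ht by exact Hab.
    + apply pderiv_fst, H, Ht.
    + apply pcont_fst, Hq, Ht.
  - apply (is_RInt_derive (fun t => snd (p t)) (fun t => snd (q t))); intros t Ht;
      rewrite Rmin_left, Rmax_right in Ht by exact Hab.
    + apply pderiv_snd, H, Ht.
    + apply pcont_snd, Hq, Ht.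
Qed.

Definition seg_int (f : C -> C) (a b : C) : C :=
  ((b - a) * Cint (fun t => f (a + RtoC t * (b - a))%C) 0 1)%C.

Definition on_segment (a b z : C) : Prop :=
  exists t, 0 <= t <= 1 /\ z = (a + RtoC t * (b - a))%C.

Lemma pcont_line (f : C -> C) (a v : C) (t : R) : ccont f (a + RtoC t * v)%C ->
  pcont (fun s => f (a + RtoC s * v)%C) t.
Proof.
  intros H. apply (pcont_ccont f (fun s => a + RtoC s * v)%C); [exact H|].
  eapply pderiv_pcont. apply pderiv_line.
Qed.

Lemma seg_pcont (f : C -> C) (a b : C) :
  (forall z, on_segment a b z -> ccont f z) ->
  pcont_on 0 1 (fun t => f (a + RtoC t * (b - a))%C).
Proof. intros H t Ht. apply pcont_line, H. exists t. auto. Qed.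

Lemma seg_int_bound (f : C -> C) (a b : C) (M : R) :
  (forall z, on_segment a b z -> ccont f z) ->
  (forall z, on_segment a b z -> Cmod (f z) <= M) ->
  Cmod (seg_int f a b) <= 2 * M * Cmod (b - a).
Proof.
  intros Hc H. unfold seg_int. rewrite Cmod_mult.
  assert (E : Cmod (Cint (fun t => f (a + RtoC t * (b - a))%C) 0 1) <= 2 * (M * (1 - 0))).
  { apply Cint_bound; [lra | apply seg_pcont, Hc|].
    intros t Ht. apply H. exists t. auto. }
  pose proof (Cmod_ge_0 (b - a)). nra.
Qed.

Lemma seg_int_derive (g f : C -> C) (a b : C) :
  (forall z, on_segment a b z -> ccont f z) ->
  (forall z, on_segment a b z -> cderiv g z (f z)) ->
  seg_int f a b = (g b - g a)%C.
Proof.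
  intros Hc H. unfold seg_int.
  rewrite <- Cint_scal by (try lra; apply seg_pcont, Hc).
  rewrite (Cint_derive (fun t => g (a + RtoC t * (b - a))%C)).
  - replace (a + 1 * (b - a))%C with b by ring.
    replace (a + 0 * (b - a))%C with a by ring. reflexivity.
  - lra.
  - intros t Ht. apply pcont_mult; [apply pcont_const|]. apply (seg_pcont f a b Hc t Ht).
  - intros t Ht. rewrite Cmult_comm.
    apply (pderiv_comp g); [|apply pderiv_line]. apply H. exists t. auto.
Qed.

Lemma seg_int_plus (f g : C -> C) (a b : C) :
  (forall z, on_segment a b z -> ccont f z) -> (forall z, on_segment a b z -> ccont g z) ->
  seg_int (fun z => f z + g z)%C a b = (seg_int f a b + seg_int g a b)%C.
Proof.
  intros Hf Hg. unfold seg_int.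
  rewrite (Cint_plus (fun t => f (a + RtoC t * (b - a))%C) (fun t => g (a + RtoC t * (b - a))%C));
    [ring | lra | apply seg_pcont, Hf | apply seg_pcont, Hg].
Qed.

Lemma Cint_comp_lin (q : R -> C) (u v c d : R) :
  ex_RInt (fun t => fst (q t)) (u * c + v) (u * d + v) ->
  ex_RInt (fun t => snd (q t)) (u * c + v) (u * d + v) ->
  Cint q (u * c + v) (u * d + v) = (RtoC u * Cint (fun t => q (u * t + v)%R) c d)%C.
Proof.
  intros E1 E2.
  assert (G : forall f : R -> R, ex_RInt f (u * c + v) (u * d + v) ->
    RInt f (u * c + v) (u * d + v) = u * RInt (fun t => f (u * t + v)) c d).
  { intros f Hf.
    pose proof (@RInt_comp_lin R_CompleteNormedModule f u v c d Hf) as E.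
    rewrite <- E. destruct (Req_dec u 0) as [->|Hu].
    - rewrite Rmult_0_l. rewrite (RInt_ext _ (fun _ => 0)).
      + rewrite RInt_const. unfold scal; simpl; unfold mult; simpl. ring.
      + intros. unfold scal; simpl; unfold mult; simpl. ring.
    - apply (@RInt_scal R_CompleteNormedModule).
      apply (ex_RInt_ext (fun t => scal (/ u) (scal u (f (u * t + v))))).
      + intros x _. unfold scal; simpl; unfold mult; simpl. field. exact Hu.
      + apply (@ex_RInt_scal R_NormedModule), (@ex_RInt_comp_lin R_NormedModule), Hf. }
  unfold Cint, Cmult; simpl. f_equal.
  - rewrite (G (fun t => fst (q t)) E1). simpl. ring.
  - rewrite (G (fun t => snd (q t)) E2). simpl. ring.
Qed.

Lemma seg_int_swap (f : C -> C) (a b : C) :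
  (forall z, on_segment a b z -> ccont f z) -> seg_int f b a = (- seg_int f a b)%C.
Proof.
  intros Hf. unfold seg_int. pose proof (seg_pcont f a b Hf) as Hp.
  pose proof (pcont_ex_fst _ 0 1 Rle_0_1 Hp) as E1.
  pose proof (pcont_ex_snd _ 0 1 Rle_0_1 Hp) as E2.
  set (q := fun t => f (a + RtoC t * (b - a))%C) in *.
  assert (S : Cint q 1 0 = (- Cint q 0 1)%C).
  { apply injective_projections; symmetry.
    - exact (@opp_RInt_swap R_CompleteNormedModule _ _ _ E1).
    - exact (@opp_RInt_swap R_CompleteNormedModule _ _ _ E2). }
  pose proof (Cint_comp_lin q (-1) 1 0 1) as L.
  replace (-1 * 0 + 1) with 1 in L by ring. replace (-1 * 1 + 1) with 0 in L by ring.
  specialize (L (ex_RInt_swap _ _ _ E1) (ex_RInt_swap _ _ _ E2)).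
  assert (X : Cint (fun t => q (-1 * t + 1)) 0 1 = Cint (fun t => f (b + RtoC t * (a - b))%C) 0 1).
  { apply Cint_ext; [lra|]. intros t _. unfold q. f_equal.
    rewrite RtoC_plus, RtoC_mult. ring. }
  rewrite X in L. rewrite S in L.
  replace (Cint q 0 1) with (Cint (fun t : R => f (b + t * (a - b))%C) 0 1).
  - ring.
  - replace (Cint q 0 1) with (- (- Cint q 0 1))%C by ring. rewrite L. ring.
Qed.

Definition midpoint (a b : C) : C := ((a + b) * RtoC (/ 2))%C.

Lemma seg_int_midpoint (f : C -> C) (a b : C) :
  (forall z, on_segment a b z -> ccont f z) ->
  seg_int f a b = (seg_int f a (midpoint a b) + seg_int f (midpoint a b) b)%C.
Proof.
  intros Hf. unfold seg_int. pose proof (seg_pcont f a b Hf) as Hp.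
  set (q := fun t => f (a + RtoC t * (b - a))%C) in *.
  assert (P1 : pcont_on 0 (/ 2) q) by (intros t Ht; apply Hp; lra).
  assert (P2 : pcont_on (/ 2) 1 q) by (intros t Ht; apply Hp; lra).
  assert (H2 : 0 <= / 2) by lra. assert (H3 : / 2 <= 1) by lra.
  assert (S : Cint q 0 1 = (Cint q 0 (/ 2) + Cint q (/ 2) 1)%C).
  { apply injective_projections; symmetry.
    - exact (@RInt_Chasles R_CompleteNormedModule _ _ _ _
        (pcont_ex_fst q _ _ H2 P1) (pcont_ex_fst q _ _ H3 P2)).
    - exact (@RInt_Chasles R_CompleteNormedModule _ _ _ _
        (pcont_ex_snd q _ _ H2 P1) (pcont_ex_snd q _ _ H3 P2)). }
  assert (H2' : (RtoC (/ 2) * 2)%C = 1).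
  { rewrite <- RtoC_mult. f_equal. lra. }
  assert (L1 : Cint q 0 (/ 2) =
    (RtoC (/ 2) * Cint (fun t => f (a + RtoC t * (midpoint a b - a))%C) 0 1)%C).
  { pose proof (Cint_comp_lin q (/ 2) 0 0 1) as L.
    replace (/ 2 * 0 + 0) with 0 in L by ring. replace (/ 2 * 1 + 0) with (/ 2) in L by ring.
    rewrite L; [|apply pcont_ex_fst; assumption|apply pcont_ex_snd; assumption].
    f_equal. apply Cint_ext; [lra|]. intros t _. unfold q, midpoint. f_equal.
    rewrite RtoC_plus, RtoC_mult.
    replace ((a + b) * RtoC (/ 2) - a)%C with (RtoC (/ 2) * (a + b) - (RtoC (/ 2) * 2) * a)%C
      by (rewrite H2'; ring). ring. }
  assert (L2 : Cint q (/ 2) 1 =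
    (RtoC (/ 2) * Cint (fun t => f (midpoint a b + RtoC t * (b - midpoint a b))%C) 0 1)%C).
  { pose proof (Cint_comp_lin q (/ 2) (/ 2) 0 1) as L.
    replace (/ 2 * 0 + / 2) with (/ 2) in L by ring.
    replace (/ 2 * 1 + / 2) with 1 in L by lra.
    rewrite L; [|apply pcont_ex_fst; assumption|apply pcont_ex_snd; assumption].
    f_equal. apply Cint_ext; [lra|]. intros t _. unfold q, midpoint. f_equal.
    rewrite RtoC_plus, RtoC_mult.
    replace (b - (a + b) * RtoC (/ 2))%C with ((RtoC (/ 2) * 2) * b - RtoC (/ 2) * (a + b))%C
      by (rewrite H2'; ring).
    replace a with ((RtoC (/ 2) * 2) * a)%C at 1 by (rewrite H2'; ring). ring. }
  assert (Ha : (midpoint a b - a = RtoC (/ 2) * (b - a))%C).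
  { unfold midpoint. replace a with ((RtoC (/ 2) * 2) * a)%C at 2 by (rewrite H2'; ring). ring. }
  assert (Hb : (b - midpoint a b = RtoC (/ 2) * (b - a))%C).
  { unfold midpoint. replace b with ((RtoC (/ 2) * 2) * b)%C at 1 by (rewrite H2'; ring). ring. }
  rewrite S, L1, L2.
  set (I := Cint (fun t => f (a + t * (midpoint a b - a))%C) 0 1).
  set (J := Cint (fun t => f (midpoint a b + t * (b - midpoint a b))%C) 0 1).
  rewrite Ha, Hb. ring.
Qed.

(** * Goursat's theorem *)

Lemma two_pow_pos (n : nat) : 0 < 2 ^ n.
Proof. apply pow_lt. lra. Qed.

Lemma exists_pow2_small (d eps : R) : 0 <= d -> 0 < eps -> exists n, d / 2 ^ n < eps.
Proof.
  intros Hd He.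
  destruct (pow_lt_1_zero (/ 2)) with (y := eps / (d + 1)) as [N HN].
  - rewrite Rabs_pos_eq; lra.
  - apply Rdiv_lt_0_compat; lra.
  - exists N. specialize (HN N (Nat.le_refl N)).
    rewrite Rabs_pos_eq in HN by (apply pow_le; lra). rewrite pow_inv in HN.
    apply (Rmult_lt_compat_r (d + 1)) in HN; [|lra].
    replace (eps / (d + 1) * (d + 1)) with eps in HN by (field; lra).
    pose proof (Rinv_0_lt_compat _ (two_pow_pos N)). unfold Rdiv. nra.
Qed.

(** The sequences x n - 2 d / 2^n and x n + 2 d / 2^n are monotone and enclose x n, so they
    enclose a limit together with the rate of convergence. *)
Lemma geometric_limit_R (x : nat -> R) (d : R) :
  (forall n, Rabs (x (S n) - x n) <= d / 2 ^ n) ->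
  exists l, forall n, Rabs (x n - l) <= 2 * d / 2 ^ n.
Proof.
  intros H.
  assert (E : forall n, 2 * d / 2 ^ S n = d / 2 ^ n).
  { intros n. simpl. field. apply pow_nonzero. lra. }
  set (y := fun n => x n - 2 * d / 2 ^ n). set (z := fun n => x n + 2 * d / 2 ^ n).
  assert (Hy : forall n, y n <= y (S n)).
  { intros n. unfold y. rewrite E. pose proof (Rabs_le_between' (x (S n)) (x n) (d / 2 ^ n)) as B.
    destruct (proj1 B (H n)). unfold Rdiv in *. lra. }
  assert (Hz : forall n, z (S n) <= z n).
  { intros n. unfold z. rewrite E. pose proof (Rabs_le_between' (x (S n)) (x n) (d / 2 ^ n)) as B.
    destruct (proj1 B (H n)). unfold Rdiv in *. lra. }
  assert (Hd : 0 <= d).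
  { pose proof (H 0%nat) as A. simpl in A. pose proof (Rabs_pos (x 1%nat - x 0%nat)). lra. }
  assert (Hyz : forall n, y n <= z n).
  { intros n. unfold y, z. pose proof (two_pow_pos n).
    assert (0 <= 2 * d / 2 ^ n) by (apply Rdiv_le_0_compat; lra). lra. }
  assert (My : forall n k, y n <= y (n + k)%nat).
  { intros n k. induction k; [rewrite Nat.add_0_r; lra|].
    rewrite Nat.add_succ_r. eapply Rle_trans; [exact IHk | apply Hy]. }
  assert (Mz : forall n k, z (n + k)%nat <= z n).
  { intros n k. induction k; [rewrite Nat.add_0_r; lra|].
    rewrite Nat.add_succ_r. eapply Rle_trans; [apply Hz | exact IHk]. }
  assert (Myz : forall n m, y n <= z m).
  { intros n m. eapply Rle_trans; [apply (My n m)|].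
    eapply Rle_trans; [apply Hyz|]. rewrite Nat.add_comm. apply Mz. }
  destruct (completeness (fun v => exists n, v = y n)) as [l [Hub Hleast]].
  - exists (z 0%nat). intros v [n ->]. apply Myz.
  - exists (y 0%nat). exists 0%nat. reflexivity.
  - exists l. intros n. apply Rabs_le.
    assert (y n <= l) by (apply Hub; exists n; reflexivity).
    assert (l <= z n) by (apply Hleast; intros v [m ->]; apply Myz).
    unfold y, z in *. lra.
Qed.

Lemma geometric_limit (x : nat -> C) (d : R) :
  (forall n, Cmod (x (S n) - x n) <= d / 2 ^ n) ->
  exists l, forall n, Cmod (x n - l) <= 4 * d / 2 ^ n.
Proof.
  intros H.
  destruct (geometric_limit_R (fun n => fst (x n)) d) as [a Ha].
  { intros n. eapply Rle_trans; [|apply (H n)]. apply (fst_le_Cmod (x (S n) - x n)%C). }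
  destruct (geometric_limit_R (fun n => snd (x n)) d) as [b Hb].
  { intros n. eapply Rle_trans; [|apply (H n)]. apply (im_le_Cmod (x (S n) - x n)%C). }
  exists (a, b). intros n.
  replace (4 * d / 2 ^ n) with (2 * (2 * d / 2 ^ n)) by (unfold Rdiv; ring).
  apply Cmod_pair_le; [apply Ha | apply Hb].
Qed.

Lemma segment_in_closed_ball (o a b z : C) (r : R) : Cmod (a - o) <= r -> Cmod (b - o) <= r ->
  on_segment a b z -> Cmod (z - o) <= r.
Proof.
  intros Ha Hb [t [Ht ->]].
  replace (a + RtoC t * (b - a) - o)%C with (RtoC t * (b - o) + RtoC (1 - t) * (a - o))%C
    by (rewrite RtoC_minus; ring).
  eapply Rle_trans; [apply Cmod_triangle|].
  rewrite !Cmod_mult, !Cmod_RtoC_pos by lra. nra.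
Qed.

Lemma half_half : (RtoC (/ 2) + RtoC (/ 2) = 1)%C.
Proof. rewrite <- RtoC_plus. f_equal. lra. Qed.

Lemma midpoint_on_segment (a b : C) : on_segment a b (midpoint a b).
Proof.
  exists (/ 2). split; [lra|]. unfold midpoint.
  replace a with ((RtoC (/ 2) + RtoC (/ 2)) * a)%C at 2 by (rewrite half_half; ring). ring.
Qed.

Lemma Cmod_half (z : C) : Cmod (RtoC (/ 2) * z) = Cmod z / 2.
Proof. rewrite Cmod_mult, Cmod_RtoC_pos by lra. lra. Qed.

Lemma midpoint_sub_shared (a b c : C) : Cmod (midpoint a b - midpoint a c) = Cmod (b - c) / 2.
Proof. rewrite <- Cmod_half. f_equal. unfold midpoint. ring. Qed.

Lemma midpoint_comm (a b : C) : midpoint a b = midpoint b a.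
Proof. unfold midpoint. ring. Qed.

Lemma midpoint_sub_end (a b : C) : Cmod (midpoint a b - a) = Cmod (b - a) / 2.
Proof.
  rewrite <- Cmod_half. f_equal. unfold midpoint.
  replace a with ((RtoC (/ 2) + RtoC (/ 2)) * a)%C at 2 by (rewrite half_half; ring). ring.
Qed.

Definition tri_int (f : C -> C) (a b c : C) : C :=
  (seg_int f a b + seg_int f b c + seg_int f c a)%C.

(** The invariant of the repeated subdivision. *)
Definition small_tri (o : C) (r : R) (a b c : C) (d : R) : Prop :=
  (Cmod (a - o) <= r /\ Cmod (b - o) <= r /\ Cmod (c - o) <= r) /\
  (Cmod (b - a) <= d /\ Cmod (c - b) <= d /\ Cmod (a - c) <= d).

(** The midpoints of the sides cut a triangle into four; the integrals over the inner
    sides cancel, so one of the four carries at least a quarter of the integral. *)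
Lemma tri_subdivide (o : C) (r : R) (f : C -> C) (a b c : C) (d : R) :
  (forall z, Cmod (z - o) <= r -> ccont f z) -> small_tri o r a b c d ->
  exists a' b' c', small_tri o r a' b' c' (d / 2) /\ Cmod (a' - a) <= d /\
    Cmod (tri_int f a b c) <= 4 * Cmod (tri_int f a' b' c').
Proof.
  intros Hf [[Ha [Hb Hc]] [Hab [Hbc Hca]]].
  assert (Hseg : forall x y, Cmod (x - o) <= r -> Cmod (y - o) <= r ->
    forall z, on_segment x y z -> ccont f z)
    by (intros x y Hx Hy z Hz; apply Hf, (segment_in_closed_ball o x y); assumption).
  set (p := midpoint a b). set (q := midpoint b c). set (s := midpoint c a).
  assert (Hp : Cmod (p - o) <= r)
    by (apply (segment_in_closed_ball o a b); auto using midpoint_on_segment).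
  assert (Hq : Cmod (q - o) <= r)
    by (apply (segment_in_closed_ball o b c); auto using midpoint_on_segment).
  assert (Hs : Cmod (s - o) <= r)
    by (apply (segment_in_closed_ball o c a); auto using midpoint_on_segment).
  assert (E : tri_int f a b c =
    (tri_int f a p s + tri_int f p b q + tri_int f s q c + tri_int f q s p)%C).
  { unfold tri_int.
    rewrite (seg_int_midpoint f a b), (seg_int_midpoint f b c), (seg_int_midpoint f c a)
      by (apply Hseg; assumption).
    fold p q s.
    rewrite (seg_int_swap f s p), (seg_int_swap f p q), (seg_int_swap f q s)
      by (apply Hseg; assumption).
    ring. }
  assert (Epa : Cmod (p - a) = Cmod (b - a) / 2) by apply midpoint_sub_end.
  assert (Epb : Cmod (p - b) = Cmod (b - a) / 2).
  { unfold p. rewrite midpoint_comm, midpoint_sub_end, Cmod_sub_sym. reflexivity. }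
  assert (Eqb : Cmod (q - b) = Cmod (c - b) / 2) by apply midpoint_sub_end.
  assert (Eqc : Cmod (q - c) = Cmod (c - b) / 2).
  { unfold q. rewrite midpoint_comm, midpoint_sub_end, Cmod_sub_sym. reflexivity. }
  assert (Esc : Cmod (s - c) = Cmod (a - c) / 2) by apply midpoint_sub_end.
  assert (Esa : Cmod (s - a) = Cmod (a - c) / 2).
  { unfold s. rewrite midpoint_comm, midpoint_sub_end, Cmod_sub_sym. reflexivity. }
  assert (Eps : Cmod (p - s) = Cmod (c - b) / 2).
  { unfold p, s. rewrite (midpoint_comm c a), midpoint_sub_shared, Cmod_sub_sym. reflexivity. }
  assert (Epq : Cmod (p - q) = Cmod (a - c) / 2).
  { unfold p, q. rewrite (midpoint_comm a b). apply midpoint_sub_shared. }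
  assert (Eqs : Cmod (q - s) = Cmod (b - a) / 2).
  { unfold q, s. rewrite (midpoint_comm b c). apply midpoint_sub_shared. }
  assert (Hqa : Cmod (q - a) <= d).
  { pose proof (Cmod_sub_triangle q p a) as T. rewrite (Cmod_sub_sym q p) in T. lra. }
  assert (Tr : Cmod (tri_int f a b c) <= Cmod (tri_int f a p s) + Cmod (tri_int f p b q)
    + Cmod (tri_int f s q c) + Cmod (tri_int f q s p)).
  { rewrite E. eapply Rle_trans; [apply Cmod_triangle|]. apply Rplus_le_compat_r.
    eapply Rle_trans; [apply Cmod_triangle|]. apply Rplus_le_compat_r. apply Cmod_triangle. }
  assert (D0 : 0 <= d) by (eapply Rle_trans; [apply Cmod_ge_0 | exact Hab]).
  assert (Eaa : Cmod (a - a) = 0) by (replace (a - a)%C with (RtoC 0) by ring; apply Cmod_0).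
  destruct (Rle_lt_dec (Cmod (tri_int f a b c)) (4 * Cmod (tri_int f a p s))) as [L|L1].
  { exists a, p, s. unfold small_tri. rewrite (Cmod_sub_sym s p), (Cmod_sub_sym a s).
    repeat split; lra. }
  destruct (Rle_lt_dec (Cmod (tri_int f a b c)) (4 * Cmod (tri_int f p b q))) as [L|L2].
  { exists p, b, q. unfold small_tri. rewrite (Cmod_sub_sym b p).
    repeat split; lra. }
  destruct (Rle_lt_dec (Cmod (tri_int f a b c)) (4 * Cmod (tri_int f s q c))) as [L|L3].
  { exists s, q, c. unfold small_tri. rewrite (Cmod_sub_sym c q).
    repeat split; lra. }
  exists q, s, p. unfold small_tri. rewrite (Cmod_sub_sym s q), (Cmod_sub_sym q p).
  repeat split; lra.
Qed.

Lemma cderiv_line (k p m z : C) : cderiv (fun w => k + (w - p) * m)%C z m.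
Proof.
  apply (cderiv_ext (fun w => (k - p * m) + m * w)%C); [intros w; ring|].
  apply (cderiv_eq _ _ (0 + m * 1)%C); [ring|].
  apply (cderiv_plus (fun _ => k - p * m)%C (fun w => m * w)%C).
  - apply cderiv_const.
  - apply (cderiv_scal m (fun w => w)), cderiv_id.
Qed.

(** Affine functions have a polynomial primitive. *)
Lemma tri_int_affine (f : C -> C) (p k m : C) (a b c : C) :
  (forall z, f z = k + (z - p) * m)%C -> tri_int f a b c = 0.
Proof.
  intros E.
  assert (D : forall z, cderiv (fun w => k * w + RtoC (/ 2) * m * ((w - p) * (w - p)))%C z (f z)).
  { intros z.
    apply (cderiv_eq _ _ (k * 1 + RtoC (/ 2) * m * (1 * (z - p) + (z - p) * 1))%C).
    - rewrite E. replace ((z - p) * m)%C with ((RtoC (/ 2) + RtoC (/ 2)) * ((z - p) * m))%C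
        by (rewrite half_half; ring). ring.
    - assert (Dp : cderiv (fun w => w - p)%C z 1).
      { apply (cderiv_ext (fun w => - p + (w - 0) * 1)%C); [intros w; ring|]. apply cderiv_line. }
      apply (cderiv_plus (fun w => k * w)%C (fun w => RtoC (/ 2) * m * ((w - p) * (w - p)))%C).
      + apply (cderiv_scal k (fun w => w)), cderiv_id.
      + apply (cderiv_scal (RtoC (/ 2) * m) (fun w => (w - p) * (w - p))%C).
        apply (cderiv_mult (fun w => w - p)%C (fun w => w - p)%C); exact Dp. }
  assert (Cf : forall z, ccont f z).
  { intros z. apply (cderiv_ccont f z m).
    apply (cderiv_ext (fun w => k + (w - p) * m)%C); [intros w; symmetry; apply E|].
    apply cderiv_line. }
  unfold tri_int. rewrite !(seg_int_derive _ f _ _ (fun z _ => Cf z) (fun z _ => D z)). ring.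
Qed.

Lemma ccont_plus (f g : C -> C) (z : C) : ccont f z -> ccont g z ->
  ccont (fun w => f w + g w)%C z.
Proof.
  intros Hp Hq eps Heps.
  destruct (Hp (eps / 2)) as [d [Hd Hp']]; [lra|].
  destruct (Hq (eps / 2)) as [e [He Hq']]; [lra|].
  exists (Rmin d e). split; [apply Rmin_pos; assumption|]. intros s Hs.
  destruct (lt_Rmin _ _ _ Hs) as [M1 M2].
  pose proof (Hp' s M1). pose proof (Hq' s M2).
  replace (f s + g s - (f z + g z))%C with ((f s - f z) + (g s - g z))%C by ring.
  eapply Rle_lt_trans; [apply Cmod_triangle|]. lra.
Qed.

Lemma tri_int_bound (f : C -> C) (a b c : C) (d M : R) :
  (forall z, on_segment a b z \/ on_segment b c z \/ on_segment c a z ->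
     ccont f z /\ Cmod (f z) <= M) ->
  Cmod (b - a) <= d -> Cmod (c - b) <= d -> Cmod (a - c) <= d ->
  Cmod (tri_int f a b c) <= 6 * M * d.
Proof.
  intros H H1 H2 H3.
  assert (HM : 0 <= M).
  { eapply Rle_trans; [apply Cmod_ge_0|]. apply (H a). left. exists 0. split; [lra|]. ring. }
  assert (G : forall x y, (forall z, on_segment x y z -> ccont f z /\ Cmod (f z) <= M) ->
    Cmod (y - x) <= d -> Cmod (seg_int f x y) <= 2 * M * d).
  { intros x y Hxy Hd. eapply Rle_trans; [apply (seg_int_bound f x y M)|].
    - intros z Hz. apply (Hxy z Hz).
    - intros z Hz. apply (Hxy z Hz).
    - apply Rmult_le_compat_l; lra. }
  unfold tri_int. eapply Rle_trans; [apply Cmod_triangle|].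
  eapply Rle_trans; [apply Rplus_le_compat_r, Cmod_triangle|].
  pose proof (G a b (fun z Hz => H z (or_introl Hz)) H1).
  pose proof (G b c (fun z Hz => H z (or_intror (or_introl Hz))) H2).
  pose proof (G c a (fun z Hz => H z (or_intror (or_intror Hz))) H3). lra.
Qed.

Lemma Rle_eps_mult (x k : R) : 0 <= k -> (forall eps, 0 < eps -> x <= k * eps) -> x <= 0.
Proof.
  intros Hk H. destruct (Rle_lt_dec x 0) as [|Hx]; [assumption|].
  specialize (H (x / (k + 1) / 2)).
  assert (0 < x / (k + 1)) by (apply Rdiv_lt_0_compat; lra).
  assert (E : x / (k + 1) * (k + 1) = x) by (field; lra).
  assert (x <= k * (x / (k + 1) / 2)) by (apply H; lra). nra.
Qed.

(** Repeated subdivision shrinks to a point p.  There f equals an affine function, whose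
    triangle integrals vanish, up to an error eps |z - p|; hence the n-th triangle contributes at most
    a constant times eps d^2 / 4^n, while it carries at least 4^(-n) of the original integral. *)
Theorem goursat (o : C) (r : R) (f f1 : C -> C) (a b c : C) : holo o r f f1 ->
  Cmod (a - o) < r -> Cmod (b - o) < r -> Cmod (c - o) < r -> tri_int f a b c = 0.
Proof.
  intros Hf Ha Hb Hc.
  set (r' := Rmax (Cmod (a - o)) (Rmax (Cmod (b - o)) (Cmod (c - o)))).
  assert (Hr' : r' < r) by (unfold r'; repeat apply Rmax_lub_lt; assumption).
  assert (Hcont : forall z, Cmod (z - o) <= r' -> ccont f z).
  { intros z Hz. apply cderiv_ccont with (f1 z). apply Hf. lra. }
  set (d := Cmod (b - a) + Cmod (c - b) + Cmod (a - c)).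
  pose proof (Cmod_ge_0 (b - a)) as P1. pose proof (Cmod_ge_0 (c - b)) as P2.
  pose proof (Cmod_ge_0 (a - c)) as P3.
  set (St := {s : C * C * C * R |
    small_tri o r' (fst (fst (fst s))) (snd (fst (fst s))) (snd (fst s)) (snd s)}).
  set (A := fun s : St => fst (fst (fst (proj1_sig s)))).
  set (B := fun s : St => snd (fst (fst (proj1_sig s)))).
  set (K := fun s : St => snd (fst (proj1_sig s))).
  set (D := fun s : St => snd (proj1_sig s)).
  set (T := fun s : St => Cmod (tri_int f (A s) (B s) (K s))).
  assert (HS : forall s : St, small_tri o r' (A s) (B s) (K s) (D s))
    by (intros s; exact (proj2_sig s)).
  assert (Hstep : forall s : St, exists s' : St,
    D s' = D s / 2 /\ Cmod (A s' - A s) <= D s /\ T s <= 4 * T s').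
  { intros s. destruct (tri_subdivide o r' f _ _ _ _ Hcont (proj2_sig s))
      as [a' [b' [c' [H1 [H2 H3]]]]].
    exists (exist _ (a', b', c', D s / 2) H1). split; [reflexivity|]. split; assumption. }
  assert (S0 : small_tri o r' a b c d).
  { split.
    - split; [apply Rmax_l|]. split; (eapply Rle_trans; [|apply Rmax_r]);
        [apply Rmax_l | apply Rmax_r].
    - unfold d. repeat split; lra. }
  set (s0 := exist _ (a, b, c, d) S0 : St).
  set (next := fun s => proj1_sig (constructive_indefinite_description _ (Hstep s))).
  set (u := fun n => Nat.iter n next s0).
  assert (Hu : forall n, D (u (S n)) = D (u n) / 2 /\ Cmod (A (u (S n)) - A (u n)) <= D (u n)
    /\ T (u n) <= 4 * T (u (S n))).
  { intros n. apply (proj2_sig (constructive_indefinite_description _ (Hstep (u n)))). }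
  assert (HD : forall n, D (u n) = d / 2 ^ n).
  { induction n as [|n IH].
    - simpl. unfold Rdiv. rewrite Rinv_1. unfold D. simpl. ring.
    - rewrite (proj1 (Hu n)), IH. simpl. field. apply pow_nonzero. lra. }
  assert (HT : forall n, Cmod (tri_int f a b c) <= 4 ^ n * T (u n)).
  { induction n as [|n IH].
    - rewrite pow_O, Rmult_1_l. apply Rle_refl.
    - eapply Rle_trans; [exact IH|].
      replace (4 ^ S n * T (u (S n))) with (4 ^ n * (4 * T (u (S n)))) by (simpl; ring).
      apply Rmult_le_compat_l; [apply pow_le; lra | apply (Hu n)]. }
  destruct (geometric_limit (fun n => A (u n)) d) as [p Hp].
  { intros n. rewrite <- HD. apply Hu. }
  assert (Hd0 : 0 <= d) by (unfold d; lra).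
  assert (Hpr : Cmod (p - o) <= r').
  { cut (Cmod (p - o) - r' <= 0); [lra|].
    apply (Rle_eps_mult _ 1); [lra|]. intros eps Heps.
    destruct (exists_pow2_small (4 * d) eps) as [n Hn]; [lra | exact Heps|].
    pose proof (Hp n) as H1. cbv beta in H1.
    pose proof (proj1 (proj1 (HS (u n)))) as H2.
    pose proof (Cmod_sub_triangle p (A (u n)) o) as H3. rewrite (Cmod_sub_sym p (A (u n))) in H3. lra. }
  apply Cmod_eq_0. apply Rle_antisym; [|apply Cmod_ge_0].
  apply (Rle_eps_mult _ (30 * d * d)); [apply Rmult_le_pos; lra|]. intros eps Heps.
  pose proof (Hf p ltac:(lra)) as Hder.
  destruct (proj1 (cderiv_eps _ _ _) Hder eps Heps) as [delta [Hdelta Hd']].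
  destruct (exists_pow2_small (5 * d) delta) as [n Hn]; [lra | exact Hdelta|].
  destruct (HS (u n)) as [[Ia [Ib Ic]] [Lab [Lbc Lca]]].
  rewrite HD in Lab, Lbc, Lca. pose proof (Hp n) as Hpa. cbv beta in Hpa.
  set (dn := d / 2 ^ n) in *.
  assert (Edn4 : 4 * d / 2 ^ n = 4 * dn) by (unfold dn, Rdiv; ring).
  assert (Edn5 : 5 * d / 2 ^ n = 5 * dn) by (unfold dn, Rdiv; ring).
  rewrite Edn4 in Hpa. rewrite Edn5 in Hn.
  assert (Hdn : 0 <= dn) by (eapply Rle_trans; [apply Cmod_ge_0 | exact Lab]).
  assert (Hpb : Cmod (B (u n) - p) <= 5 * dn).
  { pose proof (Cmod_sub_triangle (B (u n)) (A (u n)) p). lra. }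
  assert (Hpc : Cmod (K (u n) - p) <= 5 * dn).
  { pose proof (Cmod_sub_triangle (K (u n)) (A (u n)) p) as H1.
    rewrite (Cmod_sub_sym (K (u n)) (A (u n))) in H1. lra. }
  assert (Hpa' : Cmod (A (u n) - p) <= 5 * dn) by lra.
  set (lin := fun z => (f p + (z - p) * f1 p)%C).
  set (rest := fun z => (f z + -1 * lin z)%C).
  assert (Clin : forall z, ccont lin z).
  { intros z. apply cderiv_ccont with (f1 p). apply cderiv_line. }
  assert (Crest : forall z, Cmod (z - o) <= r' -> ccont rest z).
  { intros z Hz. apply ccont_plus; [apply Hcont, Hz|].
    apply cderiv_ccont with (-1 * f1 p)%C. apply cderiv_scal, cderiv_line. }
  assert (Hseg : forall x y, Cmod (x - o) <= r' -> Cmod (y - o) <= r' ->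
    Cmod (x - p) <= 5 * dn -> Cmod (y - p) <= 5 * dn ->
    forall z, on_segment x y z -> ccont rest z /\ Cmod (rest z) <= eps * (5 * dn)).
  { intros x y Hx Hy Hx' Hy' z Hz. split.
    - apply Crest. apply (segment_in_closed_ball o x y); assumption.
    - pose proof (segment_in_closed_ball p x y z _ Hx' Hy' Hz) as Hzp.
      unfold rest, lin.
      replace (f z + -1 * (f p + (z - p) * f1 p))%C with (f z - f p - (z - p) * f1 p)%C by ring.
      eapply Rle_trans; [apply Hd'; lra|]. apply Rmult_le_compat_l; lra. }
  assert (Er : tri_int f (A (u n)) (B (u n)) (K (u n))
     = tri_int rest (A (u n)) (B (u n)) (K (u n))).
  { assert (Sg : forall x y, Cmod (x - o) <= r' -> Cmod (y - o) <= r' ->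
      seg_int rest x y = (seg_int f x y + seg_int (fun z => -1 * lin z)%C x y)%C).
    { intros x y Hx Hy. unfold rest. apply seg_int_plus.
      - intros z Hz. apply Hcont, (segment_in_closed_ball o x y); assumption.
      - intros z _. apply cderiv_ccont with (-1 * f1 p)%C. apply cderiv_scal, cderiv_line. }
    pose proof (tri_int_affine (fun z => -1 * lin z)%C p (-1 * f p)%C (-1 * f1 p)%C
      (A (u n)) (B (u n)) (K (u n)) ltac:(intros z; unfold lin; ring)) as Z.
    unfold tri_int in *. rewrite !Sg by assumption.
    match goal with |- ?L = ?R => replace R with (L + 0)%C; [ring|] end.
    rewrite <- Z. ring. }
  eapply Rle_trans; [apply (HT n)|]. unfold T. rewrite Er.
  assert (Bd : Cmod (tri_int rest (A (u n)) (B (u n)) (K (u n))) <= 6 * (eps * (5 * dn)) * dn).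
  { apply tri_int_bound; [|assumption..].
    intros z [Hz|[Hz|Hz]]; revert Hz; apply Hseg; assumption. }
  assert (E4 : 4 ^ n * (dn * dn) = d * d).
  { unfold dn. replace (4 ^ n) with (2 ^ n * 2 ^ n).
    - field. apply pow_nonzero. lra.
    - rewrite <- Rpow_mult_distr. replace (2 * 2) with 4 by lra. reflexivity. }
  pose proof (pow_lt 4 n ltac:(lra)) as P4.
  eapply Rle_trans; [apply Rmult_le_compat_l; [lra | exact Bd]|].
  replace (4 ^ n * (6 * (eps * (5 * dn)) * dn)) with (30 * eps * (4 ^ n * (dn * dn))) by ring.
  rewrite E4. apply Req_le. ring.
Qed.

(** * Primitives and difference quotients *)

Lemma Cmod_center (o : C) : Cmod (o - o) = 0.
Proof. replace (o - o)%C with (RtoC 0) by ring. apply Cmod_0. Qed.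

Lemma holo_ccont (o : C) (r : R) (f f1 : C -> C) (z : C) :
  holo o r f f1 -> Cmod (z - o) < r -> ccont f z.
Proof. intros Hf Hz. apply cderiv_ccont with (f1 z). apply Hf, Hz. Qed.

Lemma ball_segment (o a b z : C) (r : R) : Cmod (a - o) < r -> Cmod (b - o) < r ->
  on_segment a b z -> Cmod (z - o) < r.
Proof. intros Ha Hb [t [Ht ->]]. apply ball_convex; assumption. Qed.

(** Goursat's theorem makes the integral from the centre independent of the detour, so
    its increment is an integral over a short segment. *)
Lemma holo_primitive (o : C) (r : R) (f f1 : C -> C) : 0 < r -> holo o r f f1 ->
  holo o r (seg_int f o) f.
Proof.
  intros Hr Hf z Hz. rewrite cderiv_eps. intros eps Heps.
  destruct (holo_ccont o r f f1 z Hf Hz (eps / 2)) as [d [Hd Hd']]; [lra|].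
  exists (Rmin d (r - Cmod (z - o))). split; [apply Rmin_pos; lra|].
  intros w Hw.
  destruct (lt_Rmin _ _ _ Hw) as [H1 H2].
  assert (Hwo : Cmod (w - o) < r) by (pose proof (Cmod_sub_triangle w z o); lra).
  assert (Hoo : Cmod (o - o) < r) by (rewrite Cmod_center; exact Hr).
  pose proof (goursat o r f f1 o z w Hf Hoo Hz Hwo) as G. unfold tri_int in G.
  rewrite (seg_int_swap f o w) in G
    by (intros u Hu; apply (holo_ccont o r f f1 u Hf), (ball_segment o o w); assumption).
  assert (Hzz : Cmod (z - z) <= Cmod (w - z)) by (rewrite Cmod_center; apply Cmod_ge_0).
  assert (Cs : forall u, on_segment z w u -> ccont f u)
    by (intros u Hu; apply (holo_ccont o r f f1 u Hf), (ball_segment o z w); assumption).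
  assert (Cc : forall u, ccont (fun _ => - f z)%C u)
    by (intros u; apply cderiv_ccont with (RtoC 0); apply cderiv_const).
  assert (E : (seg_int f o w - seg_int f o z - (w - z) * f z)%C
     = seg_int (fun u => f u + - f z)%C z w).
  { rewrite (seg_int_plus f (fun _ => - f z)%C z w Cs) by (intros; apply Cc).
    rewrite (seg_int_derive (fun u => 0 + (u - 0) * - f z)%C (fun _ => - f z)%C z w)
      by (intros; first [apply Cc | apply cderiv_line]).
    replace (seg_int f o w) with (seg_int f o z + seg_int f z w)%C; [ring|].
    replace (seg_int f o w) with (0 + seg_int f o w)%C by ring. rewrite <- G. ring. }
  rewrite E.
  eapply Rle_trans; [apply (seg_int_bound _ z w (eps / 2))|].
  - intros u Hu. apply ccont_plus; [apply Cs, Hu | apply Cc].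
  - intros u Hu. left. apply Hd'. eapply Rle_lt_trans; [|exact H1].
    apply (segment_in_closed_ball z z w u); [exact Hzz | apply Rle_refl | exact Hu].
  - apply Req_le. field.
Qed.

Lemma holo_of_ex (o : C) (r : R) (f : C -> C) :
  (forall z, Cmod (z - o) < r -> exists l, cderiv f z l) -> holo o r f (C_derive f).
Proof.
  intros H z Hz. destruct (H z Hz) as [l Hl].
  rewrite (is_C_derive_unique f z l Hl). exact Hl.
Qed.

(** The difference quotient with its diagonal value filled in.  It serves
    both for Cauchy's formula and for dividing out zeros. *)
Definition diff_quot (f f1 : C -> C) (z w : C) : C :=
  if excluded_middle_informative (w = z) then f1 z else ((f w - f z) / (w - z))%C.

Lemma diff_quot_diag (f f1 : C -> C) (z : C) : diff_quot f f1 z z = f1 z.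
Proof.
  unfold diff_quot. destruct (excluded_middle_informative (z = z)); [reflexivity|congruence].
Qed.

Lemma diff_quot_off (f f1 : C -> C) (z w : C) : w <> z ->
  diff_quot f f1 z w = ((f w - f z) / (w - z))%C.
Proof.
  intros H. unfold diff_quot. destruct (excluded_middle_informative (w = z)); [congruence|reflexivity].
Qed.

Lemma diff_quot_mul (f f1 : C -> C) (z w : C) :
  f w = (f z + (w - z) * diff_quot f f1 z w)%C.
Proof.
  destruct (classic (w = z)) as [->|H].
  - ring.
  - rewrite diff_quot_off by exact H. field. apply Cminus_nz, H.
Qed.

Lemma cderiv_sub_const (c z : C) : cderiv (fun w => w - c)%C z 1.
Proof.
  apply (cderiv_ext (fun w => - c + (w - 0) * 1)%C); [intros w; ring|]. apply cderiv_line.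
Qed.

Lemma cderiv_const_sub (c z : C) : cderiv (fun w => c - w)%C z (-1)%C.
Proof.
  apply (cderiv_ext (fun w => c + (w - 0) * -1)%C); [intros w; ring|]. apply cderiv_line.
Qed.

Lemma taylor_remainder (f f1 : C -> C) (z w : C) (K : R) (m : C) :
  (forall u, on_segment z w u -> cderiv f u (f1 u) /\ Cmod (f1 u - m) <= K) ->
  Cmod (f w - f z - (w - z) * m) <= K * Cmod (w - z).
Proof.
  intros H.
  replace (f w - f z - (w - z) * m)%C
    with ((f w - (0 + (w - z) * m)) - (f z - (0 + (z - z) * m)))%C by ring.
  apply (mean_value_segment (fun u => f u - (0 + (u - z) * m))%C (fun u => f1 u - m)%C).
  intros t Ht. destruct (H (z + t * (w - z))%C) as [H1 H2]; [exists t; auto|].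
  split.
  - apply (cderiv_minus f (fun u => 0 + (u - z) * m)%C); [exact H1 | apply cderiv_line].
  - exact H2.
Qed.

(** Away from z this is the quotient rule.  At z it says that f has a second order
    Taylor expansion, which follows from differentiability of f1 at z and the mean value
    inequality. *)
Lemma diff_quot_holo (o : C) (r : R) (f f1 f2 : C -> C) (z : C) :
  holo o r f f1 -> holo o r f1 f2 -> Cmod (z - o) < r ->
  holo o r (diff_quot f f1 z) (C_derive (diff_quot f f1 z)).
Proof.
  intros Hf Hf1 Hz. apply holo_of_ex. intros w Hw.
  destruct (classic (w = z)) as [->|N].
  - exists (RtoC (/ 2) * f2 z)%C. rewrite cderiv_eps. intros eps Heps.
    destruct (proj1 (cderiv_eps _ _ _) (Hf1 z Hz) eps Heps) as [d [Hd Hd']].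
    exists (Rmin d (r - Cmod (z - o))). split; [apply Rmin_pos; lra|].
    intros u Hu.
    destruct (lt_Rmin _ _ _ Hu) as [H1 H2].
    assert (Huo : Cmod (u - o) < r) by (pose proof (Cmod_sub_triangle u z o); lra).
    destruct (classic (u = z)) as [->|Nu].
    { match goal with |- Cmod ?x <= _ => replace x with (RtoC 0) by ring end.
      rewrite Cmod_0, Cmod_center. lra. }
    rewrite diff_quot_off by exact Nu. rewrite diff_quot_diag.
    pose proof (Cminus_nz _ _ Nu) as Nz. pose proof (proj1 (Cmod_gt_0 _) Nz) as Pz.
    (* subtracting the quadratic term leaves a derivative of size o(|v - z|) *)
    set (g := fun v => (f v - RtoC (/ 2) * f2 z * ((v - z) * (v - z)))%C).
    assert (T : Cmod (g u - g z - (u - z) * f1 z) <= eps * Cmod (u - z) * Cmod (u - z)).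
    { apply (taylor_remainder g (fun v => f1 v - (v - z) * f2 z)%C).
      intros v Hv.
      assert (Hvo : Cmod (v - o) < r) by (apply (ball_segment o z u); assumption).
      assert (Hvz : Cmod (v - z) <= Cmod (u - z)).
      { apply (segment_in_closed_ball z z u v); [|apply Rle_refl | exact Hv].
        rewrite Cmod_center. apply Cmod_ge_0. }
      split.
      - apply (cderiv_eq _ _ (f1 v - RtoC (/ 2) * f2 z * (1 * (v - z) + (v - z) * 1))%C).
        + replace ((v - z) * f2 z)%C with ((RtoC (/ 2) + RtoC (/ 2)) * ((v - z) * f2 z))%C
            by (rewrite half_half; ring). ring.
        + apply (cderiv_minus f (fun v => RtoC (/ 2) * f2 z * ((v - z) * (v - z)))%C);
            [apply Hf, Hvo|].
          apply (cderiv_scal (RtoC (/ 2) * f2 z) (fun v => (v - z) * (v - z))%C).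
          apply (cderiv_mult (fun v => v - z)%C (fun v => v - z)%C); apply cderiv_sub_const.
      - replace (f1 v - (v - z) * f2 z - f1 z)%C
          with (f1 v - f1 z - (v - z) * f2 z)%C by ring.
        eapply Rle_trans; [apply Hd'; lra|]. apply Rmult_le_compat_l; lra. }
    replace ((f u - f z) / (u - z) - f1 z - (u - z) * (RtoC (/ 2) * f2 z))%C
      with ((g u - g z - (u - z) * f1 z) / (u - z))%C.
    + rewrite Cmod_div by exact Nz.
      apply (Rmult_le_reg_r (Cmod (u - z))); [exact Pz|].
      unfold Rdiv. rewrite Rmult_assoc, Rinv_l, Rmult_1_r by lra. exact T.
    + unfold g. field. exact Nz.
  - pose proof (Cminus_nz _ _ N) as Nz. pose proof (proj1 (Cmod_gt_0 _) Nz) as Pz.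
    eexists. apply (cderiv_ext_ball (fun u => (f u - f z) / (u - z))%C _ _ _ (Cmod (w - z)) Pz).
    + intros u Hu. rewrite diff_quot_off; [reflexivity|]. intros ->.
      rewrite (Cmod_sub_sym z w) in Hu. lra.
    + apply (cderiv_div (fun u => f u - f z)%C (fun u => u - z)%C w (f1 w - 0)%C 1);
        [|apply cderiv_sub_const | exact Nz].
      apply (cderiv_minus f (fun _ => f z)); [apply Hf, Hw | apply cderiv_const].
Qed.

Definition circle (o : C) (rho t : R) : C := (o + RtoC rho * expi t)%C.
Definition circle_velocity (rho t : R) : C := (RtoC rho * (Ci * expi t))%C.

Lemma Cmod_expi (t : R) : Cmod (expi t) = 1.
Proof.
  unfold Cmod, expi. simpl. transitivity (sqrt 1); [f_equal | apply sqrt_1].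
  pose proof (sin2_cos2 t). unfold Rsqr in *. lra.
Qed.

Lemma pderiv_expi (t : R) : pderiv expi t (Ci * expi t)%C.
Proof.
  replace (Ci * expi t)%C with (- sin t, cos t).
  - apply (pderiv_pair cos sin); [apply is_derive_cos | apply is_derive_sin].
  - unfold Ci, expi, Cmult. simpl. f_equal; ring.
Qed.

Lemma pderiv_circle (o : C) (rho t : R) : pderiv (circle o rho) t (circle_velocity rho t).
Proof.
  pose proof (pderiv_comp (fun w => o + (w - 0) * RtoC rho)%C expi t (RtoC rho) (Ci * expi t)%C
    (cderiv_line _ _ _ _) (pderiv_expi t)) as H.
  intros eps Heps. destruct (H eps Heps) as [d [Hd Hd']]. exists d. split; [exact Hd|].
    intros s Hs. eapply Rle_trans; [|apply (Hd' s Hs)]. apply Req_le. f_equal.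
  unfold circle, circle_velocity. ring.
Qed.

(** * Cauchy's integral formula *)

Lemma circle_closed (o : C) (rho : R) : circle o rho (2 * PI) = circle o rho 0.
Proof. unfold circle, expi. rewrite cos_2PI, sin_2PI, cos_0, sin_0. reflexivity. Qed.

Lemma circle_dist (o : C) (rho t : R) : 0 <= rho -> Cmod (circle o rho t - o) = rho.
Proof.
  intros H. unfold circle. replace (o + rho * expi t - o)%C with (rho * expi t)%C by ring.
  rewrite Cmod_mult, Cmod_expi, Cmod_RtoC_pos by exact H. ring.
Qed.

Lemma Cmod_circle_velocity (rho t : R) : 0 <= rho -> Cmod (circle_velocity rho t) = rho.
Proof.
  intros H. unfold circle_velocity. rewrite !Cmod_mult, Cmod_expi, Cmod_RtoC_pos, Cmod_Ci by exact H. ring.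
Qed.

Lemma pcont_circle (o : C) (rho t : R) : pcont (circle o rho) t.
Proof. eapply pderiv_pcont, pderiv_circle. Qed.

Lemma pcont_circle_velocity (rho t : R) : pcont (circle_velocity rho) t.
Proof.
  unfold circle_velocity. apply pcont_mult; [apply pcont_const|].
  apply pcont_mult; [apply pcont_const|]. eapply pderiv_pcont, pderiv_expi.
Qed.

Lemma two_PI_pos : 0 <= 2 * PI.
Proof. pose proof PI_RGT_0. lra. Qed.

Lemma pcont_on_bounded (p : R -> C) (a b : R) : a <= b -> pcont_on a b p ->
  exists M, forall t, a <= t <= b -> Cmod (p t) <= M.
Proof.
  intros Hab Hp.
  destruct (continuity_ab_maj (fun t => Cmod (p t)) a b Hab) as [t0 [H _]].
  - intros t Ht. apply continuity_pt_Cmod, Hp, Ht.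
  - exists (Cmod (p t0)). exact H.
Qed.

Lemma circle_integral_holo (o : C) (r rho : R) (q q1 : C -> C) : 0 < rho < r ->
  holo o r q q1 -> Cint (fun t => q (circle o rho t) * circle_velocity rho t)%C 0 (2 * PI) = 0.
Proof.
  intros Hr Hq.
  assert (Hin : forall t, Cmod (circle o rho t - o) < r)
    by (intros t; rewrite circle_dist; lra).
  rewrite (Cint_derive (fun t => seg_int q o (circle o rho t))).
  - rewrite circle_closed. ring.
  - apply two_PI_pos.
  - intros t _. apply pcont_mult; [|apply pcont_circle_velocity].
    apply pcont_ccont; [|apply pcont_circle]. eapply holo_ccont; [exact Hq | apply Hin].
  - intros t _. apply (pderiv_comp (seg_int q o)); [|apply pderiv_circle].
    apply (holo_primitive o r q q1); [lra | exact Hq | apply Hin].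
Qed.

(** Two applications of the mean value inequality. *)
Lemma taylor_quadratic (f f1 f2 : C -> C) (z : C) (d B : R) :
  holo z d f f1 -> holo z d f1 f2 -> (forall u, Cmod (u - z) < d -> Cmod (f2 u) <= B) ->
  forall w, Cmod (w - z) < d ->
    Cmod (f w - f z - (w - z) * f1 z) <= B * Cmod (w - z) * Cmod (w - z).
Proof.
  intros Hf Hf1 HB w Hw.
  assert (Hz : Cmod (z - z) < d).
  { rewrite Cmod_center. eapply Rle_lt_trans; [apply Cmod_ge_0 | exact Hw]. }
  assert (HB0 : 0 <= B) by (eapply Rle_trans; [apply Cmod_ge_0 | apply (HB z Hz)]).
  apply (taylor_remainder f f1). intros u Hu.
  assert (Hud : Cmod (u - z) < d) by (apply (ball_segment z z w); assumption).
  split; [apply Hf, Hud|].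
  eapply Rle_trans; [apply (mean_value_ball z d f1 f2 B Hf1 HB); assumption|].
  apply Rmult_le_compat_l; [exact HB0|].
  apply (segment_in_closed_ball z z w u); [|apply Rle_refl | exact Hu].
  rewrite Cmod_center. apply Cmod_ge_0.
Qed.

Lemma cderiv_kernel (c z : C) (n : nat) : c <> z ->
  cderiv (fun w => (/ (c - w)) ^ S n)%C z (RtoC (INR (S n)) * (/ (c - z)) ^ S (S n))%C.
Proof.
  intros H. pose proof (Cminus_nz _ _ H) as Hz.
  eapply cderiv_eq; [|apply cderiv_pow, (cderiv_inv (fun w => c - w)%C);
    [apply cderiv_const_sub | exact Hz]].
  rewrite !Cpow_S. simpl. field. exact Hz.
Qed.

Lemma Cmod_kernel_bound (c u : C) (k : R) (n : nat) : 0 < k -> k <= Cmod (c - u) ->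
  Cmod ((/ (c - u)) ^ n) <= (/ k) ^ n.
Proof.
  intros Hk H. rewrite Cmod_pow. apply pow_incr. split; [apply Cmod_ge_0|].
  rewrite Cmod_inv by (apply Cmod_gt_0; lra).
  apply Rinv_le_contravar; assumption.
Qed.

(** Cauchy type integrals with density p; p includes the factor coming from the
    parametrization of the circle. *)
Definition cauchy_integral (o : C) (rho : R) (p : R -> C) (n : nat) (w : C) : C :=
  Cint (fun t => p t * (/ (circle o rho t - w)) ^ n)%C 0 (2 * PI).

Lemma off_circle (o w : C) (rho t : R) : 0 < rho -> Cmod (w - o) < rho ->
  rho - Cmod (w - o) <= Cmod (circle o rho t - w).
Proof.
  intros Hr Hw. pose proof (circle_dist o rho t ltac:(lra)) as E.
  pose proof (Cmod_sub_triangle (circle o rho t) w o). lra.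
Qed.

Lemma off_circle_neq (o w : C) (rho t : R) : 0 < rho -> Cmod (w - o) < rho ->
  circle o rho t <> w.
Proof.
  intros Hr Hw E. pose proof (off_circle o w rho t Hr Hw) as H. rewrite E, Cmod_center in H. lra.
Qed.

Lemma kernel_pcont (o w : C) (rho : R) (p : R -> C) (n : nat) : 0 < rho -> Cmod (w - o) < rho ->
  pcont_on 0 (2 * PI) p ->
  pcont_on 0 (2 * PI) (fun t => p t * (/ (circle o rho t - w)) ^ n)%C.
Proof.
  intros Hr Hw Hp t Ht. apply pcont_mult; [apply Hp, Ht|].
  apply (pcont_ccont (fun c => (/ (c - w)) ^ n)%C); [|apply pcont_circle].
  pose proof (Cminus_nz _ _ (off_circle_neq o w rho t Hr Hw)) as Hz.
  destruct n as [|n].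
  - apply cderiv_ccont with (RtoC 0). exact (cderiv_const 1 _).
  - eapply cderiv_ccont, cderiv_pow, (cderiv_inv (fun c => c - w)%C);
      [apply cderiv_sub_const | exact Hz].
Qed.

(** Differentiation under the integral sign: the kernels have a quadratic Taylor
    bound which is uniform on the circle, and it can be integrated. *)
Lemma cderiv_cauchy_integral (o w : C) (rho : R) (p : R -> C) (n : nat) : 0 < rho ->
  pcont_on 0 (2 * PI) p -> Cmod (w - o) < rho ->
  cderiv (cauchy_integral o rho p (S n)) w
    (RtoC (INR (S n)) * cauchy_integral o rho p (S (S n)) w)%C.
Proof.
  intros Hr Hp Hw.
  destruct (pcont_on_bounded p 0 (2 * PI) two_PI_pos Hp) as [M HM].
  pose proof two_PI_pos as HPI.
  assert (HM0 : 0 <= M).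
  { eapply Rle_trans; [apply Cmod_ge_0 | apply (HM 0)]. lra. }
  set (d := (rho - Cmod (w - o)) / 2). assert (Hd : 0 < d) by (unfold d; lra).
  set (B := INR (S n) * INR (S (S n)) * (/ d) ^ S (S (S n))).
  assert (HB : 0 <= B).
  { unfold B. apply Rmult_le_pos; [apply Rmult_le_pos; apply pos_INR|].
    apply pow_le. left. apply Rinv_0_lt_compat, Hd. }
  assert (Hball : forall u t, Cmod (u - w) < d -> d <= Cmod (circle o rho t - u)).
  { intros u t Hu. pose proof (off_circle o w rho t Hr Hw).
    pose proof (Cmod_sub_triangle (circle o rho t) u w). unfold d in *. lra. }
  assert (Hne : forall u t, Cmod (u - w) < d -> circle o rho t <> u).
  { intros u t Hu E. pose proof (Hball u t Hu) as H. rewrite E, Cmod_center in H. lra. }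
  assert (T : forall t u, Cmod (u - w) < d ->
    Cmod ((/ (circle o rho t - u)) ^ S n - (/ (circle o rho t - w)) ^ S n
      - (u - w) * (RtoC (INR (S n)) * (/ (circle o rho t - w)) ^ S (S n)))
    <= B * Cmod (u - w) * Cmod (u - w)).
  { intros t u Hu.
    apply (taylor_quadratic (fun v => (/ (circle o rho t - v)) ^ S n)%C
      (fun v => RtoC (INR (S n)) * (/ (circle o rho t - v)) ^ S (S n))%C
      (fun v => RtoC (INR (S n)) * (RtoC (INR (S (S n))) * (/ (circle o rho t - v)) ^ S (S (S n))))%C
      w d B); [| | |exact Hu].
    - intros v Hv. apply cderiv_kernel, Hne, Hv.
    - intros v Hv. apply cderiv_scal, cderiv_kernel, Hne, Hv.
    - intros v Hv. rewrite !Cmod_mult, !Cmod_RtoC_pos by apply pos_INR.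
      unfold B. rewrite Rmult_assoc.
      apply Rmult_le_compat_l; [apply pos_INR|]. apply Rmult_le_compat_l; [apply pos_INR|].
      apply Cmod_kernel_bound; [exact Hd | apply Hball, Hv]. }
  rewrite cderiv_eps. intros eps Heps.
  set (L := 2 * (M * B * (2 * PI))).
  assert (HL : 0 <= L).
  { unfold L. apply Rmult_le_pos; [lra|]. apply Rmult_le_pos; [|exact HPI].
    apply Rmult_le_pos; assumption. }
  exists (Rmin d (eps / (L + 1))). split.
  { apply Rmin_pos; [exact Hd|]. apply Rdiv_lt_0_compat; lra. }
  intros u Hu.
  destruct (lt_Rmin _ _ _ Hu) as [H1 H2].
  assert (Huo : Cmod (u - o) < rho).
  { pose proof (Cmod_sub_triangle u w o). unfold d in H1. lra. }
  set (k := fun t => ((/ (circle o rho t - u)) ^ S n - (/ (circle o rho t - w)) ^ S n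
      - (u - w) * (RtoC (INR (S n)) * (/ (circle o rho t - w)) ^ S (S n)))%C).
  assert (E : (cauchy_integral o rho p (S n) u - cauchy_integral o rho p (S n) w
    - (u - w) * (RtoC (INR (S n)) * cauchy_integral o rho p (S (S n)) w))%C
    = Cint (fun t => p t * k t)%C 0 (2 * PI)).
  { pose proof (kernel_pcont o u rho p (S n) Hr Huo Hp) as C1.
    pose proof (kernel_pcont o w rho p (S n) Hr Hw Hp) as C2.
    pose proof (kernel_pcont o w rho p (S (S n)) Hr Hw Hp) as C3.
    set (c2 := RtoC (-1)). set (c3 := (- (u - w) * RtoC (INR (S n)))%C).
    rewrite (Cint_ext _ (fun t => p t * (/ (circle o rho t - u)) ^ S n +
      (c2 * (p t * (/ (circle o rho t - w)) ^ S n) +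
       c3 * (p t * (/ (circle o rho t - w)) ^ S (S n))))%C 0 (2 * PI) HPI).
    2: { intros t _. unfold k, c2, c3. ring. }
    assert (D2 : pcont_on 0 (2 * PI) (fun t => c2 * (p t * (/ (circle o rho t - w)) ^ S n))%C)
      by (intros t Ht; apply pcont_mult; [apply pcont_const | apply C2, Ht]).
    assert (D3 : pcont_on 0 (2 * PI) (fun t => c3 * (p t * (/ (circle o rho t - w)) ^ S (S n)))%C)
      by (intros t Ht; apply pcont_mult; [apply pcont_const | apply C3, Ht]).
    rewrite (Cint_plus _ (fun t => c2 * (p t * (/ (circle o rho t - w)) ^ S n) +
       c3 * (p t * (/ (circle o rho t - w)) ^ S (S n)))%C 0 (2 * PI) HPI C1)
      by (intros t Ht; apply pcont_plus; [apply D2, Ht | apply D3, Ht]).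
    rewrite (Cint_plus _ _ 0 (2 * PI) HPI D2 D3).
    rewrite (Cint_scal c2 _ 0 (2 * PI) HPI C2), (Cint_scal c3 _ 0 (2 * PI) HPI C3).
    unfold cauchy_integral, c2, c3. ring. }
  rewrite E.
  assert (Bd : Cmod (Cint (fun t => p t * k t)%C 0 (2 * PI))
     <= 2 * (M * (B * Cmod (u - w) * Cmod (u - w)) * (2 * PI - 0))).
  { apply Cint_bound; [exact HPI | |].
    - intros t Ht. unfold k.
      apply (pcont_ccont (fun c => c) _ t); [intros e He; exists e; split; auto|].
      pose proof (kernel_pcont o u rho p (S n) Hr Huo Hp t Ht) as C1.
      pose proof (kernel_pcont o w rho p (S n) Hr Hw Hp t Ht) as C2.
      pose proof (kernel_pcont o w rho p (S (S n)) Hr Hw Hp t Ht) as C3.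
      pose proof (pcont_plus _ _ _ C1 (pcont_plus _ _ _
        (pcont_mult _ _ _ (pcont_const (-1) t) C2)
        (pcont_mult _ _ _ (pcont_const (- (u - w) * RtoC (INR (S n)))%C t) C3))) as C4.
      intros e He. destruct (C4 e He) as [dd [Hdd HH]]. exists dd. split; [exact Hdd|].
      intros s Hs. eapply Rle_lt_trans; [|apply (HH s Hs)]. apply Req_le. f_equal. ring.
    - intros t Ht. rewrite Cmod_mult. apply Rmult_le_compat; try apply Cmod_ge_0.
      + apply HM, Ht.
      + exact (T t u H1). }
  eapply Rle_trans; [exact Bd|].
  replace (2 * (M * (B * Cmod (u - w) * Cmod (u - w)) * (2 * PI - 0)))
    with (L * Cmod (u - w) * Cmod (u - w)) by (unfold L; ring).
  apply Rmult_le_compat_r; [apply Cmod_ge_0|].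
  apply (Rmult_lt_compat_r (L + 1)) in H2; [|lra].
  replace (eps / (L + 1) * (L + 1)) with eps in H2 by (field; lra).
  pose proof (Cmod_ge_0 (u - w)). nra.
Qed.

(** The derivative of the winding integral is the integral of an exact differential, so it
    vanishes, and at the centre the integrand is the constant i. *)
Lemma winding_const (o w : C) (rho : R) : 0 < rho -> Cmod (w - o) < rho ->
  cauchy_integral o rho (circle_velocity rho) 1 w = (RtoC (2 * PI) * Ci)%C.
Proof.
  intros Hr Hw. pose proof two_PI_pos as HPI.
  assert (Hp : pcont_on 0 (2 * PI) (circle_velocity rho)) by (intros t _; apply pcont_circle_velocity).
  assert (Z : forall u, Cmod (u - o) < rho -> cauchy_integral o rho (circle_velocity rho) 2 u = 0).
  { intros u Hu. unfold cauchy_integral.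
    rewrite (Cint_derive (fun t => -1 * / (circle o rho t - u))%C).
    - rewrite circle_closed. ring.
    - exact HPI.
    - apply kernel_pcont; assumption.
    - intros t _. rewrite Cmult_comm.
      pose proof (Cminus_nz _ _ (off_circle_neq o u rho t Hr Hu)) as Hz.
      apply (pderiv_comp (fun c => -1 * / (c - u))%C); [|apply pderiv_circle].
      eapply cderiv_eq; [|apply (cderiv_scal (-1)%C (fun c => / (c - u))%C),
        (cderiv_inv (fun c => c - u)%C); [apply cderiv_sub_const | exact Hz]].
      rewrite !Cpow_S. simpl. field. exact Hz. }
  assert (D : holo o rho (cauchy_integral o rho (circle_velocity rho) 1) (fun _ => RtoC 0)).
  { intros u Hu. eapply cderiv_eq; [|apply (cderiv_cauchy_integral o u rho _ 0 Hr Hp Hu)].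
    rewrite Z by exact Hu. ring. }
  assert (Ho : Cmod (o - o) < rho) by (rewrite Cmod_center; exact Hr).
  assert (E : cauchy_integral o rho (circle_velocity rho) 1 w = cauchy_integral o rho (circle_velocity rho) 1 o).
  { pose proof (mean_value_ball o rho _ _ 0 D) as MV.
    specialize (MV (fun z _ => Req_le _ _ Cmod_0) w o Hw Ho).
    rewrite Rmult_0_l in MV.
    assert (X : (cauchy_integral o rho (circle_velocity rho) 1 w
       - cauchy_integral o rho (circle_velocity rho) 1 o)%C = 0).
    { apply Cmod_eq_0. apply Rle_antisym; [exact MV | apply Cmod_ge_0]. }
    replace (cauchy_integral o rho (circle_velocity rho) 1 w) with ((cauchy_integral o rho (circle_velocity rho) 1 w
       - cauchy_integral o rho (circle_velocity rho) 1 o) + cauchy_integral o rho (circle_velocity rho) 1 o)%C by ring.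
    rewrite X. ring. }
  rewrite E. unfold cauchy_integral.
  rewrite (Cint_derive (fun t => 0 + RtoC t * Ci)%C).
  - ring.
  - exact HPI.
  - apply kernel_pcont; assumption.
  - intros t _.
    replace (circle_velocity rho t * (/ (circle o rho t - o)) ^ 1)%C with Ci; [apply pderiv_line|].
    unfold circle_velocity, circle. rewrite Cpow_1_r.
    replace (o + rho * expi t - o)%C with (rho * expi t)%C by ring.
    field. split.
    + intros Z'. pose proof (Cmod_expi t) as X. rewrite Z', Cmod_0 in X. lra.
    + intros Z'. apply RtoC_inj in Z'. lra.
Qed.

Lemma two_PI_i_neq0 : (RtoC (2 * PI) * Ci)%C <> 0.
Proof.
  apply Cmult_neq_0.
  - intros H. apply RtoC_inj in H. pose proof PI_RGT_0. lra.
  - intros H. injection H. lra.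
Qed.

(** The difference quotient of f at w is holomorphic, so its integral over the circle
    vanishes; what remains is f w times the winding integral. *)
Lemma cauchy_formula (o w : C) (r rho : R) (f f1 f2 : C -> C) : 0 < rho < r ->
  holo o r f f1 -> holo o r f1 f2 -> Cmod (w - o) < rho ->
  (RtoC (2 * PI) * Ci * f w)%C
    = cauchy_integral o rho (fun t => f (circle o rho t) * circle_velocity rho t)%C 1 w.
Proof.
  intros Hr Hf Hf1 Hw. pose proof two_PI_pos as HPI.
  assert (Hwr : Cmod (w - o) < r) by lra.
  pose proof (circle_integral_holo o r rho _ _ Hr (diff_quot_holo o r f f1 f2 w Hf Hf1 Hwr)) as Z.
  assert (Hp : pcont_on 0 (2 * PI) (circle_velocity rho)) by (intros t _; apply pcont_circle_velocity).
  rewrite <- (winding_const o w rho (proj1 Hr) Hw).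
  unfold cauchy_integral.
  rewrite (Cint_ext (fun t => f (circle o rho t) * circle_velocity rho t * (/ (circle o rho t - w)) ^ 1)%C
    (fun t => diff_quot f f1 w (circle o rho t) * circle_velocity rho t +
       f w * (circle_velocity rho t * (/ (circle o rho t - w)) ^ 1))%C 0 (2 * PI) HPI).
  2: { intros t _. rewrite (diff_quot_mul f f1 w (circle o rho t)) at 1. rewrite Cpow_1_r.
       pose proof (Cminus_nz _ _ (off_circle_neq o w rho t (proj1 Hr) Hw)) as Hz.
       field. exact Hz. }
  pose proof (kernel_pcont o w rho _ 1 (proj1 Hr) Hw Hp) as Ck.
  rewrite Cint_plus, Z, Cint_scal; [ring | exact HPI | exact Ck | exact HPI | |].
  - intros t _. apply pcont_mult; [|apply pcont_circle_velocity].
    apply pcont_ccont; [|apply pcont_circle].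
    eapply holo_ccont; [apply (diff_quot_holo o r f f1 f2 w Hf Hf1 Hwr)|].
    rewrite circle_dist; lra.
  - intros t Ht. apply pcont_mult; [apply pcont_const | apply Ck, Ht].
Qed.

(** * Derivatives, Cauchy estimates and orders of zeros *)

Lemma circle_trace_pcont (o : C) (r rho : R) (f f1 : C -> C) : 0 < rho < r -> holo o r f f1 ->
  pcont_on 0 (2 * PI) (fun t => f (circle o rho t) * circle_velocity rho t)%C.
Proof.
  intros Hr Hf t _. apply pcont_mult; [|apply pcont_circle_velocity].
  apply pcont_ccont; [|apply pcont_circle].
  eapply holo_ccont; [exact Hf|]. rewrite circle_dist; lra.
Qed.

(** The formula cannot be applied to f directly, because it presupposes that the
    derivative is again holomorphic.  It does apply to a primitive F of f, whose derivative f is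
    holomorphic; thus F is a Cauchy integral, f and f1 are its first two derivatives, and the third
    one exists as well. *)
Theorem holo_derivative (o : C) (r : R) (f f1 : C -> C) :
  holo o r f f1 -> holo o r f1 (C_derive f1).
Proof.
  intros Hf. apply holo_of_ex. intros z Hz.
  set (rho := (Cmod (z - o) + r) / 2). pose proof (Cmod_ge_0 (z - o)) as Hz0.
  assert (Hr : 0 < rho < r) by (unfold rho; lra).
  assert (Hzr : Cmod (z - o) < rho) by (unfold rho; lra).
  set (F := seg_int f o).
  assert (HF : holo o r F f) by (apply (holo_primitive o r f f1); [lra | exact Hf]).
  set (p := fun t => (F (circle o rho t) * circle_velocity rho t)%C).
  assert (Hp : pcont_on 0 (2 * PI) p) by (apply (circle_trace_pcont o r rho F f); assumption).
  set (c := (RtoC (2 * PI) * Ci)%C). assert (Hc : c <> 0) by apply two_PI_i_neq0.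
  assert (E0 : forall w, Cmod (w - o) < rho -> (c * F w)%C = cauchy_integral o rho p 1 w)
    by (intros w Hw; apply (cauchy_formula o w r rho F f f1); assumption).
  assert (Hsub : forall w, Cmod (w - o) < rho ->
    forall u, Cmod (u - w) < rho - Cmod (w - o) -> Cmod (u - o) < rho).
  { intros w Hw u Hu. pose proof (Cmod_sub_triangle u w o). lra. }
  assert (E1 : forall w, Cmod (w - o) < rho -> (c * f w)%C = cauchy_integral o rho p 2 w).
  { intros w Hw.
    apply (cderiv_unique (cauchy_integral o rho p 1) w).
    - apply (cderiv_ext_ball (fun u => c * F u)%C _ _ _ (rho - Cmod (w - o))); [lra | |].
      + intros u Hu. apply E0, (Hsub w Hw u Hu).
      + apply cderiv_scal, HF. lra.
    - eapply cderiv_eq; [|apply (cderiv_cauchy_integral o w rho p 0); try assumption; lra].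
      simpl. ring. }
  assert (E2 : forall w, Cmod (w - o) < rho ->
    (c * f1 w)%C = (RtoC (INR 2) * cauchy_integral o rho p 3 w)%C).
  { intros w Hw.
    apply (cderiv_unique (cauchy_integral o rho p 2) w).
    - apply (cderiv_ext_ball (fun u => c * f u)%C _ _ _ (rho - Cmod (w - o))); [lra | |].
      + intros u Hu. apply E1, (Hsub w Hw u Hu).
      + apply cderiv_scal, Hf. lra.
    - apply (cderiv_cauchy_integral o w rho p 1); try assumption; lra. }
  eexists.
  apply (cderiv_ext_ball (fun u => / c * (RtoC (INR 2) * cauchy_integral o rho p 3 u))%C
    _ _ _ (rho - Cmod (z - o))); [lra | |].
  - intros u Hu. rewrite <- (E2 u (Hsub z Hzr u Hu)). field. exact Hc.
  - apply cderiv_scal, cderiv_scal, (cderiv_cauchy_integral o z rho p 2); try assumption; lra.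
Qed.

(** A weak maximum principle: up to a factor depending on the distance to the circle, f is
    bounded inside by its values on the circle. *)
Lemma cauchy_bound (o w : C) (r rho M : R) (f f1 : C -> C) : 0 < rho < r -> holo o r f f1 ->
  (forall t, 0 <= t <= 2 * PI -> Cmod (f (circle o rho t)) <= M) -> Cmod (w - o) < rho ->
  Cmod (f w) <= 2 * M * rho / (rho - Cmod (w - o)).
Proof.
  intros Hr Hf HM Hw. pose proof (holo_derivative o r f f1 Hf) as Hf1.
  pose proof (cauchy_formula o w r rho f f1 _ Hr Hf Hf1 Hw) as E.
  pose proof PI_RGT_0 as HPI. pose proof two_PI_pos as HPI2.
  set (k := rho - Cmod (w - o)). assert (Hk : 0 < k) by (unfold k; lra).
  assert (HM0 : 0 <= M) by (eapply Rle_trans; [apply Cmod_ge_0 | apply (HM 0); lra]).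
  assert (B : Cmod (cauchy_integral o rho (fun t => f (circle o rho t) * circle_velocity rho t)%C 1 w)
     <= 2 * (M * rho * (/ k) ^ 1 * (2 * PI - 0))).
  { unfold cauchy_integral. apply Cint_bound; [exact HPI2 | |].
    - apply kernel_pcont; [lra | exact Hw|]. apply (circle_trace_pcont o r rho f f1); assumption.
    - intros t Ht. rewrite !Cmod_mult, Cmod_circle_velocity by lra.
      apply Rmult_le_compat; try apply Cmod_ge_0.
      + apply Rmult_le_pos; [apply Cmod_ge_0 | lra].
      + apply Rmult_le_compat_r; [lra | apply HM, Ht].
      + apply Cmod_kernel_bound; [exact Hk | apply off_circle; lra]. }
  rewrite <- E, !Cmod_mult, Cmod_Ci, Cmod_RtoC_pos in B by lra.
  apply (Rmult_le_reg_l (2 * PI)); [lra|].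
  replace (2 * PI * (2 * M * rho / k)) with (2 * (M * rho * (/ k) ^ 1 * (2 * PI - 0)))
    by (simpl; field; lra).
  lra.
Qed.

(** Differentiating the formula on the circle of radius r / 2. *)
Theorem cauchy_estimate (o : C) (r M : R) (f f1 : C -> C) : 0 < r -> holo o r f f1 ->
  (forall z, Cmod (z - o) < r -> Cmod (f z) <= M) -> Cmod (f1 o) <= 4 * M / r.
Proof.
  intros Hr Hf HM. pose proof (holo_derivative o r f f1 Hf) as Hf1.
  pose proof PI_RGT_0 as HPI. pose proof two_PI_pos as HPI2.
  set (rho := r / 2). assert (Hrho : 0 < rho < r) by (unfold rho; lra).
  assert (Ho : Cmod (o - o) < rho) by (rewrite Cmod_center; lra).
  set (p := fun t => (f (circle o rho t) * circle_velocity rho t)%C).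
  assert (Hp : pcont_on 0 (2 * PI) p) by (apply (circle_trace_pcont o r rho f f1); assumption).
  set (c := (RtoC (2 * PI) * Ci)%C).
  assert (E : (c * f1 o)%C = cauchy_integral o rho p 2 o).
  { apply (cderiv_unique (cauchy_integral o rho p 1) o).
    - apply (cderiv_ext_ball (fun u => c * f u)%C _ _ _ rho); [lra | |].
      + intros u Hu. apply (cauchy_formula o u r rho f f1 _ Hrho Hf Hf1 Hu).
      + apply cderiv_scal, Hf. rewrite Cmod_center. exact Hr.
    - eapply cderiv_eq; [|apply (cderiv_cauchy_integral o o rho p 0); try assumption; lra].
      simpl. ring. }
  assert (B : Cmod (cauchy_integral o rho p 2 o) <= 2 * (M * rho * (/ rho) ^ 2 * (2 * PI - 0))).
  { unfold cauchy_integral. apply Cint_bound; [exact HPI2 | |].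
    - apply kernel_pcont; [lra | exact Ho | exact Hp].
    - intros t _. unfold p. rewrite !Cmod_mult, Cmod_circle_velocity by lra.
      assert (Hc : Cmod (circle o rho t - o) = rho) by (apply circle_dist; lra).
      apply Rmult_le_compat; try apply Cmod_ge_0.
      + apply Rmult_le_pos; [apply Cmod_ge_0 | lra].
      + apply Rmult_le_compat_r; [lra | apply HM; lra].
      + apply Cmod_kernel_bound; lra. }
  rewrite <- E in B. unfold c in B. rewrite !Cmod_mult, Cmod_Ci, Cmod_RtoC_pos in B by lra.
  apply (Rmult_le_reg_l (2 * PI)); [lra|].
  replace (2 * PI * (4 * M / r)) with (2 * (M * rho * (/ rho) ^ 2 * (2 * PI - 0)))
    by (unfold rho; simpl; field; lra).
  lra.
Qed.

Lemma cauchy_estimate_inside (o z : C) (r s M : R) (f f1 : C -> C) : 0 < s ->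
  holo o r f f1 -> (forall u, Cmod (u - o) < r -> Cmod (f u) <= M) ->
  Cmod (z - o) <= r - s -> Cmod (f1 z) <= 4 * M / s.
Proof.
  intros Hs Hf HM Hz.
  assert (Hsub : forall u, Cmod (u - z) < s -> Cmod (u - o) < r)
    by (intros u Hu; pose proof (Cmod_sub_triangle u z o); lra).
  apply (cauchy_estimate z s M f f1 Hs).
  - intros u Hu. apply Hf, Hsub, Hu.
  - intros u Hu. apply HM, Hsub, Hu.
Qed.

(** f divided by z^n, as long as the quotients of lower order vanish at the origin. *)
Fixpoint zero_quotient (f : C -> C) (n : nat) : C -> C :=
  match n with
  | O => f
  | S m => diff_quot (zero_quotient f m) (C_derive (zero_quotient f m)) 0
  end.

Lemma zero_quotient_holo (r : R) (f f1 : C -> C) (n : nat) : 0 < r -> holo 0 r f f1 ->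
  holo 0 r (zero_quotient f n) (C_derive (zero_quotient f n)).
Proof.
  intros Hr Hf.
  assert (H0 : holo 0 r f (C_derive f)).
  { apply holo_of_ex. intros z Hz. exists (f1 z). apply Hf, Hz. }
  induction n as [|n IH]; [exact H0|].
  apply (diff_quot_holo 0 r _ _ _ 0 IH (holo_derivative _ _ _ _ IH)).
  rewrite Cmod_center. exact Hr.
Qed.

Lemma zero_quotient_factor (f : C -> C) (n : nat) (z : C) :
  (forall k, (k < n)%nat -> zero_quotient f k 0 = 0) ->
  f z = (z ^ n * zero_quotient f n z)%C.
Proof.
  induction n as [|n IH]; intros H.
  - simpl. ring.
  - rewrite IH by (intros k Hk; apply H; lia).
    rewrite (diff_quot_mul (zero_quotient f n) (C_derive (zero_quotient f n)) 0 z).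
    rewrite H by lia. rewrite Cpow_S. simpl. ring.
Qed.

(** If every quotient vanishes at the origin, then f = z^n k_n with k_n holomorphic and, on
    a circle of radius rho, of size M / rho^n.  Hence |f| <= 4 M 2^(-n) for |z| < rho / 2 and
    every n. *)
Theorem finite_order (r : R) (f f1 : C -> C) : 0 < r -> holo 0 r f f1 ->
  (forall z, Cmod z < r / 4 -> f z = 0) \/
  exists n, zero_quotient f n 0 <> 0 /\ forall k, (k < n)%nat -> zero_quotient f k 0 = 0.
Proof.
  intros Hr Hf.
  destruct (classic (exists n, zero_quotient f n 0 <> 0)) as [H|H].
  { right. destruct H as [n Hn]. revert Hn.
    induction n as [n IH] using (well_founded_induction Wf_nat.lt_wf). intros Hn.
    destruct (classic (exists k, (k < n)%nat /\ zero_quotient f k 0 <> 0)) as [[k [Hk Hk']]|N].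
    - apply (IH k Hk Hk').
    - exists n. split; [exact Hn|]. intros k Hk. apply NNPP. intros H. apply N. exists k. auto. }
  left.
  assert (Z : forall n, zero_quotient f n 0 = 0).
  { intros n. apply NNPP. intros Hn. apply H. exists n. exact Hn. }
  set (rho := r / 2). assert (Hrho : 0 < rho < r) by (unfold rho; lra).
  destruct (pcont_on_bounded (fun t => f (circle 0 rho t)) 0 (2 * PI) two_PI_pos) as [M HM].
  { intros t _. apply pcont_ccont; [|apply pcont_circle].
    eapply holo_ccont; [exact Hf|]. rewrite circle_dist; lra. }
  assert (HM0 : 0 <= M)
    by (eapply Rle_trans; [apply Cmod_ge_0 | apply (HM 0); pose proof two_PI_pos; lra]).
  intros z Hz.
  assert (Hz0 : Cmod (z - 0) < rho / 2)
    by (replace (z - 0)%C with z by ring; unfold rho; lra).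
  assert (B : forall n, Cmod (f z) <= 4 * M / 2 ^ n).
  { intros n.
    rewrite (zero_quotient_factor f n z) by (intros; apply Z).
    pose proof (zero_quotient_holo r f f1 n Hr Hf) as Hq.
    assert (Hn : 0 < rho ^ n) by (apply pow_lt; lra).
    assert (Q : Cmod (zero_quotient f n z) <= 4 * (M / rho ^ n)).
    { eapply Rle_trans;
        [apply (cauchy_bound 0 z r rho (M / rho ^ n) _ _ Hrho Hq); [|lra]|].
      - intros t Ht. pose proof (HM t Ht) as B. cbv beta in B.
        rewrite (zero_quotient_factor f n) in B by (intros; apply Z).
        rewrite Cmod_mult, Cmod_pow in B.
        replace (circle 0 rho t) with (circle 0 rho t - 0)%C in B at 1 by ring.
        rewrite circle_dist in B by lra.
        apply (Rmult_le_reg_l (rho ^ n)); [exact Hn|].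
        replace (rho ^ n * (M / rho ^ n)) with M by (field; lra). exact B.
      - assert (0 <= M / rho ^ n) by (apply Rdiv_le_0_compat; lra).
        apply (Rmult_le_reg_r (rho - Cmod (z - 0))); [lra|].
        unfold Rdiv at 1. rewrite Rmult_assoc, Rinv_l by lra. nra. }
    rewrite Cmod_mult, Cmod_pow.
    assert (Cmod z ^ n <= (rho / 2) ^ n).
    { apply pow_incr. split; [apply Cmod_ge_0|].
      replace (z - 0)%C with z in Hz0 by ring. lra. }
    replace (4 * M / 2 ^ n) with ((rho / 2) ^ n * (4 * (M / rho ^ n))).
    - apply Rmult_le_compat; try apply Cmod_ge_0; try assumption.
      apply pow_le, Cmod_ge_0.
    - unfold Rdiv. rewrite Rpow_mult_distr, pow_inv. field.
      split; apply pow_nonzero; lra. }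
  apply Cmod_eq_0, Rle_antisym; [|apply Cmod_ge_0].
  apply (Rle_eps_mult _ 1); [lra|]. intros eps Heps.
  destruct (exists_pow2_small (4 * M) eps) as [n Hn]; [lra | exact Heps|].
  pose proof (B n). lra.
Qed.

(** * The exponential and maps close to it *)

Definition cexp (z : C) : C := (RtoC (exp (fst z)) * expi (snd z))%C.

Lemma expi_plus (a b : R) : expi (a + b) = (expi a * expi b)%C.
Proof.
  unfold expi, Cmult. simpl. rewrite cos_plus, sin_plus. f_equal; ring.
Qed.

Lemma cexp_plus (z w : C) : cexp (z + w) = (cexp z * cexp w)%C.
Proof.
  unfold cexp. simpl fst. simpl snd. rewrite exp_plus, RtoC_mult, expi_plus. ring.
Qed.

Lemma cexp_0 : cexp 0 = 1.
Proof.
  unfold cexp, expi. simpl. rewrite exp_0, cos_0, sin_0.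
  apply injective_projections; simpl; ring.
Qed.

Lemma Cmod_cexp (z : C) : Cmod (cexp z) = exp (fst z).
Proof.
  unfold cexp. rewrite Cmod_mult, Cmod_expi, Cmod_RtoC_pos by (left; apply exp_pos). ring.
Qed.

Lemma cderiv_cexp_0 : cderiv cexp 0 1.
Proof.
  rewrite cderiv_eps. intros eps Heps.
  set (e := Rmin (eps / 8) (1 / 4)).
  assert (He : 0 < e) by (unfold e; apply Rmin_pos; lra).
  assert (He1 : e <= eps / 8) by apply Rmin_l. assert (He2 : e <= 1 / 4) by apply Rmin_r. clearbody e.
  assert (D1 : is_derive exp 0 1) by (pose proof (is_derive_exp 0) as X; rewrite exp_0 in X; exact X).
  assert (D2 : is_derive cos 0 0).
  { pose proof (is_derive_cos 0) as X. rewrite sin_0, Ropp_0 in X. exact X. }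
  assert (D3 : is_derive sin 0 1) by (pose proof (is_derive_sin 0) as X; rewrite cos_0 in X; exact X).
  destruct (proj2 (is_derive_eps _ _ _) D1 e He) as [d1 [Hd1 B1]].
  destruct (proj2 (is_derive_eps _ _ _) D2 e He) as [d2 [Hd2 B2]].
  destruct (proj2 (is_derive_eps _ _ _) D3 e He) as [d3 [Hd3 B3]].
  set (d := Rmin (Rmin d1 d2) (Rmin d3 e)).
  assert (Hd : 0 < d) by (unfold d; repeat apply Rmin_pos; assumption).
  assert (Ld : d <= d1 /\ d <= d2 /\ d <= d3 /\ d <= e).
  { unfold d. repeat split.
    - eapply Rle_trans; [apply Rmin_l | apply Rmin_l].
    - eapply Rle_trans; [apply Rmin_l | apply Rmin_r].
    - eapply Rle_trans; [apply Rmin_r | apply Rmin_l].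
    - eapply Rle_trans; [apply Rmin_r | apply Rmin_r]. }
  exists d. split; [exact Hd|]. intros w Hw.
  rewrite cexp_0. replace (w - 0)%C with w in * by ring.
  pose proof (fst_le_Cmod w) as Hx. pose proof (im_le_Cmod w) as Hy.
  set (m := Cmod w) in *. destruct w as [x y]. simpl in Hx, Hy.
  specialize (B1 x). specialize (B2 y). specialize (B3 y).
  rewrite Rminus_0_r, exp_0 in B1. rewrite Rminus_0_r, cos_0 in B2. rewrite Rminus_0_r, sin_0 in B3.
  specialize (B1 ltac:(lra)). specialize (B2 ltac:(lra)). specialize (B3 ltac:(lra)).
  assert (B2' : Rabs (cos y - 1) <= e * m).
  { replace (cos y - 1) with (cos y - 1 - y * 0) by ring. nra. }
  assert (B3' : Rabs (sin y - y) <= e * m).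
  { replace (sin y - y) with (sin y - 0 - y * 1) by ring. nra. }
  assert (B1' : Rabs (exp x - 1 - x) <= e * m).
  { replace (exp x - 1 - x) with (exp x - 1 - x * 1) by ring. nra. }
  assert (Hm : 0 <= m) by apply Cmod_ge_0.
  assert (X : Rabs (exp x - 1) <= 2 * m).
  { replace (exp x - 1) with ((exp x - 1 - x) + x) by ring.
    eapply Rle_trans; [apply Rabs_triang|]. nra. }
  assert (X2 : Rabs (exp x) <= 2).
  { replace (exp x) with ((exp x - 1) + 1) by ring.
    eapply Rle_trans; [apply Rabs_triang|]. rewrite Rabs_R1. lra. }
  eapply Rle_trans; [apply Cmod_le_add|]. unfold cexp, expi. simpl.
  replace (exp x * cos y - 0 * sin y + - (1) + - (x * 1 - y * 0))
    with (exp x * (cos y - 1) + (exp x - 1 - x)) by ring.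
  replace (exp x * sin y + 0 * cos y + - 0 + - (x * 0 + y * 1))
    with (exp x * (sin y - y) + (exp x - 1) * y) by ring.
  assert (P1 : Rabs (exp x * (cos y - 1)) <= 2 * (e * m))
    by (rewrite Rabs_mult; apply Rmult_le_compat; try apply Rabs_pos; assumption).
  assert (P2 : Rabs (exp x * (sin y - y)) <= 2 * (e * m))
    by (rewrite Rabs_mult; apply Rmult_le_compat; try apply Rabs_pos; assumption).
  assert (P3 : Rabs ((exp x - 1) * y) <= 2 * m * m)
    by (rewrite Rabs_mult; apply Rmult_le_compat; try apply Rabs_pos; assumption).
  pose proof (Rabs_triang (exp x * (cos y - 1)) (exp x - 1 - x)).
  pose proof (Rabs_triang (exp x * (sin y - y)) ((exp x - 1) * y)).
  assert (2 * m * m <= 2 * e * m) by nra.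
  assert (e * m <= eps / 8 * m) by (apply Rmult_le_compat_r; assumption).
  nra.
Qed.

Lemma cderiv_cexp (z : C) : cderiv cexp z (cexp z).
Proof.
  apply (cderiv_ext (fun w => cexp z * cexp (- z + 1 * w))%C).
  { intros w. rewrite <- cexp_plus. f_equal. ring. }
  apply (cderiv_eq _ _ (cexp z * (1 * 1))%C); [ring|].
  apply cderiv_scal. apply cderiv_affine.
  replace (- z + 1 * z)%C with (RtoC 0) by ring. apply cderiv_cexp_0.
Qed.

Lemma cexp_2PIi : cexp (RtoC (2 * PI) * Ci) = 1.
Proof.
  unfold cexp, expi. simpl.
  replace (2 * PI * 0 - 0 * 1) with 0 by ring. replace (2 * PI * 1 + 0 * 0) with (2 * PI) by ring.
  rewrite exp_0, cos_2PI, sin_2PI. apply injective_projections; simpl; ring.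
Qed.

(** Solve Phi z = b by the contraction z -> z - (Phi z - b), starting from 0. *)
Lemma near_identity_onto (Phi : C -> C) (r : R) (b : C) :
  (forall z w, Cmod z < r -> Cmod w < r ->
     Cmod (Phi z - Phi w - (z - w)) <= / 2 * Cmod (z - w)) ->
  Phi 0 = 0 -> 4 * Cmod b < r -> exists z, Cmod z < r /\ Phi z = b.
Proof.
  intros HPhi H0 Hb. pose proof (Cmod_ge_0 b) as Hb0.
  set (x := fun n => Nat.iter n (fun z => z - (Phi z - b))%C (RtoC 0)).
  assert (Hx : forall n, x (S n) = (x n - (Phi (x n) - b))%C) by reflexivity.
  assert (Q : forall n, Cmod (x n) <= 2 * Cmod b * (1 - / 2 ^ n) /\
     Cmod (x (S n) - x n) <= Cmod b / 2 ^ n).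
  { assert (Hin : forall n, Cmod (x n) <= 2 * Cmod b * (1 - / 2 ^ n) -> Cmod (x n) < r).
    { intros n Hn. pose proof (Rinv_0_lt_compat _ (two_pow_pos n)). nra. }
    induction n as [|n [IH1 IH2]].
    - rewrite Hx. simpl. rewrite H0, Cmod_0. split; [lra|].
      replace (0 - (0 - b) - 0)%C with b by ring. lra.
    - assert (E : / 2 ^ n = 2 * / 2 ^ S n) by (simpl; field; apply pow_nonzero; lra).
      assert (A : Cmod (x (S n)) <= 2 * Cmod b * (1 - / 2 ^ S n)).
      { replace (x (S n)) with (x n + (x (S n) - x n))%C by ring.
        eapply Rle_trans; [apply Cmod_triangle|]. unfold Rdiv in IH2. nra. }
      split; [exact A|].
      rewrite (Hx (S n)).
      replace (x (S n) - (Phi (x (S n)) - b) - x (S n))%C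
        with (- (Phi (x (S n)) - Phi (x n) - (x (S n) - x n)))%C by (rewrite (Hx n); ring).
      rewrite Cmod_opp.
      eapply Rle_trans; [apply HPhi; apply Hin; assumption|].
      unfold Rdiv in *. rewrite E in IH2. nra. }
  destruct (geometric_limit x (Cmod b)) as [l Hl]; [intros n; apply Q|].
  assert (Hlr : Cmod l < r).
  { pose proof (Hl 0%nat) as A. simpl in A.
    replace (0 - l)%C with (- l)%C in A by ring. rewrite Cmod_opp in A. lra. }
  exists l. split; [exact Hlr|].
  assert (Z : Cmod (Phi l - b) = 0).
  { apply Rle_antisym; [|apply Cmod_ge_0].
    apply (Rle_eps_mult _ 1); [lra|]. intros eps Heps.
    destruct (exists_pow2_small (7 * Cmod b) eps) as [n Hn]; [lra | exact Heps|].
    pose proof (Hl n) as A. pose proof (proj2 (Q n)) as B.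
    assert (Hxn : Cmod (x n) < r).
    { pose proof (proj1 (Q n)). pose proof (Rinv_0_lt_compat _ (two_pow_pos n)). nra. }
    pose proof (HPhi (x n) l Hxn Hlr) as D.
    replace (Phi l - b)%C
      with (- (Phi (x n) - Phi l - (x n - l)) - (x n - l) - (x (S n) - x n))%C
      by (rewrite (Hx n); ring).
    eapply Rle_trans; [apply Cmod_minus_le|].
    eapply Rle_trans; [apply Rplus_le_compat_r, Cmod_minus_le|]. rewrite Cmod_opp.
    unfold Rdiv in *. lra. }
  apply Cmod_eq_0 in Z. replace (Phi l) with ((Phi l - b) + b)%C by ring. rewrite Z. ring.
Qed.

(** The exponential takes the value 1 at 0 and at 2 pi i.  A map that is C^1 close to it
    is, near 0, close to a translate of the identity, hence takes its value at 2 pi i near 0 as well.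
    Radius 9 leaves room for 2 pi. *)
Lemma near_exp_not_injective (H H1 G G1 : C -> C) (tau : R) : tau <= / 1000 ->
  holo 0 9 H H1 -> holo 0 9 G G1 ->
  (forall z, Cmod (z - 0) < 9 -> Cmod (H1 z - cexp z) <= tau) ->
  (forall z, Cmod (z - 0) < 9 -> Cmod (G1 z) <= tau) ->
  exists z w, Cmod z < 9 /\ Cmod w < 9 /\ z <> w /\
    (H z + Cconj (G z) = H w + Cconj (G w))%C.
Proof.
  intros Htau HH HG BH BG.
  set (F := fun z => (H z + Cconj (G z))%C).
  assert (In : forall z, Cmod z < 9 -> Cmod (z - 0) < 9)
    by (intros z Hz; replace (z - 0)%C with z by ring; exact Hz).
  assert (Err : forall z w, Cmod z < 9 -> Cmod w < 9 ->
    Cmod (F z - F w - (cexp z - cexp w)) <= / 500 * Cmod (z - w)).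
  { intros z w Hz Hw.
    assert (D : holo 0 9 (fun u => H u - cexp u)%C (fun u => H1 u - cexp u)%C).
    { intros u Hu. apply (cderiv_minus H cexp); [apply HH, Hu | apply cderiv_cexp]. }
    pose proof (mean_value_ball 0 9 _ _ tau D BH z w (In z Hz) (In w Hw)) as A.
    pose proof (mean_value_ball 0 9 _ _ tau HG BG z w (In z Hz) (In w Hw)) as B.
    cbv beta in A.
    replace (F z - F w - (cexp z - cexp w))%C
      with ((H z - cexp z - (H w - cexp w)) + Cconj (G z - G w))%C
      by (unfold F; rewrite Cminus_conj; ring).
    eapply Rle_trans; [apply Cmod_triangle|]. rewrite Cmod_conj.
    pose proof (Cmod_ge_0 (z - w)). nra. }
  assert (Lin : forall z w, Cmod z < / 8 -> Cmod w < / 8 ->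
    Cmod (cexp z - cexp w - (z - w)) <= / 4 * Cmod (z - w)).
  { assert (E : forall z, Cmod (z - 0) < / 8 -> Cmod (cexp z - 1) <= / 4).
    { intros z Hz.
      pose proof (gronwall_ball 0 (/ 8) 1 cexp cexp) as A.
      specialize (A ltac:(lra) ltac:(lra) ltac:(lra) (fun u _ => cderiv_cexp u)).
      specialize (A ltac:(intros; lra) z Hz). rewrite cexp_0, Cmod_1 in A. lra. }
    intros z w Hz Hw.
    replace (cexp z - cexp w - (z - w))%C with ((cexp z - z) - (cexp w - w))%C by ring.
    apply (mean_value_ball 0 (/ 8) (fun u => cexp u - u)%C (fun u => cexp u - 1)%C).
    - intros u _. apply (cderiv_minus cexp (fun u => u)); [apply cderiv_cexp | apply cderiv_id].
    - exact E.
    - replace (z - 0)%C with z by ring. exact Hz.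
    - replace (w - 0)%C with w by ring. exact Hw. }
  set (p := (RtoC (2 * PI) * Ci)%C).
  pose proof PI_RGT_0 as HPI. pose proof PI_4 as HPI4. pose proof PI2_1 as HPI1.
  assert (Hp : Cmod p = 2 * PI).
  { unfold p. rewrite Cmod_mult, Cmod_Ci, Cmod_RtoC_pos by lra. ring. }
  assert (H0 : Cmod 0 < 9) by (rewrite Cmod_0; lra).
  set (b := (F p - F 0)%C).
  assert (Hb : Cmod b <= / 500 * 8).
  { pose proof (Err p 0 ltac:(lra) H0) as A. unfold p in A at 2. rewrite cexp_2PIi, cexp_0 in A.
    fold p in A. replace (F p - F 0 - (1 - 1))%C with b in A by (unfold b; ring).
    replace (p - 0)%C with p in A by ring. lra. }
  destruct (near_identity_onto (fun z => F z - F 0)%C (/ 8) b) as [z [Hz E]].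
  - intros z w Hz Hw.
    replace (F z - F 0 - (F w - F 0) - (z - w))%C
      with ((F z - F w - (cexp z - cexp w)) + (cexp z - cexp w - (z - w)))%C by ring.
    eapply Rle_trans; [apply Cmod_triangle|].
    pose proof (Err z w ltac:(lra) ltac:(lra)). pose proof (Lin z w Hz Hw).
    pose proof (Cmod_ge_0 (z - w)). lra.
  - ring.
  - lra.
  - exists z, p. split; [lra|]. split; [lra|]. split.
    + intros Ez. rewrite Ez in Hz. lra.
    + fold (F z) (F p). replace (F z) with ((F z - F 0) + F 0)%C by ring.
      rewrite E. unfold b. ring.
Qed.

(** * Normalized harmonic maps of a large disk *)

Lemma holo_sub (o z : C) (r s : R) (f f1 : C -> C) :
  holo o r f f1 -> Cmod (z - o) + s <= r -> holo z s f f1.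
Proof.
  intros Hf Hs u Hu. apply Hf. pose proof (Cmod_sub_triangle u z o). lra.
Qed.

Lemma sub_0_r (z : C) : (z - 0)%C = z.
Proof. ring. Qed.

(** The second complex dilatation g'/h' of h + conj g. *)
Definition dilatation (H1 G1 : C -> C) (z : C) : C := (G1 z / H1 z)%C.
Definition dilatation_deriv (H1 H2 G1 G2 : C -> C) (z : C) : C :=
  ((G2 z * H1 z - G1 z * H2 z) / (H1 z * H1 z))%C.

Lemma dilatation_holo (o : C) (r : R) (H1 H2 G1 G2 : C -> C) :
  holo o r H1 H2 -> holo o r G1 G2 -> (forall z, Cmod (z - o) < r -> H1 z <> 0) ->
  holo o r (dilatation H1 G1) (dilatation_deriv H1 H2 G1 G2).
Proof.
  intros HH HG Hnz z Hz. apply (cderiv_div G1 H1); [apply HG, Hz | apply HH, Hz | apply Hnz, Hz].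
Qed.

Lemma Cmod_div_lt_1 (a b : C) : Cmod a < Cmod b -> Cmod (a / b) < 1.
Proof.
  intros H. pose proof (Cmod_ge_0 a). assert (Hb : b <> 0) by (apply Cmod_gt_0; lra).
  rewrite Cmod_div by exact Hb. apply (Rmult_lt_reg_r (Cmod b)); [lra|].
  unfold Rdiv. rewrite Rmult_assoc, Rinv_l; lra.
Qed.

Lemma Cmod_sq (z : C) : (RtoC (Cmod z ^ 2) = z * Cconj z)%C.
Proof. apply Cmod2_conj. Qed.

(** For a1 = h', b1 = g' and w the dilatation, the left side divided by the Jacobian is the
    z-derivative of the logarithm of the Jacobian: it differs from the analytic pre-Schwarzian a2 / a1 by a term controlled by the
    dilatation. *)
Lemma jacobian_pre_schwarzian (a2 a1 b2 b1 : C) : a1 <> 0 ->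
  let w := (b1 / a1)%C in let w1 := ((b2 * a1 - b1 * a2) / (a1 * a1))%C in
  (a2 * Cconj a1 - b2 * Cconj b1
    = RtoC (Cmod a1 ^ 2) * (a2 / a1 * RtoC (1 - Cmod w ^ 2) - Cconj w * w1))%C.
Proof.
  intros Ha w w1. rewrite RtoC_minus, !Cmod_sq.
  assert (E1 : b1 = (w * a1)%C) by (unfold w; field; exact Ha).
  assert (E2 : b2 = (w1 * a1 + w * a2)%C) by (unfold w, w1; field; exact Ha).
  rewrite E1 at 1. rewrite E2. rewrite Cmult_conj. clearbody w w1. field. exact Ha.
Qed.

(** Suppose h' is normalized at 0, g' vanishes there, and the derivative of the logarithm of
    the Jacobian is bounded by 4 on a very large disk.  The dilatation is at most 1 and vanishes at 0, so by Cauchy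
    estimates it is tiny on bounded sets; then H2 / H1 is bounded on a large disk and, again by Cauchy
    estimates, nearly constant, that is nearly 1, on bounded sets.  Hence H1 is nearly the exponential,
    G1 is nearly zero, and the map repeats a value.  This is a quantitative form of the statement
    that the limit of such maps on larger and larger disks is e^z - 1. *)
Lemma normalized_not_injective : exists L, 0 < L /\
  forall H H1 H2 G G1 G2 : C -> C,
  holo 0 L H H1 -> holo 0 L H1 H2 -> holo 0 L G G1 -> holo 0 L G1 G2 ->
  (forall z, Cmod z < L -> Cmod (G1 z) < Cmod (H1 z)) ->
  G1 0 = 0 -> H1 0 = 1 -> H2 0 = 1 ->
  (forall z, Cmod z < L -> Cmod (H2 z * Cconj (H1 z) - G2 z * Cconj (G1 z))
     <= 4 * (Cmod (H1 z) ^ 2 - Cmod (G1 z) ^ 2)) ->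
  exists z w, Cmod z < L /\ Cmod w < L /\ z <> w /\
    (H z + Cconj (G z) = H w + Cconj (G w))%C.
Proof.
  set (E := exp 9). assert (HE : 1 < E) by (unfold E; rewrite <- exp_0; apply exp_increasing; lra).
  (* any L much larger than the size E of the exponential on the ball of radius 9 will do *)
  set (L := 1000000000 * E). assert (HL : 1000000000 < L) by (unfold L; nra).
  exists L. split; [lra|].
  intros H H1 H2 G G1 G2 DH DH1 DG DG1 Hlt G0 H10 H20 Hp.
  assert (Hnz : forall z, Cmod (z - 0) < L -> H1 z <> 0).
  { intros z Hz. rewrite sub_0_r in Hz. apply Cmod_gt_0.
    pose proof (Hlt z Hz). pose proof (Cmod_ge_0 (G1 z)). lra. }
  set (om := dilatation H1 G1). set (om' := dilatation_deriv H1 H2 G1 G2).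
  assert (Dom : holo 0 L om om') by (apply dilatation_holo; assumption).
  assert (Bom : forall z, Cmod (z - 0) < L -> Cmod (om z) <= 1).
  { intros z Hz. left. apply Cmod_div_lt_1, Hlt. rewrite sub_0_r in Hz. exact Hz. }
  assert (Bom' : forall z, Cmod (z - 0) < L / 2 -> Cmod (om' z) <= 8 / L).
  { intros z Hz.
    replace (8 / L) with (4 * 1 / (L / 2)) by (field; lra).
    apply (cauchy_estimate_inside 0 z L (L / 2) 1 om om'); [lra | exact Dom | exact Bom | lra]. }
  assert (om0 : om 0 = 0).
  { unfold om, dilatation. rewrite G0, H10. field. }
  assert (Som : forall z, Cmod (z - 0) < L / 2 -> Cmod (om z) <= 8 / L * Cmod z).
  { intros z Hz.
    assert (D : holo 0 (L / 2) om om').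
    { apply (holo_sub 0 0 L); [exact Dom|]. rewrite Cmod_center. lra. }
    pose proof (mean_value_ball 0 (L / 2) om om' (8 / L) D Bom' z 0 Hz) as M.
    rewrite Cmod_center, om0, !sub_0_r in M. apply M. lra. }
  assert (i8 : 8 / L * (L / 16) = / 2) by (field; lra).
  assert (p8 : 0 < 8 / L) by (apply Rdiv_lt_0_compat; lra).
  set (P := fun z => (H2 z / H1 z)%C).
  assert (BP : forall z, Cmod (z - 0) < L / 16 -> Cmod (P z) <= 5).
  { intros z Hz. assert (HzL : Cmod z < L) by (rewrite sub_0_r in Hz; lra).
    pose proof (Hp z HzL) as Q.
    assert (N : H1 z <> 0) by (apply Hnz; lra).
    pose proof (proj1 (Cmod_gt_0 _) N) as Np.
    rewrite (jacobian_pre_schwarzian _ _ _ _ N) in Q. cbv zeta in Q.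
    change (G1 z / H1 z)%C with (om z) in Q.
    change ((G2 z * H1 z - G1 z * H2 z) / (H1 z * H1 z))%C with (om' z) in Q.
    change (H2 z / H1 z)%C with (P z) in Q.
    assert (W : Cmod (om z) <= / 2).
    { pose proof (Som z ltac:(lra)). rewrite sub_0_r in Hz.
      pose proof (Cmod_ge_0 z). nra. }
    assert (W' : Cmod (om' z) <= 1).
    { eapply Rle_trans; [apply Bom'; lra|]. apply (Rmult_le_reg_r L); [lra|].
      unfold Rdiv. rewrite Rmult_assoc, Rinv_l by lra. lra. }
    assert (J : Cmod (H1 z) ^ 2 - Cmod (G1 z) ^ 2 = Cmod (H1 z) ^ 2 * (1 - Cmod (om z) ^ 2)).
    { unfold om, dilatation. rewrite Cmod_div by exact N. field. lra. }
    rewrite J, Cmod_mult, (Cmod_RtoC_pos (Cmod (H1 z) ^ 2)) in Q by (apply pow2_ge_0).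
    assert (Q1 : Cmod (P z * RtoC (1 - Cmod (om z) ^ 2) - Cconj (om z) * om' z)
       <= 4 * (1 - Cmod (om z) ^ 2)).
    { apply (Rmult_le_reg_l (Cmod (H1 z) ^ 2)); [apply pow_lt, Np|]. lra. }
    pose proof (Cmod_ge_0 (om z)) as W0. pose proof (Cmod_ge_0 (om' z)) as W0'.
    set (k := 1 - Cmod (om z) ^ 2) in *.
    assert (Hk : 3 / 4 <= k) by (unfold k; nra).
    pose proof (Cmod_reverse_triangle (P z * RtoC k) (Cconj (om z) * om' z)) as T.
    rewrite !Cmod_mult, Cmod_conj, Cmod_RtoC_pos in T by lra.
    assert (Cmod (om z) * Cmod (om' z) <= / 2 * 1) by (apply Rmult_le_compat; lra).
    apply Rnot_lt_le. intros C5. nra. }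
  assert (DP : holo 0 (L / 16) P (C_derive P)).
  { pose proof (holo_derivative 0 L H1 H2 DH1) as DH2. apply holo_of_ex. intros z Hz.
    eexists. apply (cderiv_div H2 H1); [apply DH2; lra | apply DH1; lra | apply Hnz; lra]. }
  assert (BP' : forall z, Cmod (z - 0) < L / 32 -> Cmod (C_derive P z) <= 640 / L).
  { intros z Hz. replace (640 / L) with (4 * 5 / (L / 32)) by (field; lra).
    apply (cauchy_estimate_inside 0 z (L / 16) (L / 32) 5 P); [lra | exact DP | exact BP | lra]. }
  assert (P0 : P 0 = 1).
  { unfold P. rewrite H10, H20. field. }
  set (eta := 640 / L * 9).
  assert (Eeta : eta * E = 5760 / 1000000000) by (unfold eta, L; field; lra).
  assert (Heta : 0 < eta).
  { unfold eta. apply Rmult_lt_0_compat; [apply Rdiv_lt_0_compat|]; lra. }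
  assert (Heta' : eta <= 5760 / 1000000000) by nra.
  assert (SP : forall z, Cmod (z - 0) < 9 -> Cmod (P z - 1) <= eta).
  { intros z Hz.
    assert (D : holo 0 (L / 32) P (C_derive P)).
    { apply (holo_sub 0 0 (L / 16)); [exact DP|]. rewrite Cmod_center. lra. }
    pose proof (mean_value_ball 0 (L / 32) P _ (640 / L) D BP' z 0) as M.
    rewrite Cmod_center, P0, sub_0_r in M. rewrite sub_0_r in Hz.
    specialize (M ltac:(lra) ltac:(lra)). unfold eta.
    assert (0 < 640 / L) by (apply Rdiv_lt_0_compat; lra). nra. }
  (* K is H1 divided by exp, and its logarithmic derivative is P - 1 *)
  set (K := fun z => (H1 z * cexp (0 + -1 * z))%C).
  set (K' := fun z => ((P z - 1) * K z)%C).
  assert (DK : holo 0 9 K K').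
  { intros z Hz.
    eapply cderiv_eq; [|apply (cderiv_mult H1 (fun u => cexp (0 + -1 * u)));
      [apply DH1; lra | apply cderiv_affine, cderiv_cexp]].
    unfold K', K, P. field. apply Hnz. lra. }
  assert (K0 : K 0 = 1).
  { unfold K. rewrite H10. replace (0 + -1 * 0)%C with (RtoC 0) by ring. rewrite cexp_0. ring. }
  assert (BK : forall z, Cmod (z - 0) < 9 -> Cmod (K z - 1) <= 18 * eta).
  { intros z Hz.
    pose proof (gronwall_ball 0 9 eta K K' ltac:(lra) ltac:(lra) ltac:(lra) DK) as A.
    rewrite K0, Cmod_1 in A.
    eapply Rle_trans; [apply A|].
    - intros u Hu. unfold K'. rewrite Cmod_mult.
      apply Rmult_le_compat_r; [apply Cmod_ge_0 | apply SP, Hu].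
    - exact Hz.
    - pose proof (Cmod_ge_0 (z - 0)). nra. }
  assert (BE : forall z, Cmod (z - 0) < 9 -> Cmod (cexp z) <= E).
  { intros z Hz. rewrite Cmod_cexp. left. apply exp_increasing.
    rewrite sub_0_r in Hz. pose proof (fst_le_Cmod z). pose proof (Rle_abs (fst z)). lra. }
  assert (EH : forall z, Cmod (z - 0) < 9 -> Cmod (H1 z - cexp z) <= 18 * (eta * E)).
  { intros z Hz.
    replace (H1 z - cexp z)%C with ((K z - 1) * cexp z)%C.
    - rewrite Cmod_mult. pose proof (BK z Hz). pose proof (BE z Hz).
      replace (18 * (eta * E)) with (18 * eta * E) by ring.
      apply Rmult_le_compat; try apply Cmod_ge_0; assumption.
    - unfold K. replace ((H1 z * cexp (0 + -1 * z) - 1) * cexp z)%C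
        with (H1 z * (cexp (0 + -1 * z) * cexp z) - cexp z)%C by ring.
      rewrite <- cexp_plus. replace (0 + -1 * z + z)%C with (RtoC 0) by ring.
      rewrite cexp_0. ring. }
  assert (EG : forall z, Cmod (z - 0) < 9 -> Cmod (G1 z) <= / 1000).
  { intros z Hz. assert (N : H1 z <> 0) by (apply Hnz; lra).
    replace (G1 z) with (om z * H1 z)%C by (unfold om, dilatation; field; exact N).
    rewrite Cmod_mult.
    pose proof (Som z ltac:(lra)) as A. rewrite sub_0_r in Hz.
    assert (B : Cmod (om z) <= 72 / L).
    { eapply Rle_trans; [exact A|]. replace (72 / L) with (8 / L * 9) by (field; lra).
      apply Rmult_le_compat_l; lra. }
    assert (D : Cmod (H1 z) <= 2 * E).
    { replace (H1 z) with ((H1 z - cexp z) + cexp z)%C by ring.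
      eapply Rle_trans; [apply Cmod_triangle|].
      pose proof (EH z ltac:(rewrite sub_0_r; exact Hz)).
      pose proof (BE z ltac:(rewrite sub_0_r; exact Hz)). lra. }
    eapply Rle_trans; [apply Rmult_le_compat; [apply Cmod_ge_0 | apply Cmod_ge_0 | exact B | exact D]|].
    replace (72 / L * (2 * E)) with (144 / 1000000000) by (unfold L; field; lra). lra. }
  destruct (near_exp_not_injective H H1 G G1 (/ 1000)) as [z [w [Hz [Hw [Hzw Heq]]]]].
  - lra.
  - intros z Hz. apply DH. lra.
  - intros z Hz. apply DG. lra.
  - intros z Hz. eapply Rle_trans; [apply EH, Hz|]. lra.
  - exact EG.
  - exists z, w. repeat split; try assumption; lra.
Qed.

(** * A bound for the logarithmic derivative of the Jacobian *)

(** Compactness of a square containing the ball; centres outside the ball get radii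
    so small that they impose nothing. *)
Lemma locally_bounded_closed_ball (a : C) (r : R) (phi : C -> R) :
  (forall z, Cmod (z - a) <= r -> exists d M, 0 < d /\
     forall w, Cmod (w - z) < d -> phi w <= M) ->
  exists M, forall w, Cmod (w - a) <= r -> phi w <= M.
Proof.
  intros H.
  assert (Hd : forall z, exists d : posreal,
    forall w, Cmod (w - a) <= r -> Cmod (w - z) < 2 * d -> phi w <= / d).
  { intros z. destruct (Rle_lt_dec (Cmod (z - a)) r) as [Hz|Hz].
    - destruct (H z Hz) as [d [M [Hd HM]]].
      pose proof (Rabs_pos M) as HMp. pose proof (Rle_abs M) as HMa.
      assert (Hi : 0 < / (Rabs M + 1)) by (apply Rinv_0_lt_compat; lra).
      assert (Hm : 0 < Rmin (d / 2) (/ (Rabs M + 1))) by (apply Rmin_pos; lra).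
      exists (mkposreal _ Hm). simpl. intros w _ Hw.
      pose proof (Rmin_l (d / 2) (/ (Rabs M + 1))). pose proof (Rmin_r (d / 2) (/ (Rabs M + 1))).
      eapply Rle_trans; [apply HM; lra|].
      eapply Rle_trans; [|apply Rinv_le_contravar; [exact Hm | eassumption]].
      rewrite Rinv_inv. lra.
    - assert (Hm : 0 < (Cmod (z - a) - r) / 2) by lra.
      exists (mkposreal _ Hm). simpl. intros w Hw1 Hw2.
      pose proof (Cmod_sub_triangle z w a) as T. rewrite (Cmod_sub_sym z w) in T. lra. }
  set (dl := fun u v : R => proj1_sig (constructive_indefinite_description _ (Hd (u, v)))).
  destruct (compactness_value_2d (fst a - r) (fst a + r) (snd a - r) (snd a + r) dl) as [d0 Hd0].
  exists (/ d0). intros w Hw. apply NNPP. intros N.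
  pose proof (fst_le_Cmod (w - a)%C) as W1. pose proof (im_le_Cmod (w - a)%C) as W2.
  simpl in W1, W2.
  assert (W1' : Rabs (fst w + - fst a) <= r) by lra.
  assert (W2' : Rabs (snd w + - snd a) <= r) by lra.
  apply Rabs_le_between in W1'. apply Rabs_le_between in W2'.
  apply (Hd0 (fst w) (snd w)); [lra | lra |].
  intros [u [v [_ [_ [Hu [Hv Hle]]]]]]. apply N.
  pose proof (proj2_sig (constructive_indefinite_description _ (Hd (u, v))) w Hw) as B.
  fold (dl u v) in B. cbv beta in B.
  eapply Rle_trans; [apply B|].
  - eapply Rle_lt_trans; [apply Cmod_le_add|]. simpl.
    change (fst w + - u) with (fst w - u). change (snd w + - v) with (snd w - v).
    unfold dl in *. lra.
  - apply Rinv_le_contravar; [apply cond_pos | exact Hle].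
Qed.

Definition jacobian (h1 g1 : C -> C) (z : C) : R := Cmod (h1 z) ^ 2 - Cmod (g1 z) ^ 2.
(** The z-derivative of the Jacobian of h + conj g, from the first and second derivatives
    of h and g. *)
Definition jacobian_dz (h1 h2 g1 g2 : C -> C) (z : C) : C :=
  (h2 z * Cconj (h1 z) - g2 z * Cconj (g1 z))%C.

Lemma jacobian_pos (h1 g1 : C -> C) (z : C) : Cmod (g1 z) < Cmod (h1 z) -> 0 < jacobian h1 g1 z.
Proof. intros H. unfold jacobian. pose proof (Cmod_ge_0 (g1 z)). nra. Qed.

Lemma ccont_le (f : C -> C) (z : C) (e : R) : ccont f z -> 0 < e ->
  exists d, 0 < d /\ forall w, Cmod (w - z) < d -> Cmod (f w) <= Cmod (f z) + e.
Proof.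
  intros H He. destruct (H e He) as [d [Hd Hd']]. exists d. split; [exact Hd|].
  intros w Hw. pose proof (Hd' w Hw). pose proof (Cmod_reverse_triangle (f w) (f z)). lra.
Qed.

Lemma jacobian_ratio_bounded (a : C) (r R0 : R) (h1 h2 g1 g2 : C -> C) : r < R0 ->
  holo a R0 h1 h2 -> holo a R0 g1 g2 ->
  (forall z, Cmod (z - a) < R0 -> Cmod (g1 z) < Cmod (h1 z)) ->
  exists M, forall z, Cmod (z - a) <= r ->
    Cmod (jacobian_dz h1 h2 g1 g2 z) / jacobian h1 g1 z <= M.
Proof.
  intros HrR Dh1 Dg1 Hlt.
  assert (Hnz : forall z, Cmod (z - a) < R0 -> h1 z <> 0).
  { intros z Hz. apply Cmod_gt_0. pose proof (Hlt z Hz). pose proof (Cmod_ge_0 (g1 z)). lra. }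
  set (om := dilatation h1 g1). set (om' := dilatation_deriv h1 h2 g1 g2).
  assert (Dom : holo a R0 om om') by (apply dilatation_holo; assumption).
  pose proof (holo_derivative a R0 om om' Dom) as Dom'.
  pose proof (holo_derivative a R0 h1 h2 Dh1) as Dh2.
  set (P := fun z => (h2 z / h1 z)%C).
  apply locally_bounded_closed_ball. intros z Hz.
  assert (HzR : Cmod (z - a) < R0) by lra.
  assert (CP : ccont P z).
  { eapply cderiv_ccont, (cderiv_div h2 h1);
      [apply Dh2, HzR | apply Dh1, HzR | apply Hnz, HzR]. }
  assert (W1 : Cmod (om z) < 1) by (apply Cmod_div_lt_1, Hlt, HzR).
  destruct (ccont_le P z 1 CP) as [d1 [Hd1 B1]]; [lra|].
  destruct (ccont_le om' z 1) as [d2 [Hd2 B2]]; [eapply holo_ccont; eassumption | lra |].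
  destruct (ccont_le om z ((1 - Cmod (om z)) / 2)) as [d3 [Hd3 B3]];
    [eapply holo_ccont; eassumption | lra |].
  set (d := Rmin (Rmin d1 d2) (Rmin d3 (R0 - Cmod (z - a)))).
  exists d, ((Cmod (P z) + Cmod (om' z) + 2) * (2 / (1 - Cmod (om z)))).
  split; [unfold d; repeat apply Rmin_pos; lra|]. intros w Hw.
  destruct (lt_Rmin _ _ _ Hw) as [Hw12 Hw34].
  destruct (lt_Rmin _ _ _ Hw12) as [Hw1 Hw2]. destruct (lt_Rmin _ _ _ Hw34) as [Hw3 Hw4].
  assert (HwR : Cmod (w - a) < R0) by (pose proof (Cmod_sub_triangle w z a); lra).
  specialize (B1 w Hw1). specialize (B2 w Hw2). specialize (B3 w Hw3).
  pose proof (Hnz w HwR) as N. pose proof (proj1 (Cmod_gt_0 _) N) as Np.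
  unfold jacobian_dz. rewrite (jacobian_pre_schwarzian _ _ _ _ N). cbv zeta.
  change (g1 w / h1 w)%C with (om w).
  change ((g2 w * h1 w - g1 w * h2 w) / (h1 w * h1 w))%C with (om' w).
  change (h2 w / h1 w)%C with (P w).
  assert (J : jacobian h1 g1 w = Cmod (h1 w) ^ 2 * (1 - Cmod (om w) ^ 2)).
  { unfold jacobian, om, dilatation. rewrite Cmod_div by exact N. field. lra. }
  pose proof (Cmod_ge_0 (om w)) as O1. pose proof (Cmod_ge_0 (om z)) as O2.
  set (x := Cmod (om w)) in *. set (y := Cmod (om z)) in *.
  assert (K1 : 0 < 1 - x ^ 2) by nra.
  assert (K2 : (1 - y) / 2 <= 1 - x ^ 2) by nra.
  rewrite J, Cmod_mult, Cmod_RtoC_pos by apply pow2_ge_0.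
  replace (Cmod (h1 w) ^ 2 * Cmod (P w * RtoC (1 - x ^ 2) - Cconj (om w) * om' w) /
     (Cmod (h1 w) ^ 2 * (1 - x ^ 2)))
    with (Cmod (P w * RtoC (1 - x ^ 2) - Cconj (om w) * om' w) * / (1 - x ^ 2))
    by (field; split; nra).
  assert (I1 : / (1 - x ^ 2) <= 2 / (1 - y)).
  { replace (2 / (1 - y)) with (/ ((1 - y) / 2)) by (field; lra).
    apply Rinv_le_contravar; lra. }
  apply Rmult_le_compat; [apply Cmod_ge_0 | left; apply Rinv_0_lt_compat, K1 | | exact I1].
  eapply Rle_trans; [apply Cmod_minus_le|].
  rewrite !Cmod_mult, Cmod_conj, Cmod_RtoC_pos by lra. fold x.
  pose proof (Cmod_ge_0 (P w)). pose proof (Cmod_ge_0 (om' w)).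
  assert (Cmod (P w) * (1 - x ^ 2) <= Cmod (P w)) by nra.
  assert (x * Cmod (om' w) <= Cmod (om' w)) by nra.
  lra.
Qed.

(** Composing h + conj g with w -> w + A conj w replaces h by h + A g and g by g + conj A h.
    The Jacobian is multiplied by the constant 1 - |A|^2, so its logarithmic derivative does not
    change; the next lemma is the same identity for the derivative. *)
Lemma affine_jacobian (A u v : C) :
  Cmod (u + A * v) ^ 2 - Cmod (v + Cconj A * u) ^ 2
    = (1 - Cmod A ^ 2) * (Cmod u ^ 2 - Cmod v ^ 2).
Proof.
  apply RtoC_inj. rewrite RtoC_mult, !RtoC_minus, !Cmod_sq.
  rewrite !Cplus_conj, !Cmult_conj, Cconj_conj. ring.
Qed.

Lemma affine_jacobian_dz (A u1 u2 v1 v2 : C) :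
  ((u2 + A * v2) * Cconj (u1 + A * v1) - (v2 + Cconj A * u2) * Cconj (v1 + Cconj A * u1)
    = RtoC (1 - Cmod A ^ 2) * (u2 * Cconj u1 - v2 * Cconj v1))%C.
Proof.
  rewrite RtoC_minus, !Cmod_sq.
  rewrite !Cplus_conj, !Cmult_conj, Cconj_conj. ring.
Qed.

Lemma affine_injective (A v w : C) : Cmod A < 1 ->
  (v + A * Cconj v = w + A * Cconj w)%C -> v = w.
Proof.
  intros HA E.
  assert (E' : ((v - w) + A * Cconj (v - w) = 0)%C).
  { rewrite Cminus_conj.
    replace (v - w + A * (Cconj v - Cconj w))%C
      with ((v + A * Cconj v) - (w + A * Cconj w))%C by ring. rewrite E. ring. }
  assert (M : Cmod (v - w) = Cmod A * Cmod (v - w)).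
  { rewrite <- (Cmod_conj (v - w)) at 2. rewrite <- Cmod_mult, <- Cmod_opp.
    f_equal.
    replace (A * Cconj (v - w))%C with ((v - w + A * Cconj (v - w)) - (v - w))%C by ring.
    rewrite E'. ring. }
  pose proof (Cmod_ge_0 (v - w)).
  assert (Z : Cmod (v - w) = 0) by nra.
  apply Cmod_eq_0 in Z. replace v with ((v - w) + w)%C by ring. rewrite Z. ring.
Qed.

(** Reduction to the normalized situation: an affine change in the image makes the
    conjugate part critical at o, and a dilation and rotation of the source makes the logarithmic
    derivative of the Jacobian equal to 1 there.  Both preserve injectivity and the bound. *)
Lemma rescaled_not_injective (L : R) :
  (forall H H1 H2 G G1 G2 : C -> C,
    holo 0 L H H1 -> holo 0 L H1 H2 -> holo 0 L G G1 -> holo 0 L G1 G2 ->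
    (forall z, Cmod z < L -> Cmod (G1 z) < Cmod (H1 z)) ->
    G1 0 = 0 -> H1 0 = 1 -> H2 0 = 1 ->
    (forall z, Cmod z < L -> Cmod (H2 z * Cconj (H1 z) - G2 z * Cconj (G1 z))
       <= 4 * (Cmod (H1 z) ^ 2 - Cmod (G1 z) ^ 2)) ->
    exists z w, Cmod z < L /\ Cmod w < L /\ z <> w /\
      (H z + Cconj (G z) = H w + Cconj (G w))%C) ->
  forall (o : C) (s lam : R) (h h1 h2 g g1 g2 : C -> C),
  0 < s -> 0 < lam -> L <= s * lam ->
  holo o s h h1 -> holo o s h1 h2 -> holo o s g g1 -> holo o s g1 g2 ->
  (forall z, Cmod (z - o) < s -> Cmod (g1 z) < Cmod (h1 z)) ->
  Cmod (jacobian_dz h1 h2 g1 g2 o) = lam * jacobian h1 g1 o ->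
  (forall z, Cmod (z - o) < s -> Cmod (jacobian_dz h1 h2 g1 g2 z) <= 4 * lam * jacobian h1 g1 z) ->
  exists z w, Cmod (z - o) < s /\ Cmod (w - o) < s /\ z <> w /\
    (h z + Cconj (g z) = h w + Cconj (g w))%C.
Proof.
  intros Core o s lam h h1 h2 g g1 g2 Hs Hlam HL Dh Dh1 Dg Dg1 Hlt Hlamo Hbd.
  assert (Ho : Cmod (o - o) < s) by (rewrite Cmod_center; exact Hs).
  pose proof (jacobian_pos h1 g1 o (Hlt o Ho)) as Jo.
  (* the source is rescaled by mu and the image by k, with conjugate coefficient A *)
  set (mu := (jacobian_dz h1 h2 g1 g2 o / RtoC (jacobian h1 g1 o))%C).
  assert (Jo' : RtoC (jacobian h1 g1 o) <> 0) by (intros E; apply RtoC_inj in E; lra).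
  assert (Hmu : Cmod mu = lam).
  { unfold mu. rewrite Cmod_div, Cmod_RtoC_pos, Hlamo by (try exact Jo'; lra). field. lra. }
  assert (Nmu : mu <> 0) by (apply Cmod_gt_0; lra).
  assert (Nmuc : Cconj mu <> 0) by (apply Cmod_gt_0; rewrite Cmod_conj; lra).
  assert (Nh : h1 o <> 0).
  { apply Cmod_gt_0. pose proof (Hlt o Ho). pose proof (Cmod_ge_0 (g1 o)). lra. }
  assert (Nhc : Cconj (h1 o) <> 0)
    by (apply Cmod_gt_0; rewrite Cmod_conj; apply Cmod_gt_0, Nh).
  set (A := (- Cconj (g1 o / h1 o))%C).
  assert (HA : Cmod A < 1).
  { unfold A. rewrite Cmod_opp, Cmod_conj. apply Cmod_div_lt_1, Hlt, Ho. }
  assert (HA2 : 0 < 1 - Cmod A ^ 2) by (pose proof (Cmod_ge_0 A); nra).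
  set (q := (h1 o + A * g1 o)%C).
  assert (Eq : (q * Cconj (h1 o))%C = RtoC (jacobian h1 g1 o)).
  { unfold q, A, jacobian. rewrite RtoC_minus, !Cmod_sq, Cdiv_conj by exact Nh. field. exact Nhc. }
  assert (Nq : q <> 0) by (intros E; apply Jo'; rewrite <- Eq, E; ring).
  set (k := (mu / q)%C).
  assert (Nk : k <> 0).
  { unfold k. intros E. apply Nmu. replace mu with (mu / q * q)%C by (field; exact Nq).
    rewrite E. ring. }
  set (b := (/ mu)%C).
  assert (Hb : Cmod b = / lam) by (unfold b; rewrite Cmod_inv, Hmu by exact Nmu; reflexivity).
  assert (In : forall z, Cmod z < L -> Cmod (o + b * z - o) < s).
  { intros z Hz. replace (o + b * z - o)%C with (b * z)%C by ring. rewrite Cmod_mult, Hb.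
    apply (Rmult_lt_reg_l lam); [exact Hlam|]. rewrite <- Rmult_assoc, Rinv_r by lra. lra. }
  assert (In0 : forall z, Cmod (z - 0) < L -> Cmod (o + b * z - o) < s)
    by (intros z Hz; apply In; rewrite sub_0_r in Hz; exact Hz).
  set (T := fun (c e : C) (u v : C -> C) z => (c * (u (o + b * z)%C + e * v (o + b * z)%C))%C).
  assert (DT : forall c e u u1 v v1, holo o s u u1 -> holo o s v v1 ->
    holo 0 L (T c e u v) (T (c * b)%C e u1 v1)).
  { intros c e u u1 v v1 Du Dv z Hz. unfold T.
    apply (cderiv_eq _ _ (c * (b * u1 (o + b * z) + e * (b * v1 (o + b * z))))%C); [ring|].
    apply cderiv_scal.
    apply (cderiv_plus (fun w => u (o + b * w)%C) (fun w => e * v (o + b * w))%C).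
    - apply cderiv_affine, Du, In0, Hz.
    - apply cderiv_scal, cderiv_affine, Dv, In0, Hz. }
  assert (E0 : (o + b * 0)%C = o) by ring.
  assert (Jz : forall z, Cmod (T (k * b)%C A h1 g1 z) ^ 2
       - Cmod (T (Cconj k * b)%C (Cconj A) g1 h1 z) ^ 2
     = Cmod (k * b) ^ 2 * (1 - Cmod A ^ 2) * jacobian h1 g1 (o + b * z)).
  { intros z. unfold T, jacobian. pose proof (affine_jacobian A (h1 (o + b * z)%C) (g1 (o + b * z)%C)) as Q.
    set (U := (h1 (o + b * z) + A * g1 (o + b * z))%C) in *.
    set (V := (g1 (o + b * z) + Cconj A * h1 (o + b * z))%C) in *.
    rewrite Rmult_assoc, <- Q, !Cmod_mult, Cmod_conj. ring. }
  assert (Pkb : 0 < Cmod (k * b) ^ 2).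
  { apply pow_lt, Cmod_gt_0, Cmult_neq_0; [exact Nk|]. apply Cmod_gt_0. rewrite Hb.
    apply Rinv_0_lt_compat, Hlam. }
  destruct (Core (T k A h g) (T (k * b)%C A h1 g1) (T (k * b * b)%C A h2 g2)
    (T (Cconj k) (Cconj A) g h) (T (Cconj k * b)%C (Cconj A) g1 h1)
    (T (Cconj k * b * b)%C (Cconj A) g2 h2)) as [z [w [Hz [Hw [Hzw E]]]]].
  - apply DT; assumption.
  - apply DT; assumption.
  - apply DT; assumption.
  - apply DT; assumption.
  - intros z Hz. pose proof (Jz z) as J.
    pose proof (jacobian_pos h1 g1 _ (Hlt _ (In z Hz))) as Jp.
    apply Rsqr_incrst_0; try apply Cmod_ge_0. unfold Rsqr.
    assert (0 < Cmod (k * b) ^ 2 * (1 - Cmod A ^ 2) * jacobian h1 g1 (o + b * z))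
      by (apply Rmult_lt_0_compat; [apply Rmult_lt_0_compat|]; assumption).
    simpl in *. lra.
  - unfold T. rewrite E0. unfold A. rewrite Copp_conj, Cconj_conj. field. exact Nh.
  - unfold T. rewrite E0. fold q. unfold k, b. field. split; assumption.
  - unfold T. rewrite E0. unfold k.
    replace (mu / q * b * b * (h2 o + A * g2 o))%C
      with (b * ((h2 o + A * g2 o) * Cconj (h1 o) / (q * Cconj (h1 o))))%C
      by (unfold b; field; repeat split; assumption).
    rewrite Eq.
    replace ((h2 o + A * g2 o) * Cconj (h1 o))%C with (jacobian_dz h1 h2 g1 g2 o).
    + fold mu. unfold b. field. exact Nmu.
    + unfold jacobian_dz, A. rewrite Cdiv_conj by exact Nh. field. exact Nhc.
  - intros z Hz. rewrite Jz. unfold T.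
    replace (k * b * b * (h2 (o + b * z) + A * g2 (o + b * z)) *
       Cconj (k * b * (h1 (o + b * z) + A * g1 (o + b * z))) -
       Cconj k * b * b * (g2 (o + b * z) + Cconj A * h2 (o + b * z)) *
       Cconj (Cconj k * b * (g1 (o + b * z) + Cconj A * h1 (o + b * z))))%C
      with ((k * Cconj k) * (b * b * Cconj b) *
        (RtoC (1 - Cmod A ^ 2) * jacobian_dz h1 h2 g1 g2 (o + b * z)))%C.
    + rewrite !Cmod_mult, !Cmod_conj, (Cmod_RtoC_pos (1 - Cmod A ^ 2)), Hb by lra.
      pose proof (Hbd _ (In z Hz)) as B.
      set (Jv := jacobian h1 g1 (o + b * z)) in *.
      set (kk := Cmod k) in *. set (aa := 1 - Cmod A ^ 2) in *.
      assert (Kp : 0 <= kk * kk * (/ lam * / lam * / lam) * aa).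
      { pose proof (Rinv_0_lt_compat _ Hlam). pose proof (Cmod_ge_0 k : 0 <= kk).
        repeat apply Rmult_le_pos; lra. }
      replace (4 * ((kk * / lam) ^ 2 * aa * Jv))
        with (kk * kk * (/ lam * / lam * / lam) * aa * (4 * lam * Jv)) by (field; lra).
      rewrite <- (Rmult_assoc _ aa). apply Rmult_le_compat_l; assumption.
    + unfold jacobian_dz. rewrite <- affine_jacobian_dz.
      rewrite !(Cmult_conj (_ * _)), !(Cmult_conj k), !(Cmult_conj (Cconj k)), Cconj_conj. ring.
  - exists (o + b * z)%C, (o + b * w)%C. split; [apply In, Hz|]. split; [apply In, Hw|].
    split.
    + intros E'. apply Hzw.
      replace z with (mu * ((o + b * z) - o))%C by (unfold b; field; exact Nmu).
      rewrite E'. unfold b. field. exact Nmu.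
    + apply (affine_injective A _ _ HA).
      unfold T in E.
      set (z' := (o + b * z)%C) in *. set (w' := (o + b * w)%C) in *.
      assert (X : forall y, (k * (h y + A * g y) + Cconj (Cconj k * (g y + Cconj A * h y)))%C
        = (k * (h y + Cconj (g y) + A * Cconj (h y + Cconj (g y))))%C).
      { intros y. rewrite !Cmult_conj, !Cplus_conj, !Cmult_conj, !Cconj_conj. ring. }
      rewrite !X in E.
      match goal with |- ?l = ?r => replace l with (/ k * (k * l))%C by (field; exact Nk);
        replace r with (/ k * (k * r))%C by (field; exact Nk) end.
      rewrite E. reflexivity.
Qed.

(** Point picking.  Let p be the modulus of the logarithmic derivative of the
    Jacobian and choose o almost maximizing (r / 2 - |z - a|) p z.  On the ball about o of half the
    remaining radius, p is at most 4 p o.  If p a were large against 1 / r, this ball would be large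
    on the scale 1 / p o, and the map would not be injective. *)
Theorem jacobian_pre_schwarzian_bound : exists K, 0 < K /\
  forall (a : C) (r : R) (h h1 h2 g g1 g2 : C -> C), 0 < r ->
  holo a r h h1 -> holo a r h1 h2 -> holo a r g g1 -> holo a r g1 g2 ->
  (forall z, Cmod (z - a) < r -> Cmod (g1 z) < Cmod (h1 z)) ->
  (forall z w, Cmod (z - a) < r -> Cmod (w - a) < r ->
     (h z + Cconj (g z) = h w + Cconj (g w))%C -> z = w) ->
  Cmod (jacobian_dz h1 h2 g1 g2 a) <= K / r * jacobian h1 g1 a.
Proof.
  destruct normalized_not_injective as [L [HL Core]].
  exists (8 * L). split; [lra|].
  intros a r h h1 h2 g g1 g2 Hr Dh Dh1 Dg Dg1 Hlt Inj.
  set (s := r / 2).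
  set (p := fun z => Cmod (jacobian_dz h1 h2 g1 g2 z) / jacobian h1 g1 z).
  assert (Hp0 : forall z, Cmod (z - a) < r -> 0 <= p z).
  { intros z Hz. apply Rdiv_le_0_compat; [apply Cmod_ge_0 | apply jacobian_pos, Hlt, Hz]. }
  destruct (jacobian_ratio_bounded a s r h1 h2 g1 g2) as [M HM]; try assumption; [unfold s; lra|].
  assert (Haa : Cmod (a - a) < s) by (rewrite Cmod_center; unfold s; lra).
  destruct (Rle_lt_dec (p a) (8 * L / r)) as [Hle|Hgt].
  { pose proof (jacobian_pos h1 g1 a (Hlt a ltac:(unfold s in Haa; lra))) as Ja.
    unfold p in Hle. apply (Rmult_le_compat_r (jacobian h1 g1 a)) in Hle; [|lra].
    unfold Rdiv at 1 in Hle. rewrite Rmult_assoc, Rinv_l in Hle by lra. lra. }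
  exfalso.
  set (S := fun x => exists z, Cmod (z - a) < s /\ x = (s - Cmod (z - a)) * p z).
  destruct (completeness S) as [m [Hub Hlub]].
  - exists (s * M). intros x [z [Hz ->]].
    pose proof (HM z ltac:(lra)) as B. fold (p z) in B.
    pose proof (Hp0 z ltac:(unfold s in Hz; lra)). pose proof (Cmod_ge_0 (z - a)). nra.
  - exists ((s - Cmod (a - a)) * p a). exists a. auto.
  - assert (Hm : 4 * L < m).
    { eapply Rlt_le_trans; [|apply Hub; exists a; split; [exact Haa | reflexivity]].
      rewrite Cmod_center, Rminus_0_r.
      replace (4 * L) with (s * (8 * L / r)) by (unfold s; field; lra).
      apply Rmult_lt_compat_l; [unfold s; lra | exact Hgt]. }
    assert (Hex : exists z, Cmod (z - a) < s /\ m / 2 < (s - Cmod (z - a)) * p z).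
    { apply NNPP. intros N. assert (m <= m / 2); [|lra].
      apply Hlub. intros x [z [Hz ->]]. apply Rnot_lt_le. intros H. apply N. exists z. auto. }
    destruct Hex as [o [Ho Hmo]].
    set (d := s - Cmod (o - a)) in *. assert (Hd : 0 < d) by (unfold d; lra).
    assert (Hlam : 0 < p o) by (apply Rnot_le_lt; intros X; nra).
    assert (Hsub : forall z, Cmod (z - o) < d / 2 -> Cmod (z - a) < s - d / 2).
    { intros z Hz. pose proof (Cmod_sub_triangle z o a). unfold d in *. lra. }
    assert (Hs2 : s < r) by (unfold s; lra).
    assert (Hr2 : Cmod (o - a) + d / 2 <= r) by (unfold d; lra).
    destruct (rescaled_not_injective L Core o (d / 2) (p o) h h1 h2 g g1 g2)
      as [z [w [Hz [Hw [Hzw E]]]]].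
    + lra.
    + exact Hlam.
    + lra.
    + apply (holo_sub a o r); assumption.
    + apply (holo_sub a o r); assumption.
    + apply (holo_sub a o r); assumption.
    + apply (holo_sub a o r); assumption.
    + intros z Hz. apply Hlt. pose proof (Hsub z Hz). lra.
    + pose proof (jacobian_pos h1 g1 o (Hlt o ltac:(lra))). unfold p. field. lra.
    + intros z Hz. pose proof (Hsub z Hz) as Hza.
      pose proof (jacobian_pos h1 g1 z (Hlt z ltac:(lra))) as Jz.
      assert (B : (s - Cmod (z - a)) * p z <= m) by (apply Hub; exists z; split; [lra | reflexivity]).
      pose proof (Hp0 z ltac:(lra)) as Pz.
      assert (B2 : p z <= 4 * p o).
      { assert (d / 2 * p z <= m) by nra.
        apply (Rmult_le_reg_l (d / 2)); [lra|]. lra. }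
      replace (Cmod (jacobian_dz h1 h2 g1 g2 z)) with (p z * jacobian h1 g1 z) by (unfold p; field; lra).
      apply Rmult_le_compat_r; lra.
    + apply Hzw, Inj; [pose proof (Hsub z Hz); lra | pose proof (Hsub w Hw); lra | exact E].
Qed.

(** * From the Jacobian to the rotated functions *)

Lemma mobius_lt (z w : C) : Cmod z < 1 -> Cmod w < 1 ->
  Cmod (z - w) < Cmod (1 - Cconj z * w).
Proof.
  intros Hz Hw. pose proof (affine_jacobian (- Cconj z)%C 1 w) as J.
  rewrite Copp_conj, Cconj_conj, Cmod_opp, Cmod_conj, Cmod_1 in J.
  replace (1 + - Cconj z * w)%C with (1 - Cconj z * w)%C in J by ring.
  replace (w + - z * 1)%C with (w - z)%C in J by ring.
  rewrite (Cmod_sub_sym w z) in J.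
  pose proof (Cmod_ge_0 z). pose proof (Cmod_ge_0 w).
  assert (0 < (1 - Cmod z ^ 2) * (1 ^ 2 - Cmod w ^ 2)) by (apply Rmult_lt_0_compat; nra).
  apply Rsqr_incrst_0; try apply Cmod_ge_0. unfold Rsqr. simpl in *. lra.
Qed.

(** The Cauchy estimate applied to w followed by the disk automorphism that sends w a
    to 0.  Only the shape of the inequality matters, not the constant. *)
Lemma schwarz_pick (a : C) (r : R) (w w1 : C -> C) : 0 < r -> holo a r w w1 ->
  (forall z, Cmod (z - a) < r -> Cmod (w z) < 1) ->
  Cmod (w1 a) <= 4 / r * (1 - Cmod (w a) ^ 2).
Proof.
  intros Hr Dw Hw.
  assert (Haa : Cmod (a - a) < r) by (rewrite Cmod_center; exact Hr).
  set (c := w a). pose proof (Hw a Haa) as Hc. fold c in Hc. pose proof (Cmod_ge_0 c) as Hc0.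
  assert (Q : forall z, Cmod (z - a) < r -> Cmod (w z - c) < Cmod (1 - Cconj c * w z)).
  { intros z Hz. rewrite Cmod_sub_sym. apply mobius_lt; [exact Hc | apply Hw, Hz]. }
  assert (N : forall z, Cmod (z - a) < r -> (1 - Cconj c * w z)%C <> 0).
  { intros z Hz. apply Cmod_gt_0. pose proof (Q z Hz). pose proof (Cmod_ge_0 (w z - c)). lra. }
  set (phi := fun z => ((w z - c) / (1 - Cconj c * w z))%C).
  set (phi1 := fun z => ((w1 z * (1 - Cconj c * w z) - (w z - c) * (0 - Cconj c * w1 z))
     / ((1 - Cconj c * w z) * (1 - Cconj c * w z)))%C).
  assert (D : holo a r phi phi1).
  { intros z Hz. apply (cderiv_div (fun z => w z - c)%C (fun z => 1 - Cconj c * w z)%C).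
    - apply (cderiv_eq _ _ (w1 z - 0)%C); [ring|].
      apply (cderiv_minus w (fun _ => c)); [apply Dw, Hz | apply cderiv_const].
    - apply (cderiv_minus (fun _ => RtoC 1) (fun z => Cconj c * w z)%C);
        [apply cderiv_const | apply cderiv_scal, Dw, Hz].
    - apply N, Hz. }
  pose proof (cauchy_estimate a r 1 phi phi1 Hr D) as E.
  specialize (E ltac:(intros z Hz; left; apply Cmod_div_lt_1, Q, Hz)).
  pose proof (N a Haa) as Na. fold c in Na.
  assert (E1 : phi1 a = (w1 a / (1 - Cconj c * c))%C).
  { unfold phi1. fold c. field. exact Na. }
  assert (Ec : (1 - Cconj c * c)%C = RtoC (1 - Cmod c ^ 2)).
  { rewrite RtoC_minus, Cmod_sq. ring. }
  rewrite E1, Cmod_div in E by exact Na. rewrite Ec, Cmod_RtoC_pos in E by nra.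
  apply (Rmult_le_compat_r (1 - Cmod c ^ 2)) in E; [|nra].
  unfold Rdiv at 1 in E. rewrite Rmult_assoc, Rinv_l in E by nra. rewrite Rmult_1_r in E.
  eapply Rle_trans; [exact E|]. apply Req_le. field. lra.
Qed.

Lemma Cmod_unit_swap (e w : C) : Cmod e = 1 -> Cmod (e + Cconj w) = Cmod (1 + e * w).
Proof.
  intros He.
  assert (E : (e * Cconj e = 1)%C) by (rewrite <- Cmod_sq, He; f_equal; ring).
  replace (1 + e * w)%C with (e * (Cconj e + w))%C by (rewrite <- E; ring).
  rewrite Cmod_mult, He, <- (Cmod_conj (Cconj e + w)), Cplus_conj, Cconj_conj. ring.
Qed.

(** The pre-Schwarzian of h + e g differs from the logarithmic derivative of the
    Jacobian by w' (e + conj w) / ((1 + e w) (1 - |w|^2)); here denominators are cleared. *)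
Lemma rotated_from_jacobian (a2 a1 b2 b1 e : C) : a1 <> 0 -> Cmod b1 < Cmod a1 ->
  let w := (b1 / a1)%C in let w1 := ((b2 * a1 - b1 * a2) / (a1 * a1))%C in
  ((a2 + e * b2) * RtoC (Cmod a1 ^ 2 - Cmod b1 ^ 2)
    = (a2 * Cconj a1 - b2 * Cconj b1) * (a1 + e * b1)
      + w1 * a1 * (e + Cconj w) * RtoC (Cmod a1 ^ 2))%C.
Proof.
  intros Ha Hlt w w1. rewrite RtoC_minus, !Cmod_sq.
  assert (E1 : b1 = (w * a1)%C) by (unfold w; field; exact Ha).
  assert (E2 : b2 = (w1 * a1 + w * a2)%C) by (unfold w, w1; field; exact Ha).
  clearbody w w1. subst b1 b2. rewrite !Cmult_conj. ring.
Qed.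

(** For a unit number e the factors |e + conj w| and |1 + e w| agree, so the correction
    term is |w'| / (1 - |w|^2), which Schwarz-Pick bounds by a constant over r. *)
Theorem rotated_bound_of_lt : exists K, 0 < K /\
  forall (a : C) (r : R) (h h1 h2 g g1 g2 : C -> C) (e : C), 0 < r -> Cmod e = 1 ->
  holo a r h h1 -> holo a r h1 h2 -> holo a r g g1 -> holo a r g1 g2 ->
  (forall z, Cmod (z - a) < r -> Cmod (g1 z) < Cmod (h1 z)) ->
  (forall z w, Cmod (z - a) < r -> Cmod (w - a) < r ->
     (h z + Cconj (g z) = h w + Cconj (g w))%C -> z = w) ->
  Cmod (h2 a + e * g2 a) <= K / r * Cmod (h1 a + e * g1 a).
Proof.
  destruct jacobian_pre_schwarzian_bound as [K [HK B]].
  exists (K + 4). split; [lra|].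
  intros a r h h1 h2 g g1 g2 e Hr He Dh Dh1 Dg Dg1 Hlt Inj.
  specialize (B a r h h1 h2 g g1 g2 Hr Dh Dh1 Dg Dg1 Hlt Inj).
  assert (Haa : Cmod (a - a) < r) by (rewrite Cmod_center; exact Hr).
  assert (Hnz : forall z, Cmod (z - a) < r -> h1 z <> 0).
  { intros z Hz. apply Cmod_gt_0. pose proof (Hlt z Hz). pose proof (Cmod_ge_0 (g1 z)). lra. }
  pose proof (Hnz a Haa) as N. pose proof (proj1 (Cmod_gt_0 _) N) as Np.
  set (om := dilatation h1 g1). set (om' := dilatation_deriv h1 h2 g1 g2).
  assert (SP : Cmod (om' a) <= 4 / r * (1 - Cmod (om a) ^ 2)).
  { apply (schwarz_pick a r om om' Hr).
    - apply dilatation_holo; assumption.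
    - intros z Hz. apply Cmod_div_lt_1, Hlt, Hz. }
  pose proof (rotated_from_jacobian (h2 a) (h1 a) (g2 a) (g1 a) e N (Hlt a Haa)) as E.
  cbv zeta in E. change (g1 a / h1 a)%C with (om a) in E.
  change ((g2 a * h1 a - g1 a * h2 a) / (h1 a * h1 a))%C with (om' a) in E.
  change (Cmod (h1 a) ^ 2 - Cmod (g1 a) ^ 2) with (jacobian h1 g1 a) in E.
  change (h2 a * Cconj (h1 a) - g2 a * Cconj (g1 a))%C with (jacobian_dz h1 h2 g1 g2 a) in E.
  pose proof (jacobian_pos h1 g1 a (Hlt a Haa)) as J.
  assert (J' : jacobian h1 g1 a = Cmod (h1 a) ^ 2 * (1 - Cmod (om a) ^ 2)).
  { unfold jacobian, om, dilatation. rewrite Cmod_div by exact N. field. lra. }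
  set (X := Cmod (h1 a + e * g1 a)).
  assert (EX : Cmod (h1 a) * Cmod (e + Cconj (om a)) = X).
  { rewrite (Cmod_unit_swap _ _ He), <- Cmod_mult. unfold X. f_equal.
    unfold om, dilatation. field. exact N. }
  apply (Rmult_le_reg_r (jacobian h1 g1 a)); [exact J|].
  rewrite <- (Cmod_RtoC_pos (jacobian h1 g1 a)) at 1 by lra. rewrite <- Cmod_mult, E.
  eapply Rle_trans; [apply Cmod_triangle|]. rewrite !Cmod_mult.
  rewrite (Cmod_RtoC_pos (Cmod (h1 a) ^ 2)) by apply pow2_ge_0. fold X.
  assert (T1 : Cmod (jacobian_dz h1 h2 g1 g2 a) * X <= K / r * jacobian h1 g1 a * X)
    by (apply Rmult_le_compat_r; [apply Cmod_ge_0 | exact B]).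
  assert (T2 : Cmod (om' a) * Cmod (h1 a) * Cmod (e + Cconj (om a)) * Cmod (h1 a) ^ 2
     <= 4 / r * jacobian h1 g1 a * X).
  { rewrite (Rmult_assoc (Cmod (om' a))), EX, J'.
    replace (4 / r * (Cmod (h1 a) ^ 2 * (1 - Cmod (om a) ^ 2)) * X)
      with (4 / r * (1 - Cmod (om a) ^ 2) * (X * Cmod (h1 a) ^ 2)) by ring.
    rewrite Rmult_assoc. apply Rmult_le_compat_r; [|exact SP].
    apply Rmult_le_pos; [apply Cmod_ge_0 | apply pow2_ge_0]. }
  replace ((K + 4) / r * X * jacobian h1 g1 a)
    with (K / r * jacobian h1 g1 a * X + 4 / r * jacobian h1 g1 a * X) by (field; lra).
  lra.
Qed.

(** * Three arcs of a level set *)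

Lemma unit_expi (e : C) : Cmod e = 1 -> exists t, 0 <= t <= 2 * PI /\ e = expi t.
Proof.
  intros He. destruct e as [x y].
  assert (E : x * x + y * y = 1).
  { pose proof (Cmod2_alt (x, y)) as A. rewrite He in A. simpl in A. lra. }
  assert (Hx : -1 <= x <= 1) by nra.
  pose proof (acos_bound x) as [A1 A2].
  assert (S : sin (acos x) = Rabs y).
  { rewrite sin_acos by lra. rewrite <- sqrt_Rsqr_abs. f_equal. unfold Rsqr. lra. }
  destruct (Rle_lt_dec 0 y) as [Hy|Hy].
  - exists (acos x). split; [lra|]. unfold expi.
    rewrite cos_acos, S, Rabs_pos_eq by lra. reflexivity.
  - exists (2 * PI - acos x). split; [lra|]. unfold expi.
    replace (2 * PI - acos x) with (- acos x + 2 * INR 1 * PI) by (simpl; ring).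
    rewrite cos_period, sin_period, cos_neg, sin_neg, cos_acos, S, Rabs_left by lra.
    f_equal. ring.
Qed.

Lemma expi_pow (t : R) (n : nat) : (expi t ^ n = expi (INR n * t))%C.
Proof.
  induction n as [|n IH].
  - simpl. unfold expi. rewrite Rmult_0_l, cos_0, sin_0. reflexivity.
  - rewrite Cpow_S, IH, S_INR, <- expi_plus. f_equal. ring.
Qed.

Lemma ivt_common (V1 V2 : R -> R) (v0 s0 : R) : 0 < s0 ->
  (forall s, 0 <= s <= s0 -> continuity_pt V1 s) ->
  (forall s, 0 <= s <= s0 -> continuity_pt V2 s) ->
  V1 0 = v0 -> V2 0 = v0 -> v0 < V1 s0 -> v0 < V2 s0 ->
  exists s s', 0 < s <= s0 /\ 0 < s' <= s0 /\ V1 s = V2 s'.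
Proof.
  intros Hs.
  assert (G : forall W1 W2 : R -> R,
    (forall s, 0 <= s <= s0 -> continuity_pt W2 s) ->
    W2 0 = v0 -> v0 < W1 s0 -> W1 s0 <= W2 s0 ->
    exists s', 0 < s' <= s0 /\ W1 s0 = W2 s').
  { intros W1 W2 C2 E2 L1 L2.
    destruct (Req_dec (W1 s0) (W2 s0)) as [E|N]; [exists s0; split; [lra | exact E]|].
    destruct (IVT_interv (fun s => W2 s - W1 s0) 0 s0) as [t [Ht Et]].
    - intros s Hs'. apply continuity_pt_minus; [apply C2, Hs'|].
      apply continuity_pt_const. intros x y. reflexivity.
    - exact Hs.
    - rewrite E2. lra.
    - lra.
    - exists t. split; [|lra]. split; [|apply Ht].
      destruct (Rle_lt_or_eq_dec 0 t (proj1 Ht)) as [|<-]; [assumption|].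
      rewrite E2 in Et. lra. }
  intros C1 C2 E1 E2 L1 L2.
  destruct (Rle_lt_dec (V1 s0) (V2 s0)) as [L|L].
  - destruct (G V1 V2 C2 E2 L1 L) as [s' [Hs' E]]. exists s0, s'. repeat split; try lra.
  - destruct (G V2 V1 C1 E1 L2 (Rlt_le _ _ L)) as [s' [Hs' E]].
    exists s', s0. repeat split; try lra.
Qed.

Lemma ivt_same_side (V1 V2 : R -> R) (v0 s0 : R) : 0 < s0 ->
  (forall s, 0 <= s <= s0 -> continuity_pt V1 s) ->
  (forall s, 0 <= s <= s0 -> continuity_pt V2 s) ->
  V1 0 = v0 -> V2 0 = v0 -> 0 < (V1 s0 - v0) * (V2 s0 - v0) ->
  exists s s', 0 < s <= s0 /\ 0 < s' <= s0 /\ V1 s = V2 s'.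
Proof.
  intros Hs C1 C2 E1 E2 Hpos.
  destruct (Rlt_le_dec v0 (V1 s0)) as [L|L].
  - apply (ivt_common V1 V2 v0); try assumption. nra.
  - destruct (ivt_common (fun s => - V1 s) (fun s => - V2 s) (- v0) s0)
      as [s [s' [H1 [H2 E]]]]; try assumption.
    + intros s H. apply continuity_pt_opp, C1, H.
    + intros s H. apply continuity_pt_opp, C2, H.
    + lra.
    + lra.
    + destruct (Req_dec (V1 s0) v0) as [X|X]; [rewrite X in Hpos|]; lra.
    + nra.
    + exists s, s'. repeat split; try lra.
Qed.

(** Of three arcs out of one point two end on the same side of v0, and the intermediate
    value theorem gives them a common value. *)
Lemma no_tripod (V1 V2 V3 : R -> R) (v0 s0 : R) : 0 < s0 ->
  (forall s, 0 <= s <= s0 -> continuity_pt V1 s) ->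
  (forall s, 0 <= s <= s0 -> continuity_pt V2 s) ->
  (forall s, 0 <= s <= s0 -> continuity_pt V3 s) ->
  V1 0 = v0 -> V2 0 = v0 -> V3 0 = v0 ->
  V1 s0 <> v0 -> V2 s0 <> v0 -> V3 s0 <> v0 ->
  exists s s', 0 < s <= s0 /\ 0 < s' <= s0 /\
    (V1 s = V2 s' \/ V1 s = V3 s' \/ V2 s = V3 s').
Proof.
  intros Hs C1 C2 C3 E1 E2 E3 N1 N2 N3.
  destruct (Rlt_le_dec 0 ((V1 s0 - v0) * (V2 s0 - v0))) as [P|P].
  { destruct (ivt_same_side V1 V2 v0 s0) as [s [s' [A [B D]]]]; try assumption.
    exists s, s'. auto. }
  destruct (Rlt_le_dec 0 ((V1 s0 - v0) * (V3 s0 - v0))) as [Q|Q].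
  { destruct (ivt_same_side V1 V3 v0 s0) as [s [s' [A [B D]]]]; try assumption.
    exists s, s'. auto. }
  destruct (Rlt_le_dec 0 ((V2 s0 - v0) * (V3 s0 - v0))) as [T|T].
  { destruct (ivt_same_side V2 V3 v0 s0) as [s [s' [A [B D]]]]; try assumption.
    exists s, s'. auto. }
  exfalso.
  assert (X1 : V1 s0 - v0 <> 0) by lra. assert (X2 : V2 s0 - v0 <> 0) by lra.
  assert (X3 : V3 s0 - v0 <> 0) by lra.
  destruct (Rdichotomy _ _ X1), (Rdichotomy _ _ X2), (Rdichotomy _ _ X3); nra.
Qed.

(** The point s (1 + i y); for small y it stays near the positive axis, and curves of this
    form avoid polar coordinates. *)
Definition near_ray (y s : R) : C := (RtoC s * (1 + Ci * RtoC y))%C.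

(** Comparing components of q s (1 + i y) = s' (1 + i y') would force q to be
    within order d of 1. *)
Lemma rays_disjoint (q : C) : Cmod q = 1 -> q <> 1 -> exists d, 0 < d /\
  forall s s' y y', 0 < s -> 0 < s' -> Rabs y <= d -> Rabs y' <= d ->
    (q * near_ray y s)%C <> near_ray y' s'.
Proof.
  intros Hq Hq1. destruct q as [u v].
  assert (E : u * u + v * v = 1).
  { pose proof (Cmod2_alt (u, v)) as A. rewrite Hq in A. simpl in A. lra. }
  destruct (Req_dec v 0) as [->|Hv].
  - exists 1. split; [lra|]. intros s s' y y' Hs Hs' _ _ X.
    assert (Hu : u = -1).
    { assert ((u - 1) * (u + 1) = 0) as F by lra.
      apply Rmult_integral in F. destruct F as [F|F]; [|lra].
      exfalso. apply Hq1. replace u with 1 by lra. reflexivity. }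
    apply (f_equal fst) in X. unfold near_ray in X. simpl in X. subst u. lra.
  - pose proof (Rabs_pos_lt v Hv) as Hv'.
    exists (Rmin 1 (Rabs v / 4)). split; [apply Rmin_pos; lra|].
    intros s s' y y' Hs Hs' Hy Hy' X.
    pose proof (Rmin_l 1 (Rabs v / 4)) as M1. pose proof (Rmin_r 1 (Rabs v / 4)) as M2.
    set (d := Rmin 1 (Rabs v / 4)) in *.
    pose proof (f_equal fst X) as X1. pose proof (f_equal snd X) as X2.
    unfold near_ray in X1, X2. simpl in X1, X2.
    assert (Y1 : s * (u - v * y) = s') by lra.
    assert (Y2 : s * (v + u * y) = s' * y') by lra.
    assert (Y3 : v + u * y = (u - v * y) * y').
    { apply (Rmult_eq_reg_l s); [|lra]. rewrite Y2, <- Y1. ring. }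
    assert (Hu : Rabs u <= 1) by (apply Rabs_le; nra).
    assert (Hv1 : Rabs v <= 1) by (apply Rabs_le; nra).
    assert (B : Rabs v <= 3 * d).
    { replace v with (u * (y' - y) - v * (y * y')) by lra.
      assert (A1 : Rabs (u * (y' - y)) <= 1 * (2 * d)).
      { rewrite Rabs_mult. apply Rmult_le_compat; try apply Rabs_pos; [exact Hu|].
        pose proof (Rabs_triang y' (- y)) as T. rewrite Rabs_Ropp in T.
        unfold Rminus. lra. }
      assert (A2 : Rabs (v * (y * y')) <= 1 * (d * 1)).
      { rewrite !Rabs_mult. apply Rmult_le_compat; try apply Rabs_pos; [| exact Hv1 |].
        - apply Rmult_le_pos; apply Rabs_pos.
        - apply Rmult_le_compat; try apply Rabs_pos; lra. }
      pose proof (Rabs_triang (u * (y' - y)) (- (v * (y * y')))) as T.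
      rewrite Rabs_Ropp in T. unfold Rminus in *. lra. }
    lra.
Qed.

(** Arcs of the level set of U through a, leaving in the direction sigma and staying in an
    arbitrarily thin sector around it. *)
Definition level_curve (U : C -> R) (a : C) (r : R) (sigma : C) : Prop :=
  forall d, 0 < d -> exists s0 (y : R -> R), 0 < s0 /\
    forall s, 0 <= s <= s0 -> Rabs (y s) <= d /\ continuity_pt y s /\
      Cmod (near_ray (y s) s) < r /\ U (a + sigma * near_ray (y s) s)%C = U a.

Lemma pcont_RtoC (f : R -> R) (t : R) : continuity_pt f t ->
  pcont (fun s => RtoC (f s)) t.
Proof.
  intros H eps Heps. destruct (H eps Heps) as [d [Hd Hd']]. exists d. split; [exact Hd|].
  intros s Hs. rewrite <- RtoC_minus, Cmod_R.
  destruct (Req_dec t s) as [<-|N].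
  - rewrite Rminus_diag, Rabs_R0. exact Heps.
  - apply (Hd' s). split; [split; [exact I | exact N] | exact Hs].
Qed.

Lemma near_ray_pcont (y : R -> R) (t : R) : continuity_pt y t ->
  pcont (fun s => near_ray (y s) s) t.
Proof.
  intros H. unfold near_ray. apply pcont_mult.
  - apply pcont_RtoC. apply continuity_pt_id.
  - apply pcont_plus; [apply pcont_const|]. apply pcont_mult; [apply pcont_const|].
    apply pcont_RtoC, H.
Qed.

Lemma near_ray_0 (y : R) : near_ray y 0 = 0.
Proof. unfold near_ray. ring. Qed.

Lemma near_ray_nz (y s : R) : 0 < s -> near_ray y s <> 0.
Proof.
  intros Hs E. apply (f_equal fst) in E. unfold near_ray in E. simpl in E. lra.
Qed.

(** On a level set of U an injective pair (U, V) reduces to the single continuous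
    function V, which cannot be injective on three arcs with a common end. *)
Lemma tripod_not_injective (U V : C -> R) (a : C) (r : R) (q1 q2 q3 : C) : 0 < r ->
  Cmod q1 = 1 -> Cmod q2 = 1 -> Cmod q3 = 1 -> q1 <> q2 -> q1 <> q3 -> q2 <> q3 ->
  level_curve U a r q1 -> level_curve U a r q2 -> level_curve U a r q3 ->
  (forall z, Cmod (z - a) < r -> ccont (fun w => RtoC (V w)) z) ->
  ~ (forall z w, Cmod (z - a) < r -> Cmod (w - a) < r -> U z = U w -> V z = V w -> z = w).
Proof.
  intros Hr H1 H2 H3 N12 N13 N23 L1 L2 L3 CV Inj.
  assert (Ratio : forall p q, Cmod p = 1 -> Cmod q = 1 -> p <> q -> exists d, 0 < d /\
    forall s s' y y', 0 < s -> 0 < s' -> Rabs y <= d -> Rabs y' <= d ->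
    (a + p * near_ray y s)%C <> (a + q * near_ray y' s')%C).
  { intros p q Hp Hq N.
    assert (Nq : q <> 0) by (apply Cmod_gt_0; lra).
    destruct (rays_disjoint (p / q)) as [d [Hd D]].
    - rewrite Cmod_div, Hp, Hq by exact Nq. field.
    - intros E. apply N. replace p with (p / q * q)%C by (field; exact Nq). rewrite E. ring.
    - exists d. split; [exact Hd|]. intros s s' y y' A1 A2 A3 A4 E.
      apply (D s s' y y' A1 A2 A3 A4).
      assert (E' : (p * near_ray y s = q * near_ray y' s')%C).
      { replace (p * near_ray y s)%C with ((a + p * near_ray y s) - a)%C by ring.
        rewrite E. ring. }
      replace (p / q * near_ray y s)%C with (p * near_ray y s / q)%C by (field; exact Nq).
      rewrite E'. field. exact Nq. }
  destruct (Ratio q1 q2 H1 H2 N12) as [d12 [P12 D12]].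
  destruct (Ratio q1 q3 H1 H3 N13) as [d13 [P13 D13]].
  destruct (Ratio q2 q3 H2 H3 N23) as [d23 [P23 D23]].
  set (d := Rmin d12 (Rmin d13 d23)).
  assert (Hd : 0 < d) by (unfold d; repeat apply Rmin_pos; assumption).
  assert (Ld : d <= d12 /\ d <= d13 /\ d <= d23).
  { unfold d. repeat split.
    - apply Rmin_l.
    - eapply Rle_trans; [apply Rmin_r | apply Rmin_l].
    - eapply Rle_trans; [apply Rmin_r | apply Rmin_r]. }
  destruct (L1 d Hd) as [s1 [y1 [S1 K1]]]. destruct (L2 d Hd) as [s2 [y2 [S2 K2]]].
  destruct (L3 d Hd) as [s3 [y3 [S3 K3]]].
  set (s0 := Rmin s1 (Rmin s2 s3)).
  assert (Hs0 : 0 < s0) by (unfold s0; repeat apply Rmin_pos; assumption).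
  assert (Ls : s0 <= s1 /\ s0 <= s2 /\ s0 <= s3).
  { unfold s0. repeat split.
    - apply Rmin_l.
    - eapply Rle_trans; [apply Rmin_r | apply Rmin_l].
    - eapply Rle_trans; [apply Rmin_r | apply Rmin_r]. }
  clearbody d s0.
  set (c := fun (q : C) (y : R -> R) s => (a + q * near_ray (y s) s)%C).
  assert (c0 : forall q y, c q y 0 = a) by (intros; unfold c; rewrite near_ray_0; ring).
  assert (cin : forall q y s, Cmod q = 1 -> Cmod (near_ray (y s) s) < r ->
    Cmod (c q y s - a) < r).
  { intros q y s Hq Hn. unfold c.
    replace (a + q * near_ray (y s) s - a)%C with (q * near_ray (y s) s)%C by ring.
    rewrite Cmod_mult, Hq. lra. }
  assert (Arc : forall q y si, Cmod q = 1 -> s0 <= si ->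
    (forall s, 0 <= s <= si -> Rabs (y s) <= d /\ continuity_pt y s /\
      Cmod (near_ray (y s) s) < r /\ U (a + q * near_ray (y s) s)%C = U a) ->
    (forall s, 0 <= s <= s0 -> continuity_pt (fun t => V (c q y t)) s) /\
    V (c q y 0) = V a /\ V (c q y s0) <> V a /\
    forall s, 0 < s <= s0 -> Rabs (y s) <= d /\ Cmod (c q y s - a) < r /\ U (c q y s) = U a).
  { intros q y si Hq Hsi K. split; [|split; [rewrite c0; reflexivity|split]].
    - intros s Hs. destruct (K s ltac:(lra)) as [_ [Cy [Hn _]]]. apply continuity_pt_filterlim.
      apply (pcont_fst (fun t => RtoC (V (c q y t)))).
      apply (pcont_ccont (fun w => RtoC (V w)) (c q y)); [apply CV, cin; assumption|].
      unfold c. apply pcont_plus; [apply pcont_const|].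
      apply pcont_mult; [apply pcont_const | apply near_ray_pcont, Cy].
    - intros HV. destruct (K s0 ltac:(lra)) as [_ [_ [Hn HU]]].
      assert (E : c q y s0 = a).
      { apply Inj; [apply cin; assumption | rewrite Cmod_center; exact Hr | exact HU | exact HV]. }
      apply (near_ray_nz (y s0) s0 Hs0). unfold c in E.
      assert (Nq : q <> 0) by (apply Cmod_gt_0; lra).
      replace (near_ray (y s0) s0) with ((a + q * near_ray (y s0) s0 - a) / q)%C
        by (field; exact Nq).
      rewrite E. field. exact Nq.
    - intros s Hs. destruct (K s ltac:(lra)) as [Hy [_ [Hn HU]]].
      repeat split; [exact Hy | apply cin; assumption | exact HU]. }
  destruct (Arc q1 y1 s1 H1 (proj1 Ls) K1) as [A1 [B1 [C1 I1]]].
  destruct (Arc q2 y2 s2 H2 (proj1 (proj2 Ls)) K2) as [A2 [B2 [C2 I2]]].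
  destruct (Arc q3 y3 s3 H3 (proj2 (proj2 Ls)) K3) as [A3 [B3 [C3 I3]]].
  destruct (no_tripod _ _ _ (V a) s0 Hs0 A1 A2 A3 B1 B2 B3 C1 C2 C3) as [s [s' [Hs [Hs' E]]]].
  destruct (I1 s Hs) as [a1 [b1 e1]], (I2 s Hs) as [a2 [b2 e2]],
    (I2 s' Hs') as [a2' [b2' e2']], (I3 s' Hs') as [a3 [b3 e3]].
  destruct E as [E|[E|E]].
  - apply (D12 s s' (y1 s) (y2 s')); try lra. apply Inj; try assumption. exact (eq_trans e1 (eq_sym e2')).
  - apply (D13 s s' (y1 s) (y3 s')); try lra. apply Inj; try assumption. exact (eq_trans e1 (eq_sym e3)).
  - apply (D23 s s' (y2 s) (y3 s')); try lra. apply Inj; try assumption. exact (eq_trans e2 (eq_sym e3)).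
Qed.

(** * Lewy's theorem *)

(** The slope of b is at least m - 1/2 >= 1/2, which outweighs b 0 at both ends of the
    interval. *)
Lemma lipschitz_ivt (b : R -> R) (eta m : R) : 0 < eta -> 1 <= m ->
  (forall y y', Rabs y <= eta -> Rabs y' <= eta ->
     Rabs (b y - b y' - m * (y - y')) <= / 2 * Rabs (y - y')) ->
  Rabs (b 0) < eta / 2 -> exists y, Rabs y <= eta /\ b y = 0.
Proof.
  intros He Hm H H0.
  assert (Hin : forall y, - eta <= y <= eta -> Rabs y <= eta) by (intros; apply Rabs_le; lra).
  apply Rabs_def2 in H0.
  assert (Hp : 0 < b eta).
  { pose proof (H eta 0 ltac:(apply Hin; lra) ltac:(apply Hin; lra)) as A.
    rewrite Rminus_0_r, (Rabs_pos_eq eta) in A by lra. apply Rabs_le_between in A. nra. }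
  assert (Hn : b (- eta) < 0).
  { pose proof (H (- eta) 0 ltac:(apply Hin; lra) ltac:(apply Hin; lra)) as A.
    rewrite Rminus_0_r, Rabs_Ropp, (Rabs_pos_eq eta) in A by lra.
    apply Rabs_le_between in A. nra. }
  (* b is only controlled on an interval, so it is extended by constants *)
  set (cl := fun y => Rmax (- eta) (Rmin eta y)).
  assert (Hcl : forall y, - eta <= cl y <= eta).
  { intros y. unfold cl. split; [apply Rmax_l|]. apply Rmax_lub; [lra | apply Rmin_l]. }
  assert (Ecl : forall y, - eta <= y <= eta -> cl y = y).
  { intros y Hy. unfold cl. rewrite Rmin_right, Rmax_right by lra. reflexivity. }
  assert (Lcl : forall y y', Rabs (cl y - cl y') <= Rabs (y - y')).
  { intros y y'. unfold cl, Rmax, Rmin.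
    repeat destruct Rle_dec; unfold Rabs; repeat destruct Rcase_abs; lra. }
  destruct (IVT_interv (fun y => b (cl y)) (- eta) eta) as [y [Hy E]].
  - intros y _ eps Heps. exists (eps / (m + 1)). split; [apply Rdiv_lt_0_compat; lra|].
    intros y' [_ Hy']. simpl in *. unfold Rdist in *.
    pose proof (H (cl y') (cl y) (Hin _ (Hcl _)) (Hin _ (Hcl _))) as A.
    pose proof (Lcl y' y) as B.
    replace (b (cl y') - b (cl y))
      with ((b (cl y') - b (cl y) - m * (cl y' - cl y)) + m * (cl y' - cl y)) by ring.
    eapply Rle_lt_trans; [apply Rabs_triang|]. rewrite Rabs_mult, (Rabs_pos_eq m) by lra.
    apply (Rmult_lt_compat_r (m + 1)) in Hy'; [|lra].
    unfold Rdiv in Hy'. rewrite Rmult_assoc, Rinv_l in Hy' by lra.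
    pose proof (Rabs_pos (cl y' - cl y)). nra.
  - lra.
  - rewrite Ecl by lra. exact Hn.
  - rewrite Ecl by lra. exact Hp.
  - exists y. rewrite Ecl in E by exact Hy. auto.
Qed.

(** On near_ray y s the function z^m k(z) equals s^m times (1 + i y)^m k(s (1 + i y)).
    For small s the derivative of the second factor in 1 + i y is close to m, so its imaginary part
    increases in y with slope at least m - 1/2; this gives existence, uniqueness and continuous
    dependence on s of the zero. *)
Lemma zero_curve (m : nat) (k k1 : C -> C) (r d : R) : (1 <= m)%nat -> 0 < r -> 0 < d ->
  holo 0 r k k1 -> k 0 = 1 ->
  exists s0 (y : R -> R), 0 < s0 /\ forall s, 0 <= s <= s0 ->
    Rabs (y s) <= d /\ continuity_pt y s /\ Cmod (near_ray (y s) s) < r /\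
    snd ((1 + Ci * RtoC (y s)) ^ m * k (near_ray (y s) s))%C = 0.
Proof.
  intros Hm Hr Hd Dk Hk0. destruct m as [|m]; [lia|]. clear Hm.
  set (M := INR (S m)). assert (HM : 1 <= M).
  { unfold M. rewrite S_INR. pose proof (pos_INR m). lra. }
  pose proof (holo_derivative 0 r k k1 Dk) as Dk1.
  assert (H00 : Cmod (0 - 0) < r) by (rewrite Cmod_center; exact Hr).
  (* the derivative of z^m k(s z) in z is z^(m-1) q(s z) *)
  set (q := fun z => (RtoC M * k z + z * k1 z)%C).
  assert (Cq : ccont q 0).
  { eapply cderiv_ccont, (cderiv_plus (fun z => RtoC M * k z)%C (fun z => z * k1 z)%C).
    - apply cderiv_scal, Dk, H00.
    - apply (cderiv_mult (fun z => z) k1); [apply cderiv_id | apply Dk1, H00]. }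
  assert (q0 : q 0 = RtoC M) by (unfold q; rewrite Hk0; ring).
  destruct (Cq (/ 4)) as [r1 [Hr1 Bq]]; [lra|]. rewrite q0 in Bq.
  assert (Cp : ccont (fun z => z ^ m)%C 1).
  { destruct m as [|n].
    - apply cderiv_ccont with (RtoC 0). exact (cderiv_const 1 _).
    - eapply cderiv_ccont, (cderiv_pow (fun z => z)), cderiv_id. }
  destruct (Cp (/ (4 * (M + 1)))) as [d1 [Hd1 Bp]]; [apply Rinv_0_lt_compat; lra|].
  rewrite Cpow_1_l in Bp.
  set (rho := Rmin r r1). assert (Hrho : 0 < rho) by (unfold rho; apply Rmin_pos; assumption).
  assert (Hrr : rho <= r) by apply Rmin_l. assert (Hrr1 : rho <= r1) by apply Rmin_r.
  set (dl := Rmin d1 (Rmin d 1)).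
  assert (Hdl : 0 < dl) by (unfold dl; repeat apply Rmin_pos; lra).
  assert (Hdl1 : dl <= d1) by apply Rmin_l.
  assert (Hdl2 : dl <= d) by (eapply Rle_trans; [apply Rmin_r | apply Rmin_l]).
  assert (Hdl3 : dl <= 1) by (eapply Rle_trans; [apply Rmin_r | apply Rmin_r]).
  clearbody rho dl.
  set (eta := dl / 2). assert (Heta : 0 < eta) by (unfold eta; lra).
  destruct (holo_ccont 0 r k k1 0 Dk H00 (eta / 2)) as [r2 [Hr2 Bk]]; [lra|]. rewrite Hk0 in Bk.
  set (S0 := Rmin (rho / 2) r2). assert (HS0 : 0 < S0) by (unfold S0; apply Rmin_pos; lra).
  assert (HSr : S0 <= rho / 2) by apply Rmin_l. assert (HS2 : S0 <= r2) by apply Rmin_r.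
  clearbody S0.
  set (B := fun (s : R) (z : C) => (z ^ S m * k (0 + RtoC s * z))%C).
  assert (In : forall s z, Rabs s < S0 -> Cmod (z - 1) < dl -> Cmod (RtoC s * z) < rho).
  { intros s z Hs Hz. rewrite Cmod_mult, Cmod_R.
    pose proof (Cmod_triangle (z - 1) 1) as T. replace (z - 1 + 1)%C with z in T by ring.
    rewrite Cmod_1 in T. pose proof (Rabs_pos s). pose proof (Cmod_ge_0 z). nra. }
  assert (BL : forall s, Rabs s < S0 -> forall z w, Cmod (z - 1) < dl -> Cmod (w - 1) < dl ->
    Cmod (B s z - B s w - RtoC M * (z - w)) <= / 2 * Cmod (z - w)).
  { intros s Hs z w Hz Hw.
    replace (B s z - B s w - RtoC M * (z - w))%C
      with ((B s z - RtoC M * z) - (B s w - RtoC M * w))%C by ring.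
    apply (mean_value_ball 1 dl (fun u => B s u - RtoC M * u)%C
      (fun u => u ^ m * q (RtoC s * u) - RtoC M)%C); try assumption.
    - intros u Hu. pose proof (In s u Hs Hu) as Hsu.
      apply (cderiv_eq _ _ ((RtoC (INR (S m)) * u ^ m * 1 * k (0 + RtoC s * u)
        + u ^ S m * (RtoC s * k1 (0 + RtoC s * u))) - RtoC M * 1)%C).
      + unfold q, M. rewrite Cpow_S. replace (0 + s * u)%C with (s * u)%C by ring. ring.
      + apply (cderiv_minus (B s) (fun u => RtoC M * u)%C);
          [|apply (cderiv_scal (RtoC M) (fun u => u)), cderiv_id].
        apply (cderiv_mult (fun u => u ^ S m)%C (fun u => k (0 + RtoC s * u))%C).
        * apply (cderiv_pow (fun u => u)), cderiv_id.
        * apply cderiv_affine, Dk. replace (0 + s * u - 0)%C with (s * u)%C by ring. lra.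
    - intros u Hu. pose proof (In s u Hs Hu) as Hsu.
      pose proof (Bq (s * u)%C ltac:(rewrite sub_0_r; lra)) as Q.
      pose proof (Bp u ltac:(lra)) as P.
      replace (u ^ m * q (s * u) - RtoC M)%C
        with ((u ^ m - 1) * q (s * u) + (q (s * u) - RtoC M))%C by ring.
      eapply Rle_trans; [apply Cmod_triangle|]. rewrite Cmod_mult.
      pose proof (Cmod_reverse_triangle (q (s * u)%C) (RtoC M)) as T.
      rewrite (Cmod_RtoC_pos M) in T by lra.
      assert (A : Cmod (u ^ m - 1) * Cmod (q (s * u)%C) <= / (4 * (M + 1)) * (M + 1)).
      { apply Rmult_le_compat; try apply Cmod_ge_0; lra. }
      replace (/ (4 * (M + 1)) * (M + 1)) with (/ 4) in A by (field; lra). lra. }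
  set (pt := fun y : R => (1 + Ci * RtoC y)%C).
  assert (Hpt : forall y, Rabs y <= eta -> Cmod (pt y - 1) < dl).
  { intros y Hy. unfold pt. replace (1 + Ci * y - 1)%C with (Ci * y)%C by ring.
    rewrite Cmod_mult, Cmod_Ci, Cmod_R. unfold eta in Hy. lra. }
  set (b := fun s y => snd (B s (pt y))).
  assert (bL : forall s, Rabs s < S0 -> forall y y', Rabs y <= eta -> Rabs y' <= eta ->
    Rabs (b s y - b s y' - M * (y - y')) <= / 2 * Rabs (y - y')).
  { intros s Hs y y' Hy Hy'.
    pose proof (BL s Hs _ _ (Hpt y Hy) (Hpt y' Hy')) as A.
    replace (pt y - pt y')%C with (Ci * RtoC (y - y'))%C in A
      by (unfold pt; rewrite RtoC_minus; ring).
    rewrite (Cmod_mult Ci), Cmod_Ci, Cmod_R, Rmult_1_l in A.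
    eapply Rle_trans; [|exact A]. eapply Rle_trans; [|apply im_le_Cmod].
    apply Req_le. f_equal. unfold b. simpl. ring. }
  assert (Root : forall s, exists y, Rabs s < S0 -> Rabs y <= eta /\ b s y = 0).
  { intros s. destruct (Rlt_le_dec (Rabs s) S0) as [Hs|Hs]; [|exists 0; lra].
    destruct (lipschitz_ivt (b s) eta M Heta HM (bL s Hs)) as [y Hy].
    - unfold b, B, pt. replace (1 + Ci * 0)%C with (RtoC 1) by ring.
      rewrite Cpow_1_l. replace (0 + s * 1)%C with (RtoC s) by ring.
      replace (1 * k s)%C with (k s) by ring.
      assert (Hk : Cmod (k s - 1) < eta / 2).
      { apply Bk. rewrite sub_0_r, Cmod_R. lra. }
      eapply Rle_lt_trans; [|exact Hk]. eapply Rle_trans; [|apply im_le_Cmod].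
      apply Req_le. f_equal. simpl. ring.
    - exists y. intros _. exact Hy. }
  set (y := fun s => proj1_sig (constructive_indefinite_description _ (Root s))).
  assert (Hy : forall s, Rabs s < S0 -> Rabs (y s) <= eta /\ b s (y s) = 0)
    by (intros s; apply (proj2_sig (constructive_indefinite_description _ (Root s)))).
  clearbody y.
  exists (S0 / 2), y. split; [lra|]. intros s Hs.
  assert (HsS : Rabs s < S0) by (apply Rabs_lt_between; lra).
  destruct (Hy s HsS) as [Y1 Y2].
  assert (Enr : near_ray (y s) s = (RtoC s * pt (y s))%C) by reflexivity.
  pose proof (In s _ HsS (Hpt _ Y1)) as Hin.
  split; [unfold eta in Y1; lra|]. split; [|split].
  - (* the slope of b t at least 1/2 turns smallness of b t (y s) into smallness of y t - y s *)
    assert (Cb : pcont (fun t => B t (pt (y s))) s).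
    { unfold B. apply pcont_mult; [apply pcont_const|].
      apply (pcont_line k 0 (pt (y s)) s). eapply holo_ccont; [exact Dk|].
      replace (0 + s * pt (y s) - 0)%C with (s * pt (y s))%C by ring. lra. }
    intros eps Heps.
    destruct (Cb (eps / 2)) as [e [He Be]]; [lra|].
    exists (Rmin e (S0 - Rabs s)). split; [apply Rmin_pos; lra|].
    intros t [_ Ht]. simpl in *. unfold Rdist in *.
    assert (Ht1 : Rabs (t - s) < e) by (eapply Rlt_le_trans; [exact Ht | apply Rmin_l]).
    assert (Ht2 : Rabs t < S0).
    { assert (Rabs (t - s) < S0 - Rabs s) by (eapply Rlt_le_trans; [exact Ht | apply Rmin_r]).
      pose proof (Rabs_triang (t - s) s) as T. replace (t - s + s) with t in T by ring. lra. }
    destruct (Hy t Ht2) as [T1 T2].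
    pose proof (bL t Ht2 (y t) (y s) T1 Y1) as L. rewrite T2 in L.
    assert (Bs : Rabs (b t (y s)) < eps / 2).
    { eapply Rle_lt_trans; [|apply (Be t Ht1)]. eapply Rle_trans; [|apply im_le_Cmod].
      apply Req_le. f_equal. change (b t (y s) = b t (y s) + - b s (y s)).
      rewrite Y2. ring. }
    set (x := y t - y s) in *.
    pose proof (Rabs_triang (- (0 - b t (y s) - M * x)) (- b t (y s))) as T.
    replace (- (0 - b t (y s) - M * x) + - b t (y s)) with (M * x) in T by ring.
    rewrite !Rabs_Ropp, Rabs_mult, (Rabs_pos_eq M) in T by lra.
    pose proof (Rabs_pos x). nra.
  - rewrite Enr. lra.
  - rewrite Enr. unfold b, B in Y2. replace (0 + s * pt (y s))%C with (s * pt (y s))%C in Y2 by ring.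
    exact Y2.
Qed.

Lemma expi_neg_mul (t : R) : (Cconj (expi t) * expi t = 1)%C.
Proof.
  rewrite Cmult_comm, <- Cmod_sq, Cmod_expi. f_equal. ring.
Qed.

Lemma expi_sub_ne (s t : R) : 0 < t - s <= PI -> expi s <> expi t.
Proof.
  intros H E.
  assert (X : expi (t - s) = 1).
  { replace (expi (t - s)) with (expi (t - s) * (Cconj (expi s) * expi s))%C
      by (rewrite expi_neg_mul; ring).
    replace (expi (t - s) * (Cconj (expi s) * expi s))%C
      with (Cconj (expi s) * (expi (t - s) * expi s))%C by ring.
    rewrite <- expi_plus. replace (t - s + s) with t by ring. rewrite <- E. apply expi_neg_mul. }
  unfold expi in X. injection X as X1 X2.
  destruct (Rle_lt_or_eq_dec _ _ (proj2 H)) as [L|L].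
  - pose proof (sin_gt_0 (t - s) (proj1 H) L). lra.
  - rewrite L, cos_PI in X1. lra.
Qed.

(** Near a critical point psi - psi a is either zero, so that every ray is a level curve,
    or c z^n (1 + ...) with n >= 2.  In the second case the real part of the leading term vanishes along 2 n >= 4 rays, and each of
    them is tangent to a zero curve; three of them suffice. *)
Lemma critical_level_curves (a : C) (r : R) (psi psi1 : C -> C) : 0 < r ->
  holo a r psi psi1 -> psi1 a = 0 ->
  exists q1 q2 q3 r', 0 < r' <= r /\ Cmod q1 = 1 /\ Cmod q2 = 1 /\ Cmod q3 = 1 /\
    q1 <> q2 /\ q1 <> q3 /\ q2 <> q3 /\
    level_curve (fun z => fst (psi z)) a r' q1 /\
    level_curve (fun z => fst (psi z)) a r' q2 /\
    level_curve (fun z => fst (psi z)) a r' q3.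
Proof.
  intros Hr Dpsi Hcrit.
  set (phi := fun z => (psi (a + 1 * z) - psi a)%C).
  set (phi1 := fun z => (1 * psi1 (a + 1 * z))%C).
  assert (Dphi : holo 0 r phi phi1).
  { intros z Hz. rewrite sub_0_r in Hz.
    apply (cderiv_eq _ _ (1 * psi1 (a + 1 * z) - 0)%C); [unfold phi1; ring|].
    apply (cderiv_minus (fun z => psi (a + 1 * z)%C) (fun _ => psi a)); [|apply cderiv_const].
    apply cderiv_affine, Dpsi. replace (a + 1 * z - a)%C with z by ring. exact Hz. }
  assert (Epsi : forall z, psi (a + z)%C = (phi z + psi a)%C).
  { intros z. unfold phi. replace (a + 1 * z)%C with (a + z)%C by ring. ring. }
  assert (phi0 : phi 0 = 0).
  { unfold phi. replace (a + 1 * 0)%C with a by ring. ring. }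
  assert (phi10 : phi1 0 = 0).
  { unfold phi1. replace (a + 1 * 0)%C with a by ring. rewrite Hcrit. ring. }
  destruct (finite_order r phi phi1 Hr Dphi) as [Z|[n [Hn Hlow]]].
  - (* psi constant near a: every ray is a level curve *)
    exists 1, Ci, (- (1))%C, (r / 4). split; [lra|].
    assert (Ray : forall q, Cmod q = 1 -> level_curve (fun z => fst (psi z)) a (r / 4) q).
    { intros q Hq d Hd. exists (r / 8), (fun _ => 0). split; [lra|]. intros s Hs.
      split; [rewrite Rabs_R0; lra|]. split; [apply continuity_pt_const; intros u v; reflexivity|].
      assert (B : Cmod (near_ray 0 s) < r / 4).
      { unfold near_ray. replace (1 + Ci * 0)%C with (RtoC 1) by ring.
        rewrite Cmod_mult, Cmod_1, Cmod_RtoC_pos by lra. lra. }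
      split; [exact B|]. rewrite Epsi, Z.
      - f_equal. ring.
      - rewrite Cmod_mult, Hq. lra. }
    split; [apply Cmod_1|]. split; [apply Cmod_Ci|]. split; [apply Cmod_m1|].
    split; [|split; [|split; [|split; [|split]]]].
    + intros E. injection E. lra.
    + intros E. injection E. lra.
    + intros E. injection E. lra.
    + apply Ray, Cmod_1.
    + apply Ray, Cmod_Ci.
    + apply Ray, Cmod_m1.
  - assert (Hn2 : (2 <= n)%nat).
    { destruct n as [|[|n]]; [exfalso|exfalso|lia].
      - apply Hn. exact phi0.
      - apply Hn. simpl. rewrite diff_quot_diag.
        rewrite (is_C_derive_unique phi 0 (phi1 0)); [exact phi10|].
        apply Dphi. rewrite Cmod_center. exact Hr. }
    set (k := zero_quotient phi n) in *. set (c := k 0) in *.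
    pose proof (zero_quotient_holo r phi phi1 n Hr Dphi) as Dk. fold k in Dk.
    assert (Ek : forall z, phi z = (z ^ n * k z)%C)
      by (intros z; apply zero_quotient_factor, Hlow).
    (* where the leading term is purely imaginary, the real part of phi is, up to a real factor,
       the imaginary part of a function to which the zero curve lemma applies *)
    assert (Dir : forall q t, Cmod q = 1 -> (c * q ^ n = Ci * RtoC t)%C ->
      level_curve (fun z => fst (psi z)) a r q).
    { intros q t Hq Eq d Hd.
      assert (Dkq : holo 0 r (fun z => / c * k (0 + q * z))%C
         (fun z => / c * (q * C_derive k (0 + q * z)))%C).
      { intros z Hz. apply cderiv_scal, cderiv_affine, Dk.
        rewrite sub_0_r in *. replace (0 + q * z)%C with (q * z)%C by ring.
        rewrite Cmod_mult, Hq. lra. }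
      destruct (zero_curve n _ _ r d ltac:(lia) Hr Hd Dkq) as [s0 [y [Hs0 Hy]]].
      { cbv beta. replace (0 + q * 0)%C with (RtoC 0) by ring. fold c. field. exact Hn. }
      exists s0, y. split; [exact Hs0|]. intros s Hs.
      destruct (Hy s Hs) as [Y1 [Y2 [Y3 Y4]]]. repeat split; try assumption.
      rewrite Epsi, Ek.
      replace (0 + q * near_ray (y s) s)%C with (q * near_ray (y s) s)%C in Y4 by ring.
      set (N := near_ray (y s) s) in *.
      set (w := ((1 + Ci * RtoC (y s)) ^ n * (/ c * k (q * N)))%C) in *.
      replace ((q * N) ^ n * k (q * N))%C with (Ci * RtoC t * (RtoC s ^ n * w))%C.
      - clearbody w. rewrite <- RtoC_pow. destruct w as [wx wy]. simpl in Y4. rewrite Y4.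
        simpl. ring.
      - rewrite <- Eq. unfold w, N, near_ray. rewrite !Cpow_mult_l. field. exact Hn. }
    assert (Hc : 0 < Cmod c) by (apply Cmod_gt_0; exact Hn).
    assert (Hc' : RtoC (Cmod c) <> 0) by (intros E; apply RtoC_inj in E; lra).
    destruct (unit_expi (c / RtoC (Cmod c))) as [beta [_ Eb]].
    { rewrite Cmod_div, Cmod_RtoC_pos by (try exact Hc'; lra). field. lra. }
    assert (Ec : c = (RtoC (Cmod c) * expi beta)%C) by (rewrite <- Eb; field; exact Hc').
    assert (Hn0 : 0 < INR n) by (apply lt_0_INR; lia).
    assert (Hn2' : 2 <= INR n) by (apply (le_INR 2); exact Hn2).
    pose proof PI_RGT_0 as HPI.
    set (ang := fun j : R => (PI / 2 + j * PI - beta) / INR n).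
    assert (Edir : forall j, (c * expi (ang j) ^ n
       = RtoC (Cmod c) * expi (PI / 2 + j * PI))%C).
    { intros j. rewrite expi_pow. rewrite Ec at 1.
      rewrite <- Cmult_assoc, <- expi_plus. do 2 f_equal. unfold ang. field. lra. }
    assert (I0 : expi (PI / 2 + 0 * PI) = Ci).
    { unfold expi. rewrite Rmult_0_l, Rplus_0_r, cos_PI2, sin_PI2. reflexivity. }
    assert (I1 : expi (PI / 2 + 1 * PI) = (Ci * RtoC (-1))%C).
    { rewrite expi_plus, Rmult_1_l. unfold expi. rewrite cos_PI2, sin_PI2, cos_PI, sin_PI.
      reflexivity. }
    assert (I2 : expi (PI / 2 + 2 * PI) = Ci).
    { rewrite expi_plus. unfold expi. rewrite cos_PI2, sin_PI2, cos_2PI, sin_2PI.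
      apply injective_projections; simpl; ring. }
    assert (Step : forall i j, i < j -> j - i <= 2 -> expi (ang i) <> expi (ang j)).
    { intros i j Hij Hji. apply expi_sub_ne.
      replace (ang j - ang i) with ((j - i) * PI / INR n) by (unfold ang; field; lra).
      split.
      - apply Rdiv_lt_0_compat; [apply Rmult_lt_0_compat; lra | lra].
      - apply (Rmult_le_reg_r (INR n)); [lra|]. unfold Rdiv.
        rewrite Rmult_assoc, Rinv_l by lra. nra. }
    exists (expi (ang 0)), (expi (ang 1)), (expi (ang 2)), r. split; [lra|].
    split; [apply Cmod_expi|]. split; [apply Cmod_expi|]. split; [apply Cmod_expi|].
    split; [apply Step; lra|]. split; [apply Step; lra|]. split; [apply Step; lra|].
    split; [|split].
    + apply (Dir _ (Cmod c) (Cmod_expi _)). rewrite Edir, I0. ring.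
    + apply (Dir _ (- Cmod c) (Cmod_expi _)). rewrite Edir, I1.
      replace (- Cmod c) with (-1 * Cmod c) by ring. rewrite RtoC_mult. ring.
    + apply (Dir _ (Cmod c) (Cmod_expi _)). rewrite Edir, I2. ring.
Qed.

Lemma ccont_harmonic (a : C) (r : R) (h h1 g g1 : C -> C) (c z : C) :
  holo a r h h1 -> holo a r g g1 -> Cmod (z - a) < r ->
  ccont (fun w => c * (h w + Cconj (g w)))%C z.
Proof.
  intros Dh Dg Hz eps Heps. pose proof (Cmod_ge_0 c) as Hc.
  destruct (holo_ccont _ _ _ _ z Dh Hz (eps / 2 / (Cmod c + 1))) as [d [Hd B]];
    [repeat apply Rdiv_lt_0_compat; lra|].
  destruct (holo_ccont _ _ _ _ z Dg Hz (eps / 2 / (Cmod c + 1))) as [d' [Hd' B']];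
    [repeat apply Rdiv_lt_0_compat; lra|].
  exists (Rmin d d'). split; [apply Rmin_pos; assumption|]. intros w Hw.
  destruct (lt_Rmin _ _ _ Hw) as [M1 M2].
  pose proof (B w M1) as B1. pose proof (B' w M2) as B2.
  replace (c * (h w + Cconj (g w)) - c * (h z + Cconj (g z)))%C
    with (c * ((h w - h z) + Cconj (g w - g z)))%C by (rewrite Cminus_conj; ring).
  rewrite Cmod_mult.
  pose proof (Cmod_triangle (h w - h z) (Cconj (g w - g z))) as T. rewrite Cmod_conj in T.
  set (x := Cmod (h w - h z + Cconj (g w - g z))) in *.
  assert (Hx0 : 0 <= x) by apply Cmod_ge_0.
  assert (Hx : x < eps / (Cmod c + 1)).
  { replace (eps / (Cmod c + 1)) with (eps / 2 / (Cmod c + 1) + eps / 2 / (Cmod c + 1))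
      by (field; lra). lra. }
  apply (Rmult_lt_compat_r (Cmod c + 1)) in Hx; [|lra].
  unfold Rdiv in Hx. rewrite Rmult_assoc, Rinv_l in Hx by lra. nra.
Qed.

(** If |h' a| = |g' a|, some h + e g with |e| = 1 is critical at a.  With e = c^2 the real part of
    conj c (h + e g) equals that of conj c (h + conj g).  Thus a tripod in a level set of a real linear
    functional of the map starts at a, against injectivity. *)
Theorem lewy (a : C) (r : R) (h h1 g g1 : C -> C) : 0 < r ->
  holo a r h h1 -> holo a r g g1 ->
  (forall z w, Cmod (z - a) < r -> Cmod (w - a) < r ->
     (h z + Cconj (g z) = h w + Cconj (g w))%C -> z = w) ->
  Cmod (h1 a) <> Cmod (g1 a).
Proof.
  intros Hr Dh Dg Inj E.
  assert (Ex : exists t, (h1 a + expi t * g1 a)%C = 0).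
  { destruct (classic (g1 a = 0)) as [Z|Z].
    - exists 0. rewrite Z, Cmod_0 in E. apply Cmod_eq_0 in E. rewrite E, Z. ring.
    - destruct (unit_expi (- (h1 a / g1 a))%C) as [t [_ Et]].
      + rewrite Cmod_opp, Cmod_div, E by exact Z. field.
        apply Rgt_not_eq, Cmod_gt_0, Z.
      + exists t. rewrite <- Et. field. exact Z. }
  destruct Ex as [t Et].
  set (c := expi (t / 2)).
  assert (Ec2 : expi t = (c * c)%C) by (unfold c; rewrite <- expi_plus; f_equal; lra).
  assert (Ecc : (Cconj c * c = 1)%C) by apply expi_neg_mul.
  set (psi := fun z => (Cconj c * h z + c * g z)%C).
  assert (Dpsi : holo a r psi (fun z => Cconj c * h1 z + c * g1 z)%C).
  { intros z Hz. apply (cderiv_plus (fun z => Cconj c * h z)%C (fun z => c * g z)%C);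
      apply cderiv_scal; [apply Dh | apply Dg]; exact Hz. }
  assert (Hcrit : (Cconj c * h1 a + c * g1 a)%C = 0).
  { replace (Cconj c * h1 a + c * g1 a)%C
      with (Cconj c * h1 a + (Cconj c * c) * (c * g1 a))%C by (rewrite Ecc; ring).
    replace (Cconj c * h1 a + (Cconj c * c) * (c * g1 a))%C
      with (Cconj c * (h1 a + (c * c) * g1 a))%C by ring.
    rewrite <- Ec2, Et. ring. }
  destruct (critical_level_curves a r psi _ Hr Dpsi Hcrit)
    as [q1 [q2 [q3 [r' [Hr' [A1 [A2 [A3 [N1 [N2 [N3 [L1 [L2 L3]]]]]]]]]]]]].
  set (W := fun z => (Cconj c * (h z + Cconj (g z)))%C).
  assert (HU : forall z, fst (psi z) = fst (W z)).
  { intros z. unfold psi, W. simpl. ring. }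
  refine (tripod_not_injective (fun z => fst (psi z)) (fun z => snd (W z)) a r' q1 q2 q3
    (proj1 Hr') A1 A2 A3 N1 N2 N3 L1 L2 L3 _ _).
  - intros z Hz eps Heps.
    destruct (ccont_harmonic a r h h1 g g1 (Cconj c) z Dh Dg ltac:(lra) eps Heps)
      as [d [Hd B]].
    exists d. split; [exact Hd|]. intros w Hw. eapply Rle_lt_trans; [|apply (B w Hw)].
    rewrite <- RtoC_minus, Cmod_R. eapply Rle_trans; [|apply im_le_Cmod].
    apply Req_le. reflexivity.
  - intros z w Hz Hw EU EV. apply Inj; [lra | lra |].
    rewrite !HU in EU.
    assert (EW : W z = W w) by (apply injective_projections; assumption).
    unfold W in EW.
    replace (h z + Cconj (g z))%C with (Cconj c * c * (h z + Cconj (g z)))%C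
      by (rewrite Ecc; ring).
    replace (h w + Cconj (g w))%C with (Cconj c * c * (h w + Cconj (g w)))%C
      by (rewrite Ecc; ring).
    replace (Cconj c * c * (h z + Cconj (g z)))%C
      with (c * (Cconj c * (h z + Cconj (g z))))%C by ring.
    rewrite EW. ring.
Qed.

(** * The bound for univalent maps and its converse *)

Lemma sign_constant (a : C) (r : R) (u u1 v v1 : C -> C) : holo a r u u1 -> holo a r v v1 ->
  (forall z, Cmod (z - a) < r -> Cmod (u z) <> Cmod (v z)) ->
  Cmod (v a) < Cmod (u a) -> forall z, Cmod (z - a) < r -> Cmod (v z) < Cmod (u z).
Proof.
  intros Du Dv Hne Ha z Hz.
  assert (Haa : Cmod (a - a) < r).
  { rewrite Cmod_center. eapply Rle_lt_trans; [apply Cmod_ge_0 | exact Hz]. }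
  assert (In : forall t, 0 <= t <= 1 -> Cmod (a + RtoC t * (z - a) - a) < r)
    by (intros t Ht; apply ball_convex; assumption).
  destruct (Rtotal_order (Cmod (v z)) (Cmod (u z))) as [L|[L|L]]; [exact L | |].
  - exfalso. apply (Hne z Hz). auto.
  - exfalso.
    destruct (IVT_interv (fun t => Cmod (v (a + RtoC t * (z - a))%C)
      - Cmod (u (a + RtoC t * (z - a))%C)) 0 1) as [t [Ht E]].
    + intros t Ht. apply continuity_pt_minus.
      * apply (continuity_pt_Cmod (fun t => v (a + RtoC t * (z - a))%C)), pcont_line.
        eapply holo_ccont; [exact Dv | apply In, Ht].
      * apply (continuity_pt_Cmod (fun t => u (a + RtoC t * (z - a))%C)), pcont_line.
        eapply holo_ccont; [exact Du | apply In, Ht].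
    + lra.
    + replace (a + 0 * (z - a))%C with a by ring. lra.
    + replace (a + 1 * (z - a))%C with z by ring. lra.
    + apply (Hne _ (In t Ht)). lra.
Qed.

(** Lewy's theorem gives the nonvanishing and, the disk being connected, a fixed
    orientation; passing to the complex conjugate map exchanges the two orientations. *)
Theorem univalent_rotated_bound : exists K, 0 < K /\
  forall (a : C) (r : R) (h h1 h2 g g1 g2 : C -> C) (e : C), 0 < r -> Cmod e = 1 ->
  holo a r h h1 -> holo a r h1 h2 -> holo a r g g1 -> holo a r g1 g2 ->
  (forall z w, Cmod (z - a) < r -> Cmod (w - a) < r ->
     (h z + Cconj (g z) = h w + Cconj (g w))%C -> z = w) ->
  (h1 a + e * g1 a)%C <> 0 /\
  Cmod (h2 a + e * g2 a) <= K / r * Cmod (h1 a + e * g1 a).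
Proof.
  destruct rotated_bound_of_lt as [K [HK B]]. exists K. split; [exact HK|].
  intros a r h h1 h2 g g1 g2 e Hr He Dh Dh1 Dg Dg1 Inj.
  assert (Haa : Cmod (a - a) < r) by (rewrite Cmod_center; exact Hr).
  assert (Hne : forall z, Cmod (z - a) < r -> Cmod (h1 z) <> Cmod (g1 z)).
  { intros z Hz. apply (lewy z (r - Cmod (z - a)) h h1 g g1).
    - lra.
    - apply (holo_sub a z r); [exact Dh | lra].
    - apply (holo_sub a z r); [exact Dg | lra].
    - intros u w Hu Hw. apply Inj.
      + pose proof (Cmod_sub_triangle u z a). lra.
      + pose proof (Cmod_sub_triangle w z a). lra. }
  split.
  - intros E. apply (Hne a Haa).
    replace (h1 a) with (- (e * g1 a))%C.
    + rewrite Cmod_opp, Cmod_mult, He. ring.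
    + replace (h1 a) with ((h1 a + e * g1 a) - e * g1 a)%C by ring. rewrite E. ring.
  - destruct (Rtotal_order (Cmod (g1 a)) (Cmod (h1 a))) as [L|[L|L]].
    + apply (B a r h h1 h2 g g1 g2 e); try assumption.
      apply (sign_constant a r h1 h2 g1 g2); assumption.
    + exfalso. apply (Hne a Haa). auto.
    + assert (Hlt : forall z, Cmod (z - a) < r -> Cmod (h1 z) < Cmod (g1 z)).
      { apply (sign_constant a r g1 g2 h1 h2); try assumption.
        intros z Hz E. apply (Hne z Hz). auto. }
      assert (Ec : (e * Cconj e = 1)%C) by (rewrite <- Cmod_sq, He; f_equal; ring).
      assert (Sw : forall x y, Cmod (x + e * y) = Cmod (y + Cconj e * x)).
      { intros x y. replace (x + e * y)%C with (e * (y + Cconj e * x))%C.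
        - rewrite Cmod_mult, He. ring.
        - replace (e * (y + Cconj e * x))%C with (e * y + (e * Cconj e) * x)%C by ring.
          rewrite Ec. ring. }
      rewrite !Sw. apply (B a r g g1 g2 h h1 h2); try assumption.
      * rewrite Cmod_conj. exact He.
      * intros z w Hz Hw E. apply Inj; [exact Hz | exact Hw |].
        apply (f_equal Cconj) in E. rewrite !Cplus_conj, !Cconj_conj in E.
        rewrite (Cplus_comm (h z)), (Cplus_comm (h w)). exact E.
Qed.

(** The derivative deviates from its central value by at most half of it, so f
    is a small Lipschitz perturbation of an injective linear map. *)
Lemma injective_of_small_pre_schwarzian (a : C) (r K : R) (f f1 f2 : C -> C) :
  0 < r -> 0 <= K -> K * r <= / 4 -> holo a r f f1 -> holo a r f1 f2 -> f1 a <> 0 ->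
  (forall z, Cmod (z - a) < r -> Cmod (f2 z) <= K * Cmod (f1 z)) ->
  forall z w, Cmod (z - a) < r -> Cmod (w - a) < r -> f z = f w -> z = w.
Proof.
  intros Hr HK HKr Df Df1 Hn B z w Hz Hw E.
  pose proof (proj1 (Cmod_gt_0 _) Hn) as Np.
  assert (D : holo a r (fun u => f u - f1 a * u)%C (fun u => f1 u - f1 a * 1)%C).
  { intros u Hu. apply (cderiv_minus f (fun u => f1 a * u)%C); [apply Df, Hu|].
    apply (cderiv_scal (f1 a) (fun u => u)), cderiv_id. }
  pose proof (mean_value_ball a r _ _ (Cmod (f1 a) / 2) D) as MV. cbv beta in MV.
  assert (MV' : Cmod (f z - f1 a * z - (f w - f1 a * w)) <= Cmod (f1 a) / 2 * Cmod (z - w)).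
  { apply MV; [|exact Hz | exact Hw]. intros u Hu.
    replace (f1 u - f1 a * 1)%C with (f1 u - f1 a)%C by ring.
    eapply Rle_trans; [apply (gronwall_ball a r K f1 f2 Hr HK ltac:(lra) Df1 B u Hu)|].
    assert (K * Cmod (u - a) <= / 4).
    { eapply Rle_trans; [|exact HKr]. apply Rmult_le_compat_l; lra. }
    nra. }
  rewrite E in MV'.
  replace (f w - f1 a * z - (f w - f1 a * w))%C with (f1 a * - (z - w))%C in MV' by ring.
  rewrite Cmod_mult, Cmod_opp in MV'. pose proof (Cmod_ge_0 (z - w)).
  assert (Z : Cmod (z - w) = 0) by nra.
  apply Cmod_eq_0 in Z. replace z with ((z - w) + w)%C by ring. rewrite Z. ring.
Qed.

(** * Hyperbolic and Euclidean disks *)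

Lemma pseudo_hyp_dist_eq (z w : C) : Cmod z < 1 -> Cmod w < 1 ->
  0 < Cmod (1 - Cconj z * w) /\
  pseudo_hyp_dist z w * Cmod (1 - Cconj z * w) = Cmod (z - w).
Proof.
  intros Hz Hw. pose proof (mobius_lt z w Hz Hw) as M. pose proof (Cmod_ge_0 (z - w)).
  assert (P : 0 < Cmod (1 - Cconj z * w)) by lra. split; [exact P|].
  unfold pseudo_hyp_dist. rewrite Cmod_div by (apply Cmod_gt_0; exact P). field. lra.
Qed.

Lemma pseudo_hyp_dist_bounds (z w : C) : Cmod z < 1 -> Cmod w < 1 ->
  0 <= pseudo_hyp_dist z w < 1.
Proof.
  intros Hz Hw. destruct (pseudo_hyp_dist_eq z w Hz Hw) as [P E].
  pose proof (mobius_lt z w Hz Hw) as M. split; [apply Cmod_ge_0|]. nra.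
Qed.

Lemma mobius_denominator (z a : C) :
  (1 - Cconj z * a = RtoC (1 - Cmod a ^ 2) - Cconj (z - a) * a)%C.
Proof. rewrite RtoC_minus, Cmod_sq, Cminus_conj. ring. Qed.

(** Near a, the denominator of the pseudo-hyperbolic distance is 1 - |a|^2 up to |z - a|;
    this is why hyperbolic disks of fixed radius compare with Euclidean disks of radius proportional
    to 1 - |a|^2. *)
Lemma mobius_denominator_dist (z a : C) : Cmod a < 1 ->
  Rabs (Cmod (1 - Cconj z * a) - (1 - Cmod a ^ 2)) <= Cmod (z - a).
Proof.
  intros Ha. rewrite mobius_denominator. pose proof (Cmod_ge_0 a) as A0.
  set (d := 1 - Cmod a ^ 2). assert (Hd : 0 <= d) by (unfold d; nra).
  pose proof (Cmod_minus_le (RtoC d) (Cconj (z - a) * a)) as T1.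
  pose proof (Cmod_reverse_triangle (RtoC d) (Cconj (z - a) * a)) as T2.
  rewrite Cmod_mult, Cmod_conj, Cmod_RtoC_pos in T1, T2 by exact Hd.
  pose proof (Cmod_ge_0 (z - a)). apply Rabs_le. nra.
Qed.

Lemma ball_in_hyp_disk (rho : Rbar) : Rbar_lt 0 rho -> exists c, 0 < c <= / 4 /\
  forall a z, in_disk a -> Cmod (z - a) < c * (1 - Cmod a ^ 2) -> hyp_disk a rho z.
Proof.
  intros Hrho.
  assert (R0 : exists r0 : R, 0 < r0 /\ Rbar_le r0 rho).
  { destruct rho as [x| |].
    - exists x. split; [exact Hrho | apply Rbar_le_refl].
    - exists 1. split; [lra | exact I].
    - contradiction. }
  destruct R0 as [r0 [Hr0 Hle]].
  exists (Rmin (/ 4) (r0 / 8)). split.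
  { split; [apply Rmin_pos; lra | apply Rmin_l]. }
  intros a z Ha Hz. unfold in_disk in Ha. pose proof (Cmod_ge_0 a) as A0.
  set (c := Rmin (/ 4) (r0 / 8)) in *.
  assert (Hc : 0 < c) by (unfold c; apply Rmin_pos; lra).
  assert (Hc4 : c <= / 4) by apply Rmin_l. assert (Hc8 : c <= r0 / 8) by apply Rmin_r.
  clearbody c. set (d := 1 - Cmod a ^ 2) in *.
  assert (Hd : 0 < d) by (unfold d; nra).
  assert (Hd2 : d <= 2 * (1 - Cmod a)) by (unfold d; nra).
  assert (Hz1 : Cmod z < 1).
  { pose proof (Cmod_reverse_triangle z a). nra. }
  split; [exact Hz1|].
  apply (Rbar_lt_le_trans _ (Finite r0)); [|exact Hle]. simpl.
  destruct (pseudo_hyp_dist_eq z a Hz1 Ha) as [P E].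
  pose proof (pseudo_hyp_dist_bounds z a Hz1 Ha) as [B0 B1].
  set (p := pseudo_hyp_dist z a) in *.
  assert (Hp : p <= 2 * c).
  { pose proof (mobius_denominator_dist z a Ha) as M. fold d in M.
    apply Rabs_le_between in M.
    assert (d / 2 <= Cmod (1 - Cconj z * a)) by nra.
    apply Rnot_lt_le. intros L. nra. }
  unfold hyp_dist. fold p.
  assert (X : (1 + p) / (1 - p) <= exp (4 * p)).
  { eapply Rle_trans; [|apply exp_ineq1_le].
    apply (Rmult_le_reg_r (1 - p)); [lra|]. unfold Rdiv.
    rewrite Rmult_assoc, Rinv_l by lra. nra. }
  assert (Y : ln ((1 + p) / (1 - p)) <= 4 * p).
  { rewrite <- (ln_exp (4 * p)). apply ln_le; [|exact X]. apply Rdiv_lt_0_compat; lra. }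
  lra.
Qed.

Lemma hyp_disk_in_ball (c : R) : 0 < c <= / 2 -> exists rho : R, 0 < rho /\
  forall a z, in_disk a -> hyp_disk a rho z -> Cmod (z - a) < c * (1 - Cmod a ^ 2).
Proof.
  intros Hc. set (p0 := c / 2).
  assert (Hp0 : 0 < p0 <= / 4) by (unfold p0; lra).
  exists (/ 2 * ln ((1 + p0) / (1 - p0))). split.
  { apply Rmult_lt_0_compat; [lra|]. rewrite <- ln_1. apply ln_increasing; [lra|].
    apply (Rmult_lt_reg_r (1 - p0)); [lra|]. unfold Rdiv.
    rewrite Rmult_assoc, Rinv_l by lra. lra. }
  intros a z Ha [Hz Hh]. unfold in_disk in *. simpl in Hh. unfold hyp_dist in Hh.
  destruct (pseudo_hyp_dist_eq z a Hz Ha) as [P E].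
  pose proof (pseudo_hyp_dist_bounds z a Hz Ha) as [B0 B1].
  set (p := pseudo_hyp_dist z a) in *.
  assert (Hp : p < p0).
  { apply Rnot_le_lt. intros L.
    assert (ln ((1 + p0) / (1 - p0)) <= ln ((1 + p) / (1 - p))); [|lra].
    apply ln_le; [apply Rdiv_lt_0_compat; lra|].
    apply (Rmult_le_reg_r ((1 - p0) * (1 - p))); [apply Rmult_lt_0_compat; lra|].
    replace ((1 + p0) / (1 - p0) * ((1 - p0) * (1 - p))) with ((1 + p0) * (1 - p)) by (field; lra).
    replace ((1 + p) / (1 - p) * ((1 - p0) * (1 - p))) with ((1 + p) * (1 - p0)) by (field; lra).
    nra. }
  pose proof (Cmod_ge_0 a) as A0. pose proof (mobius_denominator_dist z a Ha) as M.
  set (d := 1 - Cmod a ^ 2) in *. assert (Hd : 0 < d) by (unfold d; nra).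
  apply Rabs_le_between in M. pose proof (Cmod_ge_0 (z - a)) as Z0.
  assert (Cmod (z - a) <= p0 * (d + Cmod (z - a))).
  { rewrite <- E at 1. apply Rmult_le_compat; lra. }
  unfold p0 in *. nra.
Qed.

Lemma analytic_holo (h : C -> C) : analytic_in_disk h ->
  holo 0 1 h (C_derive h) /\ holo 0 1 (C_derive h) (C_derive (C_derive h)).
Proof.
  intros H.
  assert (D : holo 0 1 h (C_derive h)).
  { intros z Hz. rewrite sub_0_r in Hz. apply C_derive_correct; [exact z | apply H, Hz]. }
  split; [exact D | apply (holo_derivative _ _ _ _ D)].
Qed.

Lemma small_ball_in_disk (a : C) (c : R) : in_disk a -> 0 <= c <= / 4 ->
  Cmod (a - 0) + c * (1 - Cmod a ^ 2) <= 1 /\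
  forall z, Cmod (z - a) < c * (1 - Cmod a ^ 2) ->
    Cmod z < 1 /\ (1 - Cmod a ^ 2) / 4 <= 1 - Cmod z ^ 2.
Proof.
  intros Ha Hc. unfold in_disk in Ha. pose proof (Cmod_ge_0 a) as A0. rewrite sub_0_r.
  set (d := 1 - Cmod a ^ 2). assert (Hd : 0 < d <= 1) by (unfold d; nra).
  assert (Hd2 : d <= 2 * (1 - Cmod a)) by (unfold d; nra).
  split; [nra|]. intros z Hz. pose proof (Cmod_ge_0 z) as Z0.
  assert (T : Cmod z < Cmod a + c * d) by (pose proof (Cmod_reverse_triangle z a); lra).
  assert (Hcd : 0 <= c * d <= d / 4) by nra.
  split; [lra|].
  assert (Cmod z ^ 2 <= (Cmod a + c * d) ^ 2) by (apply pow_incr; lra).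
  assert ((Cmod a + c * d) ^ 2 <= Cmod a ^ 2 + 3 * (c * d)) by nra.
  unfold d in *. lra.
Qed.

(** * The two implications *)

(** On the ball of radius c (1 - |a|^2) about a the map is injective, so the rotated
    pre-Schwarzian at a is at most a constant over that radius. *)
Lemma norm_finite_of_univalent (f h g : C -> C) : harmonic_mapping f h g ->
  uniformly_locally_univalent f -> Rbar_lt (pre_schwarzian_norm h g) p_infty.
Proof.
  intros [Hh [Hg Hf]] [rho [Hrho Huniv]].
  destruct (analytic_holo h Hh) as [Dh Dh1]. destruct (analytic_holo g Hg) as [Dg Dg1].
  destruct univalent_rotated_bound as [K [HK B]].
  destruct (ball_in_hyp_disk rho Hrho) as [c [Hc Hball]].
  assert (Main : forall a t, in_disk a ->
    rotated_sum t (C_derive h a) (C_derive g a) <> 0 /\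
    pre_schwarzian_value h g a t <= K / c).
  { intros a t Ha. destruct (small_ball_in_disk a c Ha ltac:(lra)) as [S1 S2].
    set (d := 1 - Cmod a ^ 2) in *.
    assert (Hd : 0 < d).
    { unfold d. unfold in_disk in Ha. pose proof (Cmod_ge_0 a). nra. }
    destruct (B a (c * d) h (C_derive h) (C_derive (C_derive h)) g (C_derive g)
      (C_derive (C_derive g)) (expi t)) as [B1 B2].
    - apply Rmult_lt_0_compat; lra.
    - apply Cmod_expi.
    - apply (holo_sub 0 a 1); assumption.
    - apply (holo_sub 0 a 1); assumption.
    - apply (holo_sub 0 a 1); assumption.
    - apply (holo_sub 0 a 1); assumption.
    - intros z w Hz Hw E. apply (Huniv a Ha); [apply Hball; assumption.. |].
      rewrite (Hf z), (Hf w) by (apply (S2 _); assumption). exact E.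
    - split; [exact B1|]. unfold pre_schwarzian_value, rotated_sum. fold d.
      rewrite Cmod_div by exact B1. pose proof (proj1 (Cmod_gt_0 _) B1) as P.
      apply (Rmult_le_reg_r (Cmod (C_derive h a + expi t * C_derive g a) / d)).
      + apply Rdiv_lt_0_compat; assumption.
      + match goal with |- d * (?x / ?y) * (?y / d) <= _ =>
          replace (d * (x / y) * (y / d)) with x by (field; lra) end.
        eapply Rle_trans; [exact B2|]. apply Req_le. field. lra. }
  unfold pre_schwarzian_norm.
  destruct excluded_middle_informative as [[z [t [Hz [_ Ht]]]]|_].
  - exfalso. apply (proj1 (Main z t Hz)). exact Ht.
  - eapply Rbar_le_lt_trans; [|exact (I : Rbar_lt (Finite (K / c)) p_infty)].
    apply Lub_Rbar_correct. intros x [z [t [Hz [_ ->]]]]. simpl. apply Main, Hz.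
Qed.

(** If f z = f w, then h z - h w and g z - g w have equal moduli, so some rotation
    h + e^(i t) g takes equal values at z and w; but all rotations have small pre-Schwarzian on the
    ball and are injective there. *)
Lemma univalent_of_norm_finite (f h g : C -> C) : harmonic_mapping f h g ->
  Rbar_lt (pre_schwarzian_norm h g) p_infty -> uniformly_locally_univalent f.
Proof.
  intros [Hh [Hg Hf]] Hn.
  destruct (analytic_holo h Hh) as [Dh Dh1]. destruct (analytic_holo g Hg) as [Dg Dg1].
  unfold pre_schwarzian_norm in Hn.
  destruct excluded_middle_informative as [_|Hdeg]; [contradiction|].
  set (S := fun x : R => exists z t, in_disk z /\ 0 <= t <= 2 * PI /\
    x = pre_schwarzian_value h g z t) in *.
  assert (HM : exists M, 0 <= M /\ forall z t, in_disk z -> 0 <= t <= 2 * PI ->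
    pre_schwarzian_value h g z t <= M).
  { pose proof (proj1 (Lub_Rbar_correct S)) as U. unfold is_ub_Rbar in U.
    destruct (Lub_Rbar S) as [M| |].
    - exists (Rmax 0 M). split; [apply Rmax_l|]. intros z t Hz Ht.
      eapply Rle_trans; [|apply Rmax_r]. apply (U (pre_schwarzian_value h g z t)).
      exists z, t. auto.
    - contradiction.
    - exists 0. split; [lra|]. intros z t Hz Ht. exfalso.
      apply (U (pre_schwarzian_value h g z t)). exists z, t. auto. }
  destruct HM as [M [HM0 HM]].
  set (c := Rmin (/ 4) (/ (16 * (M + 1)))).
  assert (Hc : 0 < c) by (unfold c; apply Rmin_pos; [|apply Rinv_0_lt_compat]; lra).
  assert (Hc4 : c <= / 4) by apply Rmin_l.
  assert (HcM : 4 * M * c <= / 4).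
  { assert (c <= / (16 * (M + 1))) by apply Rmin_r.
    assert (4 * M * c <= 4 * M * / (16 * (M + 1))) by (apply Rmult_le_compat_l; lra).
    assert (4 * M * / (16 * (M + 1)) <= 4 * (M + 1) * / (16 * (M + 1))).
    { apply Rmult_le_compat_r; [left; apply Rinv_0_lt_compat|]; lra. }
    assert (4 * (M + 1) * / (16 * (M + 1)) = / 4) by (field; lra). lra. }
  clearbody c.
  destruct (hyp_disk_in_ball c ltac:(lra)) as [rho [Hrho Hball]].
  exists rho. split; [exact Hrho|]. intros a Ha z w Hz Hw E.
  destruct (small_ball_in_disk a c Ha ltac:(lra)) as [S1 S2].
  pose proof (Hball a z Ha Hz) as Bz. pose proof (Hball a w Ha Hw) as Bw.
  set (d := 1 - Cmod a ^ 2) in *.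
  assert (Hd : 0 < d).
  { unfold d. unfold in_disk in Ha. pose proof (Cmod_ge_0 a). nra. }
  rewrite (Hf z), (Hf w) in E by (apply (S2 _); assumption).
  assert (Ex : exists t, 0 <= t <= 2 * PI /\
    (h z + expi t * g z = h w + expi t * g w)%C).
  { assert (E' : (h z - h w)%C = (- Cconj (g z - g w))%C).
    { rewrite Cminus_conj.
      replace (h z) with ((h z + Cconj (g z)) - Cconj (g z))%C by ring. rewrite E. ring. }
    destruct (classic (g z = g w)) as [G|G].
    - exists 0. split; [pose proof PI_RGT_0; lra|]. rewrite G. rewrite G in E'.
      replace (h z) with ((h z - h w) + h w)%C by ring. rewrite E'.
      rewrite Cminus_conj. ring.
    - pose proof (Cminus_nz _ _ G) as N. pose proof (proj1 (Cmod_gt_0 _) N) as Np.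
      destruct (unit_expi (- ((h z - h w) / (g z - g w)))%C) as [t [Ht Et]].
      + rewrite E', Cmod_opp, Cmod_div, Cmod_opp, Cmod_conj by exact N. field. lra.
      + exists t. split; [exact Ht|]. rewrite <- Et. field. exact N. }
  destruct Ex as [t [Ht Et]].
  assert (Rot : forall u u1 v v1, holo 0 1 u u1 -> holo 0 1 v v1 ->
    holo a (c * d) (fun y => u y + expi t * v y)%C (fun y => u1 y + expi t * v1 y)%C).
  { intros u u1 v v1 Du Dv. apply (holo_sub 0 a 1); [|exact S1]. intros y Hy.
    apply (cderiv_plus u (fun y => expi t * v y)%C); [apply Du, Hy | apply cderiv_scal, Dv, Hy]. }
  assert (ND : forall y, in_disk y -> (C_derive h y + expi t * C_derive g y)%C <> 0).
  { intros y Hy X. apply Hdeg. exists y, t. auto. }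
  apply (injective_of_small_pre_schwarzian a (c * d) (4 * M / d)
    (fun y => h y + expi t * g y)%C (fun y => C_derive h y + expi t * C_derive g y)%C
    (fun y => C_derive (C_derive h) y + expi t * C_derive (C_derive g) y)%C).
  - apply Rmult_lt_0_compat; lra.
  - apply Rdiv_le_0_compat; lra.
  - replace (4 * M / d * (c * d)) with (4 * M * c) by (field; lra). exact HcM.
  - apply Rot; assumption.
  - apply Rot; assumption.
  - apply ND, Ha.
  - intros y Hy. destruct (S2 y Hy) as [Y1 Y2].
    pose proof (HM y t Y1 Ht) as V. unfold pre_schwarzian_value, rotated_sum in V.
    pose proof (ND y Y1) as N. pose proof (proj1 (Cmod_gt_0 _) N) as Np.
    rewrite Cmod_div in V by exact N.
    set (X := Cmod (C_derive (C_derive h) y + expi t * C_derive (C_derive g) y)) in *.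
    set (Y := Cmod (C_derive h y + expi t * C_derive g y)) in *.
    assert (X0 : 0 <= X) by apply Cmod_ge_0.
    assert (XY : 0 <= X / Y) by (apply Rdiv_le_0_compat; lra).
    assert (Q : d / 4 * (X / Y) <= M) by (eapply Rle_trans; [|exact V]; apply Rmult_le_compat_r; assumption).
    apply (Rmult_le_reg_l (d / 4 / Y)); [repeat apply Rdiv_lt_0_compat; lra|].
    replace (d / 4 / Y * X) with (d / 4 * (X / Y)) by (field; lra).
    replace (d / 4 / Y * (4 * M / d * Y)) with M by (field; lra). exact Q.
  - exact Bz.
  - exact Bw.
  - exact Et.
Qed.

Theorem theorem2p1 (f h g : C -> C) (Hf : harmonic_mapping f h g) :
  uniformly_locally_univalent f <-> Rbar_lt (pre_schwarzian_norm h g) p_infty.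
Proof.
  split.
  - apply norm_finite_of_univalent, Hf.
  - apply univalent_of_norm_finite, Hf.
Qed.
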